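(* Let $u$ be a harmonic function on the unit disc $\mathbb{D}$. Assume that: (1) there exist a lower semicontinuous function $f:\mathbb{D}\to\mathbb{R}_+$, a measurable function $g:\mathbb{D}\to\mathbb{R}_+$ and some $\theta\in(0,\frac{\pi}{2})$ such that (i) $|u(z)|\le f(z)\,g(z)$ for every $z\in\mathbb{D}$; (ii) $\displaystyle\lim_{z\to e^{i\varphi},\ z\in\Omega_\theta(\varphi)} f(z)=0$ for every $\varphi\in[0,2\pi)$; (iii) $\displaystyle\sup_{r\in(0,1)}\int_0^{2\pi} g(re^{i\varphi})\,d\varphi<\infty$; (2) there exists $m\ge 0$ such that $M_r(u)=O\big((1-r)^{-m}\big)$ as $r\to 1-$. Then $u=0$.
   Context: $\mathbb{D}$ is the open unit disc in $\mathbb{C}$ and $\mathbb{R}_+=[0,\infty)$. For $\theta\in(0,\frac{\pi}{2})$ and $\varphi\in[0,2\pi)$, $\Omega_\theta(\varphi):=\{z\in\mathbb{D}: |\arg(1-e^{-i\varphi}z)|\le\frac{\pi}{2}-\theta\}$. For $r\in[0,1)$, $M_r(u):=\sup_{\varphi\in[0,2\pi)}|u(re^{i\varphi})|$. *)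

(* Defs.v *)
From HB Require Import structures.
From mathcomp Require Import all_boot all_order all_algebra.
From mathcomp Require Import complex.
From mathcomp Require Import all_classical all_reals all_analysis.

Set Implicit Arguments.
Unset Strict Implicit.
Unset Printing Implicit Defensive.

Import Order.TTheory GRing.Theory Num.Theory numFieldNormedType.Exports.

Local Open Scope classical_set_scope.
Local Open Scope ring_scope.
Local Open Scope complex_scope.

(* The complex plane, as the domain of functions, is R * R: the topology,
   the (Borel) sigma-algebra and the directional derivatives are those of the
   product.  [toC] is the identification with R[i], used for the algebra. *)

Section plane.
Variable R : realType.
Implicit Types (z : R * R) (c : R[i]) (U : set (R * R)) (h : R * R -> R).

Definition toC z : R[i] := z.1 +i* z.2.

Definition cmod c : R := ComplexField.Normc.normc c.

Definition expi (t : R) : R[i] := cos t +i* sin t.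

Definition polar (r phi : R) : R * R := (r * cos phi, r * sin phi).

(* Principal argument, in ]-pi, pi]; the value at c = 0 is junk. *)
Definition carg c : R :=
  let t := acos (complex.Re c / cmod c) in
  if 0 <= complex.Im c then t else - t.

Lemma cargP c : c != 0 ->
  c = (cmod c)%:C * expi (carg c) /\ - pi < carg c <= pi.
Proof.
case: c => a b; rewrite /carg /cmod /expi /=.
set n := Num.sqrt _ => c0.
have s0 : 0 < a ^+ 2 + b ^+ 2.
  rewrite lt_neqAle addr_ge0 ?sqr_ge0// andbT eq_sym paddr_eq0 ?sqr_ge0//.
  rewrite !sqrf_eq0; apply: contra c0 => /andP[/eqP -> /eqP ->].
  by rewrite eqxx.
have n0 : 0 < n by rewrite sqrtr_gt0.
have n2 : n ^+ 2 = a ^+ 2 + b ^+ 2 by rewrite sqr_sqrtr// ltW.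
have q2 : 1 - (a / n) ^+ 2 = (b / n) ^+ 2.
  rewrite !expr_div_n -[X in X - _](@divff _ (n ^+ 2)) ?lt0r_neq0 ?exprn_gt0//.
  by rewrite -mulrBl n2 addrC addKr.
have q1 : -1 <= a / n <= 1.
  by rewrite -ler_norml -(@ler_pXn2r _ 2) ?nnegrE// expr1n real_normK ?num_real//
     -subr_ge0 q2 sqr_ge0.
have sE : sin (acos (a / n)) = `|b| / n.
  by rewrite sin_acos// q2 sqrtr_sqr normrM normfV (gtr0_norm n0).
have nN : n * (`|b| / n) = `|b| by rewrite mulrC divfK// gt_eqF.
have nA : n * (a / n) = a by rewrite mulrC divfK// gt_eqF.
have mulE (t : R) : n%:C * (cos t +i* sin t) = (n * cos t) +i* (n * sin t).
  by rewrite /GRing.mul /= !mul0r subr0 addr0.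
case: (leP 0 b) => b0; rewrite mulE ?cosN ?sinN acosK// sE.
- by rewrite nA nN ger0_norm// acos_lepi// andbT (lt_le_trans _ (acos_ge0 _))// oppr_lt0 pi_gt0.
- rewrite nA mulrN nN ltr0_norm// opprK; split=> //.
  rewrite ltrN2 (le_trans (y := 0)) ?pi_ge0 ?oppr_le0 ?acos_ge0// andbT.
  rewrite lt_neqAle acos_lepi// andbT; apply/eqP => pE.
  move: sE; rewrite pE sinpi => /esym/eqP; rewrite mulf_eq0 invr_eq0 normr_eq0.
  by rewrite (lt_eqF b0) (gt_eqF n0).
Qed.

Definition disc : set (R * R) := [set z | cmod (toC z) < 1].

Definition stolz (theta phi : R) : set (R * R) :=
  disc `&` [set z | `|carg (1 - expi (- phi) * toC z)| <= pi / 2 - theta].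

Definition e1 : R * R := (1, 0).
Definition e2 : R * R := (0, 1).

Definition C1_on U h := forall z, U z ->
  [/\ derivable h z e1, derivable h z e2,
      {for z, continuous (fun w => 'D_e1 h w)} &
      {for z, continuous (fun w => 'D_e2 h w)}].

Definition C2_on U h :=
  [/\ C1_on U h, C1_on U (fun w => 'D_e1 h w) & C1_on U (fun w => 'D_e2 h w)].

Definition laplacian h z : R :=
  'D_e1 (fun w => 'D_e1 h w) z + 'D_e2 (fun w => 'D_e2 h w) z.

(* U is meant to be open, so that the derivatives at points of U do not depend
   on the values of h outside U. *)
Definition harmonic_on U h :=
  C2_on U h /\ forall z, U z -> laplacian h z = 0.

(* Real-valued functions are covered, as those with zero imaginary part. *)
Definition charmonic_on U (u : R * R -> R[i]) :=
  harmonic_on U (fun z => complex.Re (u z)) /\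
  harmonic_on U (fun z => complex.Im (u z)).

(* A supremum of reals is enough: for u harmonic on the disc and 0 <= r < 1, the
   set is bounded, by continuity of u on the compact circle. *)
Definition circle_sup (u : R * R -> R[i]) (r : R) : R :=
  sup [set cmod (u (polar r phi)) | phi in `[0, 2 * pi[ ].

(* In \bar R, so that g(r e^(i phi)) is not assumed integrable beforehand. *)
Definition circle_integral (g : R * R -> R) (r : R) : \bar R :=
  (\int[lebesgue_measure]_(phi in `[0%R, (2 * pi)%R]) (g (polar r phi))%:E)%E.

End plane.

(* Main.v *)
Require Import Defs.
From HB Require Import structures.
From mathcomp Require Import all_boot all_order all_algebra.
From mathcomp Require Import complex.
From mathcomp Require Import all_classical all_reals all_analysis.
From mathcomp Require Import measurable_realfun ring lra.

(** Write [u] in logarithmic polar coordinates, [U x y = u (e^(-y) e^(ix))], for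
    the real and the imaginary part separately. This is a harmonic function on
    the half-plane [y > 0], periodic in [x], of growth [O(y^-E)] at the boundary;
    Stolz regions contain the images of vertical cones; [f] tends to zero in the
    cones, and the integrals of [g] over horizontal intervals of length 2 are
    bounded. It is to be shown that [U] vanishes.

    The only tool is the Poisson semigroup ([poisson_reproduction]): values at a
    height are averages of values at smaller heights. Multiplying the Poisson
    kernel of height [e] by factors [(a^2 - 1) e^2 / (t^2 + (e a)^2)] gives, by
    partial fractions, a combination of the Poisson kernels of heights [e] and
    [e a], of better decay. This has two consequences. With many nodes [a] it
    shows that values of [U] can be extrapolated, up to a small error, from those
    far above ([vertical_extrapolation]). With few of them, spread so that the
    coefficients are small, it localises: averaged against weights that are
    smooth enough, a harmonic function of polynomial growth remains bounded near
    the boundary ([moment_growth_bounded]), so that the part of the kernel outside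
    an interval only contributes a small error ([local_reproduction]).

    Call a boundary point regular if [U] is [O(y)] near it ([lin_vanish]), and
    exceptional otherwise. If there were exceptional points then, by Baire's
    theorem ([flat_portion]), some portion of the exceptional set would consist of
    points over which [|U| <= g] in cones of a common height. Weighted integrals
    of [|U|] along horizontal lines over this portion are then bounded
    ([mass_bounded]). Near the exceptional set, values are extrapolated from
    heights at which the point lies in such a cone, and are bounded by means of
    the integral of [g]. Away from it, local reproduction leaves only small
    multiples of the same integrals, as [U] vanishes at regular points. In both
    cases a bound [A] improves to [C + A / 4].

    The mass of [|U|] over the portion even tends to zero along some heights
    ([mass_vanishes]). For its limit, a positive functional, an argument like the
    proof of Egorov's theorem shows that up to a small part it is carried by the
    points over which [f <= e] in cones of a common height. Near these points the
    mass is [O(e)]. Farther from them than the aperture of the cones at a given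
    height, reproduction sees only a fraction, less than one, of the mass at
    smaller heights ([far_average]). Hence the limit mass is at most a fraction of
    itself plus [O(e)], and it is zero. But then [U] is [O(y)] near the centre of
    the portion ([lin_vanish_point]), which is exceptional: a contradiction.

    So all points are regular. Therefore [|U| <= C y] uniformly in [x]
    ([uniform_linear_bound]), and the semigroup property gives [U = 0]. *)

Set Implicit Arguments.
Unset Strict Implicit.
Unset Printing Implicit Defensive.

Import Order.TTheory GRing.Theory Num.Theory numFieldNormedType.Exports.

Local Open Scope classical_set_scope.
Local Open Scope ring_scope.

(** * Integrals over the line *)

Section line_integrals.
Variable R : realType.
Implicit Types (f g : R -> R) (a c t : R).

Lemma eq_ler a c : a = c -> a <= c.
Proof. by move=> ->. Qed.

Definition intR f : R := \int[@lebesgue_measure R]_x f x.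

(** Domination by the Cauchy weight is integrability in a form that translations
    and bounded factors preserve; the Poisson kernel, its derivatives and
    bounded functions of compact support all satisfy it. *)
Definition tame f := measurable_fun setT f /\
  exists c, forall t, `|f t| <= c * (1 + t ^+ 2)^-1.

Lemma oneDsqr_gt0 t : 0 < 1 + t ^+ 2.
Proof. by rewrite ltr_pwDl ?sqr_ge0. Qed.

Lemma measurable_cauchy : measurable_fun setT (fun t => (1 + t ^+ 2)^-1).
Proof.
by apply: continuous_measurable_fun; exact: (@continuous_oneDsqrV R).
Qed.

Lemma integral_cauchy :
  (\int[@lebesgue_measure R]_x ((1 + x ^+ 2)^-1)%:E = pi%:E)%E.
Proof.
have mE : measurable_fun setT (fun t : R => ((1 + t ^+ 2)^-1)%:E).
  by apply/measurable_EFinP; exact: measurable_cauchy.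
have ge0 : forall x : R, (0 <= ((1 + x ^+ 2)^-1)%:E)%E.
  by move=> x; rewrite lee_fin invr_ge0 ltW// oneDsqr_gt0.
have -> : setT = `]-oo, 0]%classic `|` `]0, +oo[%classic :> set R.
  by rewrite -itv_bndbnd_setU//= set_itvNyy.
rewrite ge0_integral_setU//=; last 2 first.
- by rewrite -itv_bndbnd_setU//= set_itvNyy; exact: mE.
- by rewrite disj_set2E; apply/eqP/seteqP; split => // x /=;
    rewrite !in_itv/= andbT => -[/le_lt_trans h /h]; rewrite ltxx.
rewrite [X in (_ + X)%E](_ : _ = (pi / 2)%:E); last first.
  rewrite integral_itv_obnd_cbnd ?(@integral0y_oneDsqr R)//.
  exact: measurable_funS mE.
rewrite [X in (X + _)%E](_ : _ = (pi / 2)%:E); last first.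
  have <- := @integral0y_oneDsqr R.
  rewrite (@ge0_integration_by_substitution0 R (fun x => ((oneDsqr x)^-1)%:E))//.
  by apply: eq_integral => x _; rewrite /oneDsqr sqrrN.
by rewrite -EFinD -splitr.
Qed.

Lemma tame_integrable f : tame f ->
  (@lebesgue_measure R).-integrable setT (EFin \o f).
Proof.
move=> [mf [c fc]].
apply: (@le_integrable _ _ _ (@lebesgue_measure R) _ measurableT _
  (EFin \o (fun t => c * (1 + t ^+ 2)^-1))).
- exact/measurable_EFinP.
- move=> x _ /=; by rewrite lee_fin (le_trans (fc x))// ler_norm.
- apply: (@integrableZl _ _ _ (@lebesgue_measure R) _ measurableT c (EFin \o (fun t => (1 + t ^+ 2)^-1))) => //.
  apply/integrableP; split.
    by apply/measurable_EFinP; exact: measurable_cauchy.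
  rewrite (_ : (\int[_]_(x in _) _)%E = pi%:E) ?ltry//.
  rewrite -integral_cauchy; apply: eq_integral => x _ /=.
  by rewrite ger0_norm// invr_ge0 ltW// oneDsqr_gt0.
Qed.

Lemma tame_cauchy c : tame (fun t => c * (1 + t ^+ 2)^-1).
Proof.
split; first by apply: measurable_funM => //; exact: measurable_cauchy.
exists `|c| => t; rewrite normrM ler_wpM2l// ger0_norm//.
by rewrite invr_ge0 ltW// oneDsqr_gt0.
Qed.

Lemma intR_cauchy c : intR (fun t => c * (1 + t ^+ 2)^-1) = c * pi.
Proof.
rewrite /intR RintegralZl//; last first.
  have := tame_cauchy 1 => /tame_integrable; congr integrable.
  by apply/funext => x /=; rewrite mul1r.
by rewrite /Rintegral integral_cauchy.
Qed.

Lemma tameD f g : tame f -> tame g -> tame (fun t => f t + g t).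
Proof.
move=> [mf [c fc]] [mg [d gd]]; split; first exact: measurable_funD.
by exists (c + d) => t; rewrite (le_trans (ler_normD _ _))// mulrDl lerD.
Qed.

Lemma tameM c f g : tame f -> measurable_fun setT g -> (forall t, `|g t| <= c) ->
  tame (fun t => g t * f t).
Proof.
move=> [mf [d fd]] mg gc; split; first exact: measurable_funM.
exists (c * d) => t; rewrite normrM -mulrA ler_pM//.
Qed.

Lemma tameZ c f : tame f -> tame (fun t => c * f t).
Proof. by move=> tf; apply: (@tameM `|c|). Qed.

Lemma tameN f : tame f -> tame (fun t => - f t).
Proof.
move=> /(tameZ (-1)) [mf [c h]]; split.
  by apply: eq_measurable_fun mf => x _; rewrite mulN1r.
by exists c => t; rewrite -mulN1r.
Qed.

Lemma tameB f g : tame f -> tame g -> tame (fun t => f t - g t).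
Proof. by move=> tf tg; exact: tameD tf (tameN tg). Qed.

Lemma tame_norm f : tame f -> tame (fun t => `|f t|).
Proof.
move=> [mf [c fc]]; split; first exact: measurableT_comp.
by exists c => t; rewrite normr_id.
Qed.

Lemma le_tame f g : measurable_fun setT f -> (forall t, `|f t| <= g t) ->
  tame g -> tame f.
Proof.
move=> mf fg [_ [c gc]]; split => //; exists c => t.
by rewrite (le_trans (fg t))// (le_trans _ (gc t))// ler_norm.
Qed.

Lemma intRD f g : tame f -> tame g ->
  intR (fun t => f t + g t) = intR f + intR g.
Proof. by move=> tf tg; rewrite /intR RintegralD//; exact: tame_integrable. Qed.

Lemma intRB f g : tame f -> tame g ->
  intR (fun t => f t - g t) = intR f - intR g.
Proof. by move=> tf tg; rewrite /intR RintegralB//; exact: tame_integrable. Qed.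

Lemma intRZ c f : tame f -> intR (fun t => c * f t) = c * intR f.
Proof. by move=> tf; rewrite /intR RintegralZl//; exact: tame_integrable. Qed.

Lemma intRN f : tame f -> intR (fun t => - f t) = - intR f.
Proof.
move=> tf; rewrite -mulN1r -intRZ//.
by congr intR; apply/funext => t; rewrite mulN1r.
Qed.

Lemma intR_le f g : tame f -> tame g -> (forall t, f t <= g t) ->
  intR f <= intR g.
Proof.
by move=> tf tg fg; rewrite /intR le_Rintegral//; exact: tame_integrable.
Qed.

Lemma intR_ge0 f : (forall t, 0 <= f t) -> 0 <= intR f.
Proof. by move=> f0; exact: Rintegral_ge0. Qed.

Lemma intR_norm f : tame f -> `|intR f| <= intR (fun t => `|f t|).
Proof. by move=> tf; rewrite /intR le_normr_Rintegral//; exact: tame_integrable. Qed.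

Lemma intR_norm_le f g : tame f -> tame g -> (forall t, `|f t| <= g t) ->
  `|intR f| <= intR g.
Proof.
move=> tf tg fg; rewrite (le_trans (intR_norm tf))// intR_le//.
exact: tame_norm.
Qed.

Lemma intR_norm_cauchy c f : measurable_fun setT f ->
  (forall t, `|f t| <= c * (1 + t ^+ 2)^-1) -> `|intR f| <= c * pi.
Proof.
move=> mf fc; rewrite -intR_cauchy intR_norm_le//; last exact: tame_cauchy.
by split => //; exists c.
Qed.

(** Makes [tame] stable under translations. *)
Lemma oneDsqr_shift t x :
  (1 + (t + x) ^+ 2)^-1 <= 2 * (1 + x ^+ 2) * (1 + t ^+ 2)^-1.
Proof.
have ht := oneDsqr_gt0 t; have htx := oneDsqr_gt0 (t + x).
rewrite ler_pdivlMr// mulrC ler_pdivrMr//.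
have : 0 <= (t + 2 * x) ^+ 2 by apply: sqr_ge0.
have : 0 <= (x * (t + x)) ^+ 2 by apply: sqr_ge0.
rewrite expr2 (expr2 (t + 2 * x)) !expr2; nra.
Qed.

Lemma tame_shift f a : tame f -> tame (fun t => f (t + a)).
Proof.
move=> [mf [c fc]]; split.
  by apply: measurableT_comp => //; exact: measurable_funD.
exists (`|c| * (2 * (1 + a ^+ 2))) => t; rewrite (le_trans (fc _))//.
rewrite (le_trans (y := `|c| * (1 + (t + a) ^+ 2)^-1))//.
  by rewrite ler_wpM2r ?ler_norm// invr_ge0 ltW// oneDsqr_gt0.
by rewrite -[leRHS]mulrA ler_wpM2l// oneDsqr_shift.
Qed.

(** By uniqueness of the Lebesgue measure, intervals are enough. *)
Lemma lebesgue_measure_shift (a : R) (A : set R) : measurable A ->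
  pushforward (@lebesgue_measure R)
    ((fun t => t + a) : measurableTypeR R -> measurableTypeR R) A = lebesgue_measure A.
Proof.
have ma : measurable_fun setT
    ((fun t : R => t + a) : measurableTypeR R -> measurableTypeR R).
  exact: measurable_funD.
pose ma_mixin := isMeasurableFun.Build _ _ _ _ _ ma.
pose mshift : {mfun _ >-> _} := HB.pack
  ((fun t : R => t + a) : measurableTypeR R -> measurableTypeR R) ma_mixin.
move=> mA; apply/esym.
have := @lebesgue_measure_unique R
  (pushforward (@lebesgue_measure R) mshift).
apply => // _ [[x y]] _ <-.
transitivity (@lebesgue_measure R `]x - a, y - a]%classic).
  rewrite !lebesgue_measure_itv/= !lte_fin ltrD2r -!EFinB.
  by case: ifP => // _; congr EFin; ring.
rewrite /pushforward; congr (lebesgue_measure _).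
by apply/seteqP; split => t /=; rewrite !in_itv/= ltrBlDr lerBrDr.
Qed.

Lemma integral_shift (f : R -> \bar R) (D : set R) a : measurable D ->
  measurable_fun D f -> (forall t, D t -> 0 <= f t)%E ->
  (\int[@lebesgue_measure R]_(t in [set t | D (t + a)%R]) f (t + a)%R =
   \int[@lebesgue_measure R]_(t in D) f t)%E.
Proof.
move=> mD mf f0.
have ma : measurable_fun setT
    ((fun t : R => t + a) : measurableTypeR R -> measurableTypeR R).
  exact: measurable_funD.
rewrite -(@ge0_integral_pushforward _ _ _ _ R _ ma (@lebesgue_measure R) D f)//.
  apply: eq_measure_integral => A mA AD; exact: lebesgue_measure_shift.
by move=> t /set_mem; exact: f0.
Qed.

Lemma intR_shift f a : tame f -> intR (fun t => f (t + a)) = intR f.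
Proof.
have pos g : tame g -> (forall t, 0 <= g t) -> intR (fun t => g (t + a)) = intR g.
  move=> [mg _] g0; rewrite /intR /Rintegral; congr fine.
  rewrite -(@integral_shift (EFin \o g) setT a)//=.
    exact/measurable_EFinP.
  by move=> t _; rewrite lee_fin.
move=> tf; have tn := tame_norm tf.
have tp : tame (fun t => `|f t| + f t) by exact: tameD.
have e h : tame h -> h = (fun t => (`|f t| + f t) - `|f t|) -> intR h =
  intR (fun t => `|f t| + f t) - intR (fun t => `|f t|).
  by move=> th ->; rewrite intRB.
rewrite [RHS](e f)//; last by apply/funext => t; ring.
rewrite -(pos _ tp); last by move=> t; rewrite -lerBlDr sub0r -normrN ler_norm.
rewrite -(pos _ tn)// -intRB//; [|exact: tame_shift tp|exact: tame_shift tn].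
by congr intR; apply/funext => t; ring.
Qed.

(** Dominated differentiation, with a multiple of the Cauchy weight as the
    majorant near [a]. *)
Lemma is_derive_intR (F dF : R -> R -> R) (a e c : R) : 0 < e ->
  (forall y, `|y - a| < e -> measurable_fun setT (F y)) ->
  (forall y t, `|y - a| < e -> `|F y t| <= c * (1 + t ^+ 2)^-1) ->
  (forall y t, `|y - a| < e -> is_derive y 1 (F ^~ t) (dF y t)) ->
  (forall y t, `|y - a| < e -> `|dF y t| <= c * (1 + t ^+ 2)^-1) ->
  is_derive a 1 (fun y => intR (F y)) (intR (dF a)).
Proof.
move=> e0 mF Fc dFP dFc.
have inI y : y \in `]a - e, a + e[ -> `|y - a| < e.
  by rewrite in_itv/= => /andP[h1 h2]; rewrite ltr_distl h1.
have aI : `]a - e, a + e[%classic a.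
  by rewrite /= in_itv/= ltrBlDr ltrDl e0.
have iF y : `]a - e, a + e[%classic y ->
    (@lebesgue_measure R).-integrable setT (EFin \o F y).
  by move=> /inI ya; apply: tame_integrable; split; [exact: mF|exists c => t; exact: Fc].
have dF1 y t : `]a - e, a + e[%classic y -> setT t -> derivable (F ^~ t) y 1.
  by move=> /inI ya _; have [] := dFP y t ya.
have cp t : 0 <= c * (1 + t ^+ 2)^-1.
  by rewrite (le_trans _ (Fc a t _))// subrr normr0.
have iG := tame_integrable (tame_cauchy c).
have E y t : `|y - a| < e -> partial1of2 F y t = dF y t.
  by move=> ya; rewrite partial1of2E; have [] := dFP y t ya.
have G y t : `]a - e, a + e[%classic y -> setT t ->
    `|partial1of2 F y t| <= c * (1 + t ^+ 2)^-1.
  by move=> /inI ya _; rewrite E//; exact: dFc.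
have D := @derivable_under_integral R _ _ lebesgue_measure F setT measurableT
  a (a - e) (a + e) aI iF dF1 _ cp iG G.
apply: DeriveDef => //; rewrite -derive1E.
rewrite (@differentiation_under_integral R _ _ lebesgue_measure F setT measurableT
  a (a - e) (a + e) aI iF dF1 _ cp iG G).
by congr intR; apply/funext => t; rewrite E// subrr normr0.
Qed.

End line_integrals.

(** * One-variable calculus *)

Section calculus.
Variable R : realType.
Implicit Types (f g : R -> R) (a b x t y : R).

Lemma is_derive_eqv f x a b : is_derive x (1 : R) f a -> a = b ->
  is_derive x (1 : R) f b.
Proof. by move=> + <-. Qed.

(** The rules of differentiation for pointwise expressions, so that derivatives
    of explicit formulas are built as terms. *)
Lemma dC a x : is_derive x (1 : R) (fun=> a) (0 : R).
Proof. exact: is_derive_cst. Qed.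

Lemma dI x : is_derive x (1 : R) (fun t => t) (1 : R).
Proof. exact: is_derive_id. Qed.

Lemma dD f g x a b : is_derive x (1 : R) f a -> is_derive x (1 : R) g b ->
  is_derive x (1 : R) (fun t => f t + g t) (a + b).
Proof. by move=> df dg; exact: is_deriveD. Qed.

Lemma dN f x a : is_derive x (1 : R) f a -> is_derive x (1 : R) (fun t => - f t) (- a).
Proof. by move=> df; exact: is_deriveN. Qed.

Lemma dB f g x a b : is_derive x (1 : R) f a -> is_derive x (1 : R) g b ->
  is_derive x (1 : R) (fun t => f t - g t) (a - b).
Proof. by move=> df dg; apply: dD => //; exact: dN. Qed.

Lemma dM f g x a b : is_derive x (1 : R) f a -> is_derive x (1 : R) g b ->
  is_derive x (1 : R) (fun t => f t * g t) (a * g x + f x * b).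
Proof.
move=> df dg; apply: is_derive_eqv (is_deriveM df dg) _.
by rewrite /GRing.scale/=; ring.
Qed.

Lemma dX f x a n : is_derive x (1 : R) f a ->
  is_derive x (1 : R) (fun t => f t ^+ n.+1) (n.+1%:R * f x ^+ n * a).
Proof.
move=> df; elim: n => [|n IH].
  by rewrite expr0 !mul1r.
have -> : (fun t => f t ^+ n.+2) = (fun t => f t * f t ^+ n.+1).
  by apply/funext => t; rewrite exprS.
apply: is_derive_eq (dM df IH) _.
by rewrite exprS -natr1; ring.
Qed.

Lemma dV f x a : f x != 0 -> is_derive x (1 : R) f a ->
  is_derive x (1 : R) (fun t => (f t)^-1) (- a * (f x)^-1 ^+ 2).
Proof.
move=> f0 [d dE]; apply: DeriveDef; first exact: derivableV.
by rewrite deriveV// dE /GRing.scale/= exprVn; ring.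
Qed.

Lemma dcomp f g x a b : is_derive (g x) (1 : R) f a -> is_derive x (1 : R) g b ->
  is_derive x (1 : R) (fun t => f (g t)) (a * b).
Proof. by move=> df dg; exact: is_derive1_comp. Qed.

Lemma dcongr f g x a : is_derive x (1 : R) f a -> f =1 g -> is_derive x (1 : R) g a.
Proof. by move=> + /funext <-. Qed.

Lemma is_derive_continuous f f' : (forall t, is_derive t (1 : R) f (f' t)) -> continuous f.
Proof.
move=> d t; apply: differentiable_continuous; apply/derivable1_diffP.
by have [] := d t.
Qed.

Lemma is_derive_measurable f f' : (forall t, is_derive t (1 : R) f (f' t)) ->
  measurable_fun setT f.
Proof. by move=> d; apply: continuous_measurable_fun; exact: is_derive_continuous d. Qed.

(** A pointwise limit of difference quotients of measurable functions. *)
Lemma is_derive_measurable_param (F dF : R -> R -> R) a :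
  (forall y, a <= y -> measurable_fun setT (F^~ y)) ->
  (forall t, is_derive a (1 : R) (F t) (dF t a)) -> measurable_fun setT (dF^~ a).
Proof.
move=> mF dFP.
apply: (@measurable_fun_cvg _ _ R setT
  (fun n t => n.+1%:R * (F t (n.+1%:R^-1 + a) - F t a))).
  move=> n; apply: measurable_funM => //; apply: measurable_funB.
    by apply: mF; rewrite lerDr invr_ge0.
  exact: mF.
move=> t _; have [/cvg_ex[l lP] dE] := dFP t.
have lE : l = dF t a by rewrite -dE; apply/esym/cvg_lim.
rewrite lE in lP; move: lP => /cvgr_dnbhsP lP.
have := lP (fun n => n.+1%:R^-1) (conj _ (@cvg_harmonic R)).
move=> /(_ (fun n => _)) h.
have {}h := h (fun n => lt0r_neq0 (harmonic_gt0 n)).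
apply: cvg_trans h; apply: near_eq_cvg; apply: nearW => n /=.
by rewrite /shift /= /GRing.scale /= mulr1 invrK.
Qed.

(** Integration by parts on the whole line: both sides are the derivative at
    [x = 0] of the integral of [f (t + x) * p t], computed before and after the
    translation [t := t - x]. *)
Lemma ibp_bounded_tame f f' (p p' : R -> R) (K : R) :
  (forall t, is_derive t (1 : R) f (f' t)) -> measurable_fun setT f' ->
  (forall t, `|f t| <= K /\ `|f' t| <= K) ->
  (forall t, is_derive t (1 : R) p (p' t)) -> tame p -> tame p' ->
  intR (fun t => f' t * p t) = - intR (fun t => f t * p' t).
Proof.
move=> df mf' fK dp tp tp'.
have mf := is_derive_measurable df.
have [mp [c pc]] := tp; have [mp' [c' pc']] := tp'.
have K0 : 0 <= K by rewrite (le_trans _ (fK 0).1).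
pose d := `|c| + `|c'|.
have i0 t : 0 <= (1 + t ^+ 2)^-1 by rewrite invr_ge0 ltW// oneDsqr_gt0.
have pd t : `|p t| <= d * (1 + t ^+ 2)^-1.
  by rewrite (le_trans (pc t))// ler_wpM2r// (le_trans (ler_norm _))// lerDl.
have pd' t : `|p' t| <= d * (1 + t ^+ 2)^-1.
  by rewrite (le_trans (pc' t))// ler_wpM2r// (le_trans (ler_norm _))// lerDr.
have d0 : 0 <= d by rewrite addr_ge0.
have sh (q : R -> R) x t : (forall t, `|q t| <= d * (1 + t ^+ 2)^-1) ->
    `|x - 0| < 1 -> `|q (t - x)| <= d * 4 * (1 + t ^+ 2)^-1.
  move=> qd; rewrite subr0 => x1; rewrite (le_trans (qd _))// -mulrA ler_wpM2l//.
  rewrite (le_trans (oneDsqr_shift _ _))// ler_wpM2r//.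
  have : `|x| ^+ 2 <= 1 by rewrite expr_le1// ltW.
  by rewrite real_normK ?num_real// sqrrN; lra.
pose A x := intR (fun t => f (t + x) * p t).
have dA1 : is_derive (0 : R) (1 : R) A (intR (fun t => f' (t + 0) * p t)).
  apply: (@is_derive_intR _ (fun x t => f (t + x) * p t)
    (fun x t => f' (t + x) * p t) 0 1 (K * d)) => //.
  - move=> x _; apply: measurable_funM => //.
    by apply: measurableT_comp => //; exact: measurable_funD.
  - by move=> x t _; rewrite normrM -mulrA ler_pM//; have [] := fK (t + x).
  - move=> x t _.
    apply: is_derive_eqv (dM (dcomp (df _) (dD (dC t x) (dI x))) (dC _ _)) _.
    by rewrite mulr0 addr0 add0r mulr1.
  - by move=> x t _; rewrite normrM -mulrA ler_pM//; have [] := fK (t + x).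
have dA2 : is_derive (0 : R) (1 : R) A (intR (fun t => f t * - p' (t - 0))).
  apply: (dcongr (f := fun x => intR (fun t => f t * p (t - x)))).
    apply: (@is_derive_intR _ (fun x t => f t * p (t - x))
      (fun x t => f t * - p' (t - x)) 0 1 (K * (d * 4))) => //.
    + move=> x _; apply: measurable_funM => //.
      by apply: measurableT_comp => //; exact: measurable_funB.
    + move=> x t x1; rewrite normrM -mulrA ler_pM//; first by have [] := fK t.
      exact: sh.
    + move=> x t _.
      apply: is_derive_eqv (dM (dC _ _) (dcomp (dp _) (dB (dC t x) (dI x)))) _.
      by rewrite mul0r !add0r mulrN1.
    + move=> x t x1; rewrite normrM normrN -mulrA ler_pM//; first by have [] := fK t.
      exact: sh.
  move=> x; rewrite /A -(@intR_shift _ (fun t => f t * p (t - x)) x).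
    by congr intR; apply/funext => t; rewrite addrK.
  apply: (@tameM _ K); [exact: tame_shift|exact: mf|by move=> t; have [] := fK t].
have [_ e1] := dA1; have [_ e2] := dA2.
rewrite -intRN; last by apply: (@tameM _ K) => // t; have [] := fK t.
have E1 : (fun t => f' t * p t) = (fun t => f' (t + 0) * p t).
  by apply/funext => t; rewrite addr0.
have E2 : (fun t => - (f t * p' t)) = (fun t => f t * - p' (t - 0)).
  by apply/funext => t; rewrite subr0 mulrN.
by rewrite E1 E2 -e1 -e2.
Qed.

End calculus.

(** * Bounded harmonic functions on the half-plane *)

Section bounded_harmonic.
Variable R : realType.
Implicit Types (f g p b : R -> R) (a c t x y : R).

(** Derivatives are carried as functions; [- Wtt] stands for the second
    derivative in [y], so that the Laplace equation is built in. The bounds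
    above each horizontal line allow differentiation under the integral sign.
    The decay of [Wy] at infinity excludes, in the proof of the semigroup
    property, a contribution of the point at infinity. *)
Record bharmonic (W Wt Wy Wtt : R -> R -> R) : Prop := BHarmonic {
  bh_t : forall t y, 0 < y -> is_derive t (1 : R) (W^~ y) (Wt t y) ;
  bh_y : forall t y, 0 < y -> is_derive y (1 : R) (W t) (Wy t y) ;
  bh_tt : forall t y, 0 < y -> is_derive t (1 : R) (Wt^~ y) (Wtt t y) ;
  bh_yy : forall t y, 0 < y -> is_derive y (1 : R) (Wy t) (- Wtt t y) ;
  bh_bd : forall y0, 0 < y0 -> exists K : R, forall t y, y0 <= y ->
    [/\ `|W t y| <= K, `|Wt t y| <= K, `|Wy t y| <= K & `|Wtt t y| <= K] ;
  bh_oo : forall e, 0 < e -> exists2 Y : R, 0 < Y & forall t y, Y <= y -> `|Wy t y| <= e }.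

Section measurability.
Variables (W Wt Wy Wtt : R -> R -> R).
Hypothesis hW : bharmonic W Wt Wy Wtt.

Lemma bh_measurable y : 0 < y -> measurable_fun setT (W^~ y).
Proof. by move=> y0; apply: is_derive_measurable => t; exact: (bh_t hW). Qed.

Lemma bh_measurable_t y : 0 < y -> measurable_fun setT (Wt^~ y).
Proof. by move=> y0; apply: is_derive_measurable => t; exact: (bh_tt hW). Qed.

Lemma bh_measurable_y y : 0 < y -> measurable_fun setT (Wy^~ y).
Proof.
move=> y0; apply: (is_derive_measurable_param (F := W)) => [z yz|t].
  by apply: bh_measurable; exact: lt_le_trans yz.
exact: (bh_y hW).
Qed.

Lemma bh_measurable_tt y : 0 < y -> measurable_fun setT (Wtt^~ y).
Proof.
move=> y0; have := @is_derive_measurable_param R Wy (fun t y => - Wtt t y) y.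
move=> /(_ _ (fun t => bh_yy hW t y0)) h.
have /h {}h : forall z, y <= z -> measurable_fun setT (Wy^~ z).
  by move=> z yz; apply: bh_measurable_y; exact: lt_le_trans yz.
apply: (eq_measurable_fun (fun t => - (- Wtt t y))); first by move=> t _; rewrite opprK.
exact: measurableT_comp.
Qed.

End measurability.

Lemma is_derive_moment (G dG : R -> R -> R) p a e K : 0 < e ->
  (forall y, `|y - a| < e -> measurable_fun setT (G^~ y)) ->
  (forall y t, `|y - a| < e -> is_derive y (1 : R) (G t) (dG t y)) ->
  (forall y t, `|y - a| < e -> `|G t y| <= K /\ `|dG t y| <= K) ->
  tame p ->
  is_derive a (1 : R) (fun y => intR (fun t => G t y * p t))
    (intR (fun t => dG t a * p t)).
Proof.
move=> e0 mG dGP GK [mp [c pc]].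
have K0 : 0 <= K.
  by rewrite (le_trans _ (GK a 0 _).1)// subrr normr0.
apply: (@is_derive_intR _ (fun y t => G t y * p t) (fun y t => dG t y * p t)
  a e (K * c)) => //.
- by move=> y ya; apply: measurable_funM => //; exact: mG.
- by move=> y t ya; rewrite normrM -mulrA ler_pM//; have [] := GK y t ya.
- move=> y t ya; apply: is_derive_eqv (dM (dGP y t ya) (dC _ _)) _.
  by rewrite mulr0 addr0.
- by move=> y t ya; rewrite normrM -mulrA ler_pM//; have [] := GK y t ya.
Qed.

Lemma near_half a y : 0 < a -> `|y - a| < a / 2 -> a / 2 <= y.
Proof. by move=> a0; rewrite ltr_distl => /andP[h _]; lra. Qed.

Lemma bharmonic_affine W Wt Wy Wtt x (r : R) : 0 < r -> bharmonic W Wt Wy Wtt ->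
  bharmonic (fun t y => W (x + r * t) (r * y)) (fun t y => r * Wt (x + r * t) (r * y))
    (fun t y => r * Wy (x + r * t) (r * y)) (fun t y => r ^+ 2 * Wtt (x + r * t) (r * y)).
Proof.
move=> r0 hW.
have dt t : is_derive t (1 : R) (fun t => x + r * t) r.
  apply: is_derive_eqv (dD (dC x t) (dM (dC r t) (dI t))) _; ring.
have dy y : is_derive y (1 : R) (fun y => r * y) r.
  apply: is_derive_eqv (dM (dC r y) (dI y)) _; ring.
split.
- move=> t y y0; have ry : 0 < r * y by rewrite mulr_gt0.
  apply: is_derive_eqv (dcomp (bh_t hW _ ry) (dt t)) _; ring.
- move=> t y y0; have ry : 0 < r * y by rewrite mulr_gt0.
  apply: is_derive_eqv (dcomp (bh_y hW _ ry) (dy y)) _; ring.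
- move=> t y y0; have ry : 0 < r * y by rewrite mulr_gt0.
  apply: is_derive_eqv (dM (dC r t) (dcomp (bh_tt hW _ ry) (dt t))) _; ring.
- move=> t y y0; have ry : 0 < r * y by rewrite mulr_gt0.
  apply: is_derive_eqv (dM (dC r y) (dcomp (bh_yy hW _ ry) (dy y))) _; ring.
- move=> y0 y00; have [K KP] := bh_bd hW (mulr_gt0 r0 y00).
  have K0 : 0 <= K by have [h _ _ _] := KP 0 _ (lexx _); rewrite (le_trans _ h).
  exists (K * (1 + r + r ^+ 2)) => t y yy0.
  have [h1 h2 h3 h4] := KP (x + r * t) (r * y) (ler_wpM2l (ltW r0) yy0).
  have r2 : 0 <= r ^+ 2 by apply: sqr_ge0.
  rewrite (normrM r (Wt _ _)) (normrM r (Wy _ _)) (normrM (r ^+ 2) (Wtt _ _)).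
  rewrite (gtr0_norm r0) (ger0_norm r2).
  have e1 : r * `|Wt (x + r * t) (r * y)| <= r * K by rewrite ler_wpM2l// ltW.
  have e2 : r * `|Wy (x + r * t) (r * y)| <= r * K by rewrite ler_wpM2l// ltW.
  have e3 : r ^+ 2 * `|Wtt (x + r * t) (r * y)| <= r ^+ 2 * K by rewrite ler_wpM2l.
  have rK : 0 <= r * K by rewrite mulr_ge0// ltW.
  have rrK : 0 <= r ^+ 2 * K by rewrite mulr_ge0.
  by split; lra.
- move=> e e0; have [Y Y0 YP] := bh_oo hW (divr_gt0 e0 r0).
  exists (Y / r); first by rewrite divr_gt0.
  move=> t y Yy; rewrite normrM (gtr0_norm r0) mulrC -ler_pdivlMr// YP//.
  by rewrite mulrC -ler_pdivrMr.
Qed.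

(** Statements about the value of a harmonic function at one point thus apply to
    its weighted integrals along horizontal lines. *)
Lemma bharmonic_avg W Wt Wy Wtt p : tame p -> bharmonic W Wt Wy Wtt ->
  bharmonic (fun t y => intR (fun x => W (x + t) y * p x))
    (fun t y => intR (fun x => Wt (x + t) y * p x))
    (fun t y => intR (fun x => Wy (x + t) y * p x))
    (fun t y => intR (fun x => Wtt (x + t) y * p x)).
Proof.
move=> tp hW.
have ms (F : R -> R) t : measurable_fun setT F -> measurable_fun setT (fun x => F (x + t)).
  by move=> mF; apply: measurableT_comp => //; exact: measurable_funD.
have dt x t : is_derive t (1 : R) (fun t => x + t) 1.
  by apply: is_derive_eqv (dD (dC x t) (dI t)) _; rewrite add0r.
have bd (F : R -> R) K : measurable_fun setT F -> (forall x, `|F x| <= K) ->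
    `|intR (fun x => F x * p x)| <= K * intR (fun x => `|p x|).
  move=> mF FK.
  have tFp : tame (fun x => F x * p x) by exact: (@tameM _ K).
  rewrite -intRZ; last exact: tame_norm.
  apply: intR_norm_le => //; first by apply: tameZ; exact: tame_norm.
  by move=> x; rewrite normrM ler_wpM2r.
split.
- move=> t y y0; have [K KP] := bh_bd hW y0.
  apply: (@is_derive_moment (fun x t => W (x + t) y) (fun x t => Wt (x + t) y) p t 1 K) => //.
  + by move=> s _; apply: (ms (W^~ y)); exact: (bh_measurable hW).
  + move=> s x _; apply: is_derive_eqv (dcomp (bh_t hW _ y0) (dt x s)) _.
    by rewrite mulr1.
  + by move=> s x _; have [] := KP (x + s) y (lexx _).
- move=> t y y0; have y20 : 0 < y / 2 by rewrite divr_gt0.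
  have [K KP] := bh_bd hW y20.
  apply: (@is_derive_moment (fun x y => W (x + t) y) (fun x y => Wy (x + t) y) p y (y / 2) K) => //.
  + move=> s /(near_half y0) h; apply: (ms (W^~ s)); apply: (bh_measurable hW).
    exact: lt_le_trans h.
  + by move=> s x /(near_half y0) h; apply: (bh_y hW); exact: lt_le_trans h.
  + by move=> s x /(near_half y0) h; have [] := KP (x + t) s h.
- move=> t y y0; have [K KP] := bh_bd hW y0.
  apply: (@is_derive_moment (fun x t => Wt (x + t) y) (fun x t => Wtt (x + t) y) p t 1 K) => //.
  + by move=> s _; apply: (ms (Wt^~ y)); exact: (bh_measurable_t hW).
  + move=> s x _; apply: is_derive_eqv (dcomp (bh_tt hW _ y0) (dt x s)) _.
    by rewrite mulr1.
  + by move=> s x _; have [] := KP (x + s) y (lexx _).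
- move=> t y y0; have y20 : 0 < y / 2 by rewrite divr_gt0.
  have [K KP] := bh_bd hW y20.
  rewrite -intRN; last first.
    apply: (@tameM _ K) => //; first by apply: (ms (Wtt^~ y)); exact: (bh_measurable_tt hW).
    by move=> x; have [] := KP (x + t) y => //; rewrite ler_pdivrMr//; lra.
  rewrite (_ : intR (fun x => - _) = intR (fun x => - Wtt (x + t) y * p x)); last first.
    by congr intR; apply/funext => x; rewrite mulNr.
  apply: (@is_derive_moment (fun x y => Wy (x + t) y) (fun x y => - Wtt (x + t) y) p y (y / 2) K) => //.
  + move=> s /(near_half y0) h; apply: (ms (Wy^~ s)); apply: (bh_measurable_y hW).
    exact: lt_le_trans h.
  + by move=> s x /(near_half y0) h; apply: (bh_yy hW); exact: lt_le_trans h.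
  + by move=> s x /(near_half y0) h; rewrite normrN; have [] := KP (x + t) s h.
- move=> y0 y00; have [K KP] := bh_bd hW y00.
  exists (K * intR (fun x => `|p x|)) => t y yy0.
  have y_gt0 : 0 < y by exact: lt_le_trans yy0.
  split.
  + apply: (bd (fun x => W (x + t) y)); last by move=> x; have [] := KP (x + t) y yy0.
    by apply: (ms (W^~ y)); exact: (bh_measurable hW).
  + apply: (bd (fun x => Wt (x + t) y)); last by move=> x; have [] := KP (x + t) y yy0.
    by apply: (ms (Wt^~ y)); exact: (bh_measurable_t hW).
  + apply: (bd (fun x => Wy (x + t) y)); last by move=> x; have [] := KP (x + t) y yy0.
    by apply: (ms (Wy^~ y)); exact: (bh_measurable_y hW).
  + apply: (bd (fun x => Wtt (x + t) y)); last by move=> x; have [] := KP (x + t) y yy0.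
    by apply: (ms (Wtt^~ y)); exact: (bh_measurable_tt hW).
- move=> e e0; pose I := intR (fun x => `|p x|).
  have I0 : 0 <= I by exact: intR_ge0.
  have [Y Y0 YP] := bh_oo hW (divr_gt0 e0 (ltr_wpDl I0 ltr01)).
  exists Y => // t y Yy; have y_gt0 : 0 < y by exact: lt_le_trans Yy.
  rewrite (le_trans (bd (fun x => Wy (x + t) y) (e / (I + 1)) _ _))//.
  + by apply: (ms (Wy^~ y)); exact: (bh_measurable_y hW).
  + by move=> x; exact: YP.
  + by rewrite mulrAC ler_pdivrMr ?ltr_wpDl// mulrDr mulr1 lerDl ltW.
Qed.

Section moments.
Variables (W Wt Wy Wtt : R -> R -> R).
Hypothesis hW : bharmonic W Wt Wy Wtt.

Lemma bh_tame y p : 0 < y -> tame p -> tame (fun t => W t y * p t).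
Proof.
move=> y0 tp; have [K KP] := bh_bd hW y0; apply: (@tameM _ K) => //.
  exact: (bh_measurable hW).
by move=> t; have [] := KP t y (lexx _).
Qed.

Lemma is_derive_moment_y y p : 0 < y -> tame p ->
  is_derive y (1 : R) (fun y => intR (fun t => W t y * p t)) (intR (fun t => Wy t y * p t)).
Proof.
move=> y0 tp; have y20 : 0 < y / 2 by rewrite divr_gt0.
have [K KP] := bh_bd hW y20.
apply: (@is_derive_moment W Wy p y (y / 2) K) => //.
- move=> s /(near_half y0) h; apply: (bh_measurable hW).
  exact: lt_le_trans h.
- by move=> s x /(near_half y0) h; apply: (bh_y hW); exact: lt_le_trans h.
- by move=> s x /(near_half y0) h; have [] := KP x s h.
Qed.

Lemma moment_tt y (p p' p'' : R -> R) : 0 < y -> tame p -> tame p' -> tame p'' ->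
  (forall t, is_derive t (1 : R) p (p' t)) -> (forall t, is_derive t (1 : R) p' (p'' t)) ->
  intR (fun t => Wtt t y * p t) = intR (fun t => W t y * p'' t).
Proof.
move=> y0 tp tp' tp'' dp dp'; have [K KP] := bh_bd hW y0.
have K1 t : `|W t y| <= K /\ `|Wt t y| <= K by have [] := KP t y (lexx _).
have K2 t : `|Wt t y| <= K /\ `|Wtt t y| <= K by have [] := KP t y (lexx _).
have -> := ibp_bounded_tame (fun t => bh_tt hW t y0) (bh_measurable_tt hW y0) K2 dp tp tp'.
have -> := ibp_bounded_tame (fun t => bh_t hW t y0) (bh_measurable_t hW y0) K1 dp' tp' tp''.
by rewrite opprK.
Qed.

(** The Laplace equation and two integrations by parts: derivatives in [y] of a
    moment are paid for by the smoothness of [p]. *)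
Lemma is_derive_moment_yy y (p p' p'' : R -> R) : 0 < y -> tame p -> tame p' -> tame p'' ->
  (forall t, is_derive t (1 : R) p (p' t)) -> (forall t, is_derive t (1 : R) p' (p'' t)) ->
  is_derive y (1 : R) (fun y => intR (fun t => Wy t y * p t))
    (- intR (fun t => W t y * p'' t)).
Proof.
move=> y0 tp tp' tp'' dp dp'; have y20 : 0 < y / 2 by rewrite divr_gt0.
have [K KP] := bh_bd hW y20.
rewrite -(moment_tt y0 tp tp' tp'' dp dp') -intRN; last first.
  apply: (@tameM _ K) => //; first exact: (bh_measurable_tt hW).
  by move=> x; have [] := KP x y => //; rewrite ler_pdivrMr//; lra.
rewrite (_ : intR (fun t => - _) = intR (fun t => - Wtt t y * p t)); last first.
  by congr intR; apply/funext => t; rewrite mulNr.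
apply: (@is_derive_moment Wy (fun t y => - Wtt t y) p y (y / 2) K) => //.
- move=> s /(near_half y0) h; apply: (bh_measurable_y hW).
  exact: lt_le_trans h.
- by move=> s x /(near_half y0) h; apply: (bh_yy hW); exact: lt_le_trans h.
- by move=> s x /(near_half y0) h; rewrite normrN; have [] := KP x s h.
Qed.

End moments.

End bounded_harmonic.

(** * The Poisson kernel *)

Section poisson.
Variable R : realType.
Implicit Types (a c t x y s : R).

Definition poisson y t : R := y / (pi * (t ^+ 2 + y ^+ 2)).
Definition poisson_y y t : R := (t ^+ 2 - y ^+ 2) / (pi * (t ^+ 2 + y ^+ 2) ^+ 2).
Definition poisson_yy y t : R :=
  2 * y * (y ^+ 2 - 3 * t ^+ 2) / (pi * (t ^+ 2 + y ^+ 2) ^+ 3).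
Definition poisson_t y t : R := - (2 * t * y) / (pi * (t ^+ 2 + y ^+ 2) ^+ 2).

Lemma sqD_gt0 y t : 0 < y -> 0 < t ^+ 2 + y ^+ 2.
Proof. by move=> y0; rewrite ltr_wpDl ?sqr_ge0// exprn_gt0. Qed.

Let pi_neq0 : (pi : R) != 0. Proof. by rewrite gt_eqF// pi_gt0. Qed.

Lemma is_derive_poisson y t : 0 < y ->
  [/\ is_derive y (1 : R) (poisson^~ t) (poisson_y y t),
      is_derive y (1 : R) (poisson_y^~ t) (poisson_yy y t),
      is_derive t (1 : R) (poisson y) (poisson_t y t) &
      is_derive t (1 : R) (poisson_t y) (- poisson_yy y t)].
Proof.
move=> y0; have q0 := sqD_gt0 t y0; have qn : t ^+ 2 + y ^+ 2 != 0 by rewrite gt_eqF.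
have dq1 : is_derive y (1 : R) (fun y => t ^+ 2 + y ^+ 2) (2 * y).
  by apply: is_derive_eqv (dD (dC _ _) (dX 1 (dI y))) _; ring.
have dq2 : is_derive t (1 : R) (fun t => t ^+ 2 + y ^+ 2) (2 * t).
  by apply: is_derive_eqv (dD (dX 1 (dI t)) (dC _ _)) _; ring.
split.
- apply: is_derive_eqv (dM (dI y) (dV _ (dM (dC pi y) dq1))) _; first by rewrite mulf_neq0.
  move: pi_neq0; rewrite /poisson_y; move: (pi : R) => c c0.
  by field; rewrite ?qn ?c0.
- apply: is_derive_eqv (dM (dB (dC (t ^+ 2) y) (dX 1 (dI y))) (dV _ (dM (dC pi y) (dX 1 dq1)))) _.
    by rewrite mulf_neq0// expf_neq0.
  move: pi_neq0; rewrite /poisson_yy; move: (pi : R) => c c0.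
  by field; rewrite ?qn ?c0.
- apply: is_derive_eqv (dM (dC y t) (dV _ (dM (dC pi t) dq2))) _; first by rewrite mulf_neq0.
  move: pi_neq0; rewrite /poisson_t; move: (pi : R) => c c0.
  by field; rewrite ?qn ?c0.
- apply: is_derive_eqv (dM (dN (dM (dM (dC 2 t) (dI t)) (dC y t)))
    (dV _ (dM (dC pi t) (dX 1 dq2)))) _.
    by rewrite mulf_neq0// expf_neq0.
  move: pi_neq0; rewrite /poisson_yy; move: (pi : R) => c c0.
  by field; rewrite ?qn ?c0.
Qed.

Lemma poisson_ge0 y t : 0 < y -> 0 <= poisson y t.
Proof.
by move=> y0; rewrite divr_ge0 ?mulr_ge0 ?pi_ge0 ?(ltW y0)// ltW// sqD_gt0.
Qed.

(** Uniform over a compact range of heights, for differentiation under the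
    integral sign with respect to the height. *)
Lemma poisson_bounds y0 y1 : 0 < y0 -> exists c : R, forall y t, y0 <= y <= y1 ->
  [/\ `|poisson y t| <= c * (1 + t ^+ 2)^-1, `|poisson_y y t| <= c * (1 + t ^+ 2)^-1,
      `|poisson_t y t| <= c * (1 + t ^+ 2)^-1 & `|poisson_yy y t| <= c * (1 + t ^+ 2)^-1].
Proof.
move=> y00; pose m := Num.min 1 (y0 ^+ 2).
have m0 : 0 < m by rewrite /m lt_min ltr01 exprn_gt0.
have m1 : m <= 1 by rewrite ge_min lexx.
have m2 : m <= y0 ^+ 2 by rewrite ge_min lexx orbT.
have pi0 : 0 < (pi : R) by exact: pi_gt0.
pose C : R := `|y1| + 1 + 6 / y0.
exists (C / (pi * m)) => y t /andP[yy0 yy1].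
have y_gt0 : 0 < y by exact: lt_le_trans yy0.
have q0 := sqD_gt0 t y_gt0.
have d0 := oneDsqr_gt0 t.
have qm : m * (1 + t ^+ 2) <= t ^+ 2 + y ^+ 2.
  have : y0 ^+ 2 <= y ^+ 2 by rewrite ler_sqr ?nnegrE// ltW.
  have : m * t ^+ 2 <= t ^+ 2 by rewrite ler_piMl ?sqr_ge0.
  by rewrite mulrDr mulr1; lra.
have base : (pi * (t ^+ 2 + y ^+ 2))^-1 <= (pi * m)^-1 * (1 + t ^+ 2)^-1.
  rewrite -invfM lef_pV2 ?posrE ?mulr_gt0// -mulrA ler_wpM2l// ltW//.
have C1 : y <= C.
  rewrite /C -addrA ler_wpDr ?addr_ge0 ?divr_ge0 ?(ltW y00)//.
  by rewrite (le_trans yy1)// ler_norm.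
have iy0 : 0 <= 6 / y0 by rewrite divr_ge0 ?(ltW y00).
have C2 : 1 <= C by rewrite /C; have := normr_ge0 y1; lra.
have C3 : 6 / y <= C.
  rewrite /C ler_wpDl ?addr_ge0// ler_wpM2l// lef_pV2 ?posrE//.
have C0 : 0 <= C by exact: le_trans C2.
have red (a b : R) : 0 <= a -> a <= C -> `|b| <= a * (pi * (t ^+ 2 + y ^+ 2))^-1 ->
    `|b| <= C / (pi * m) * (1 + t ^+ 2)^-1.
  move=> a0 aC; move/le_trans; apply; rewrite -mulrA ler_pM//.
  by rewrite invr_ge0 mulr_ge0// ltW.
have pq : 0 < pi * (t ^+ 2 + y ^+ 2) by rewrite mulr_gt0.
split.
- by apply: (red y) => //; [exact: ltW|rewrite ger0_norm// poisson_ge0].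
- apply: (red 1) => //; rewrite /poisson_y normrM normfV [X in _ / X]ger0_norm; last first.
    by rewrite mulr_ge0 ?sqr_ge0// ltW.
  rewrite ler_pdivrMr ?mulr_gt0 ?exprn_gt0// mul1r.
  rewrite [X in _ <= X](_ : _ = t ^+ 2 + y ^+ 2); last first.
    by move: pi_neq0; move: (pi : R) => d d1; field; rewrite ?d1 ?gt_eqF.
  rewrite ler_norml; have := sqr_ge0 t; have := sqr_ge0 y; lra.
- apply: (red 1) => //; rewrite /poisson_t normrM normfV [X in _ / X]ger0_norm; last first.
    by rewrite mulr_ge0 ?sqr_ge0// ltW.
  rewrite ler_pdivrMr ?mulr_gt0 ?exprn_gt0// mul1r.
  rewrite [X in _ <= X](_ : _ = t ^+ 2 + y ^+ 2); last first.
    by move: pi_neq0; move: (pi : R) => d d1; field; rewrite ?d1 ?gt_eqF.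
  rewrite ler_norml; have := sqr_ge0 (t + y); have := sqr_ge0 (t - y).
  rewrite !expr2; lra.
- apply: (red (6 / y)) => //; first by rewrite divr_ge0// ltW.
  rewrite /poisson_yy normrM normfV (ger0_norm (_ : 0 <= pi * (t ^+ 2 + y ^+ 2) ^+ 3)); last first.
    by rewrite mulr_ge0 ?exprn_ge0// ltW.
  rewrite ler_pdivrMr ?mulr_gt0 ?exprn_gt0//.
  rewrite [X in _ <= X](_ : _ = 6 / y * (t ^+ 2 + y ^+ 2) ^+ 2); last first.
    by move: pi_neq0; move: (pi : R) => d d1; field; rewrite ?d1 ?gt_eqF.
  rewrite normrM ger0_norm ?mulr_ge0 ?(ltW y_gt0)//.
  have h1 : `|y ^+ 2 - 3 * t ^+ 2| <= 3 * (t ^+ 2 + y ^+ 2).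
    by rewrite ler_norml; have := sqr_ge0 t; have := sqr_ge0 y; lra.
  rewrite (le_trans (ler_wpM2l _ h1)) ?mulr_ge0 ?(ltW y_gt0)//.
  rewrite [X in _ <= X](_ : _ = (2 * y * (3 * (t ^+ 2 + y ^+ 2))) * ((t ^+ 2 + y ^+ 2) / y ^+ 2)).
    rewrite ler_peMr ?mulr_ge0 ?(ltW y_gt0) ?(ltW q0)//.
    by rewrite ler_pdivlMr ?exprn_gt0// mul1r lerDr sqr_ge0.
  by field; rewrite gt_eqF.
Qed.

Lemma continuous_poisson_yy y : 0 < y -> continuous (poisson_yy y).
Proof.
move=> y0 t; have q0 := sqD_gt0 t y0.
have cq : (fun t => t ^+ 2) @ t --> t ^+ 2 by exact: exprn_continuous.
apply: cvgM; first by apply: cvgMr; apply: cvgB; [exact: cvg_cst|apply: cvgMr].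
apply: cvgV; first by rewrite mulf_neq0// expf_neq0// gt_eqF.
apply: cvgMr.
have -> : (fun z => (z ^+ 2 + y ^+ 2) ^+ 3) = (fun z => z ^+ 3) \o (fun z => z ^+ 2 + y ^+ 2) by [].
apply: cvg_comp; last exact: exprn_continuous.
by apply: cvgD => //; exact: cvg_cst.
Qed.

Lemma poisson_tame y : 0 < y ->
  [/\ tame (poisson y), tame (poisson_y y), tame (poisson_t y) & tame (poisson_yy y)].
Proof.
move=> y0; have [c cP] := poisson_bounds y y0.
have h := fun t => cP y t; rewrite lexx in h.
have D t := is_derive_poisson t y0.
have m1 : measurable_fun setT (poisson y).
  by apply: (is_derive_measurable (f' := poisson_t y)) => t; have [] := D t.
have m2 : measurable_fun setT (poisson_t y).
  by apply: (is_derive_measurable (f' := fun t => - poisson_yy y t)) => t; have [] := D t.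
have m3 : measurable_fun setT (poisson_yy y).
  by apply: continuous_measurable_fun; exact: continuous_poisson_yy.
have m4 : measurable_fun setT (poisson_y y).
  apply: (is_derive_measurable_param (F := fun t y => poisson y t)
    (dF := fun t y => poisson_y y t)) => [z yz|t].
    apply: (is_derive_measurable (f' := poisson_t z)) => t.
    by have [] := is_derive_poisson t (lt_le_trans y0 yz).
  by have [] := D t.
by split; split => //; exists c => t; have [] := h t isT.
Qed.

Lemma intR_scale (G : R -> R) k : 0 < k -> continuous G -> (forall t, 0 <= G t) ->
  intR (fun t => G (k * t) * k) = intR G.
Proof.
move=> k0 cG G0; rewrite /intR /Rintegral.
have dF t : is_derive t (1 : R) (fun t => k * t) k.
  by apply: is_derive_eqv (dM (dC _ t) (dI t)) _; ring.
have dE : (fun t : R => k * t)^`()%classic = cst k.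
  by apply/funext => t; rewrite derive1E; have [] := dF t.
have := @increasing_ge0_integration_by_substitutionT R (fun t => k * t) G.
rewrite dE => ->//.
- by move=> u v uv; rewrite ltr_pM2l.
- by move=> t; exact: cvg_cst.
- exact: is_cvg_cst.
- exact: is_cvg_cst.
- by apply: gt0_cvgMrNy; [|exact: cvg_id].
- by apply: gt0_cvgMry; [|exact: cvg_id].
Qed.

Lemma intR_poisson y : 0 < y -> intR (poisson y) = 1.
Proof.
move=> y0; have pi0 : 0 < (pi : R) := pi_gt0 R.
transitivity (intR (fun t : R => pi^-1 * (1 + t ^+ 2)^-1)); last first.
  by rewrite intR_cauchy mulVf.
rewrite -[RHS](@intR_scale _ y^-1) ?invr_gt0//.
- congr intR; apply/funext => t; rewrite /poisson; have := sqD_gt0 t y0 => q0.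
  have qn : t ^+ 2 + y ^+ 2 != 0 by rewrite gt_eqF.
  have -> : 1 + (y^-1 * t) ^+ 2 = (t ^+ 2 + y ^+ 2) / y ^+ 2.
    by field; rewrite gt_eqF.
  by move: pi_neq0; move: (pi : R) => d d1; field; rewrite ?d1 ?qn ?gt_eqF.
- by move=> t; apply: cvgMr; exact: (@continuous_oneDsqrV R).
- by move=> t; rewrite mulr_ge0 ?invr_ge0 ?(ltW pi0)// ltW// oneDsqr_gt0.
Qed.

End poisson.

(** * The Poisson semigroup *)

Section semigroup.
Variable R : realType.
Implicit Types (a b c e t x y s tau : R).

Lemma is_derive0_segment (f : R -> R) a b : a <= b ->
  (forall x, a <= x <= b -> is_derive x (1 : R) f (0 : R)) -> f a = f b.
Proof.
move=> ab df; have [||c _] := @MVT_segment R f (cst 0) a b ab.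
- by move=> x; rewrite in_itv/= => /andP[h1 h2]; apply: df; rewrite !ltW.
- apply: derivable_within_continuous => x; rewrite in_itv/= => xab.
  by have [] := df x xab.
- by rewrite mul0r => /eqP; rewrite subr_eq0 => /eqP.
Qed.

Lemma is_derive_lipschitz (f f' : R -> R) (K a b : R) : a <= b ->
  (forall x, a <= x <= b -> is_derive x (1 : R) f (f' x)) ->
  (forall x, a <= x <= b -> `|f' x| <= K) -> `|f b - f a| <= K * (b - a).
Proof.
move=> ab df fK; have [||c] := @MVT_segment R f f' a b ab.
- by move=> x; rewrite in_itv/= => /andP[h1 h2]; apply: df; rewrite !ltW.
- apply: derivable_within_continuous => x; rewrite in_itv/= => xab.
  by have [] := df x xab.
- rewrite in_itv/= => cab ->; rewrite normrM (ger0_norm (_ : 0 <= b - a)) ?subr_ge0//.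
  by rewrite ler_wpM2r ?subr_ge0// fK.
Qed.

(** For [|t| > e] the kernel is at most [(1 + e^-2) * y / pi] times the Cauchy
    weight, which is small with [y]. *)
Lemma poisson_concentration (f : R -> R) (L K : R) e y : 0 < e -> 0 < y -> 0 <= L -> 0 <= K ->
  measurable_fun setT f -> (forall t, `|f t| <= K) -> (forall t, `|t| <= e -> `|f t| <= L) ->
  `|intR (fun t => f t * poisson y t)| <= L + K * (1 + e ^- 2) * y.
Proof.
move=> e0 y0 L0 K0 mf fK fL.
have [tP _ _ _] := poisson_tame y0.
have pi0 : 0 < (pi : R) := pi_gt0 R.
have e20 : 0 < e ^- 2 by rewrite invr_gt0 exprn_gt0.
pose g t := L * poisson y t + K * (1 + e ^- 2) * y / pi * (1 + t ^+ 2)^-1.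
have tg : tame g by apply: tameD; [exact: tameZ|exact: tame_cauchy].
have -> : L + K * (1 + e ^- 2) * y = intR g.
  rewrite /g intRD; [|exact: tameZ|exact: tame_cauchy].
  rewrite intRZ// intR_cauchy intR_poisson//.
  by rewrite mulr1 divfK// gt_eqF.
apply: intR_norm_le => //; first exact: (@tameM _ K).
move=> t; have P0 := poisson_ge0 t y0; have d0 := oneDsqr_gt0 t.
have B0 : 0 <= K * (1 + e ^- 2) * y / pi * (1 + t ^+ 2)^-1.
  by rewrite !mulr_ge0// ?invr_ge0 ?(ltW pi0) ?(ltW d0) ?(ltW y0)// addr_ge0// ltW.
rewrite normrM (ger0_norm P0) /g.
have [te|te] := leP `|t| e.
  by rewrite ler_wpDr// ler_wpM2r// fL.
apply: ler_wpDl; first by rewrite mulr_ge0.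
have -> : K * (1 + e ^- 2) * y / pi * (1 + t ^+ 2)^-1 =
    K * ((1 + e ^- 2) * y / pi * (1 + t ^+ 2)^-1).
  by rewrite !mulrA.
rewrite ler_pM//.
have t20 : 0 < t ^+ 2 by rewrite exprn_even_gt0//= -normr_gt0 (lt_trans e0).
have q0 := sqD_gt0 t y0.
rewrite /poisson -[(1 + e ^- 2) * y / pi]mulrAC.
have -> : y / (pi * (t ^+ 2 + y ^+ 2)) = (t ^+ 2 + y ^+ 2)^-1 * (y / pi).
  by rewrite invfM; ring.
rewrite -!mulrA [(1 + e ^- 2) * _]mulrC -!mulrA.
have -> : pi^-1 * (y * ((1 + t ^+ 2)^-1 * (1 + e ^- 2))) =
   ((1 + e ^- 2) / (1 + t ^+ 2)) * (y / pi) by ring.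
rewrite ler_wpM2r ?divr_ge0 ?(ltW y0) ?(ltW pi0)//.
rewrite ler_pdivlMr// mulrC ler_pdivrMr//.
have h1 : 1 <= e ^- 2 * t ^+ 2.
  rewrite mulrC ler_pdivlMr ?exprn_gt0// mul1r -[t ^+ 2]ger0_norm ?sqr_ge0//.
  by rewrite normrX lerXn2r ?nnegrE ?normr_ge0 ?(ltW e0)// ltW.
have h2 : 0 <= (1 + e ^- 2) * y ^+ 2 by rewrite mulr_ge0 ?sqr_ge0// addr_ge0// ltW.
rewrite mulrDr mulrDl mul1r; lra.
Qed.

Lemma is_derive_moment2 (G dG p dp : R -> R -> R) a e K c : 0 < e ->
  (forall y, `|y - a| < e -> measurable_fun setT (G^~ y)) ->
  (forall y, `|y - a| < e -> measurable_fun setT (p y)) ->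
  (forall y t, `|y - a| < e -> is_derive y (1 : R) (G t) (dG t y)) ->
  (forall y t, `|y - a| < e -> is_derive y (1 : R) (p^~ t) (dp y t)) ->
  (forall y t, `|y - a| < e -> `|G t y| <= K /\ `|dG t y| <= K) ->
  (forall y t, `|y - a| < e -> `|p y t| <= c * (1 + t ^+ 2)^-1 /\
     `|dp y t| <= c * (1 + t ^+ 2)^-1) ->
  is_derive a (1 : R) (fun y => intR (fun t => G t y * p y t))
    (intR (fun t => dG t a * p a t + G t a * dp a t)).
Proof.
move=> e0 mG mp dGP dpP GK pc.
have a0 : `|a - a| < e by rewrite subrr normr0.
have K0 : 0 <= K by rewrite (le_trans _ (GK a 0 a0).1).
have cp t : 0 <= c * (1 + t ^+ 2)^-1 by rewrite (le_trans _ (pc a t a0).1).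
apply: (@is_derive_intR _ (fun y t => G t y * p y t)
  (fun y t => dG t y * p y t + G t y * dp y t) a e (2 * K * c)) => //.
- by move=> y ya; apply: measurable_funM; [exact: mG|exact: mp].
- move=> y t ya; have [G1 _] := GK y t ya; have [p1 _] := pc y t ya.
  rewrite normrM (le_trans (ler_pM _ _ G1 p1))//.
  have : 0 <= K * (c * (1 + t ^+ 2)^-1) by rewrite mulr_ge0.
  by rewrite -!mulrA; lra.
- by move=> y t ya; exact: dM (dGP y t ya) (dpP y t ya).
- move=> y t ya; have [G1 G2] := GK y t ya; have [p1 p2] := pc y t ya.
  rewrite (le_trans (ler_normD _ _))// !normrM.
  have h1 := ler_pM (normr_ge0 _) (normr_ge0 _) G2 p1.
  have h2 := ler_pM (normr_ge0 _) (normr_ge0 _) G1 p2.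
  by rewrite (le_trans (lerD h1 h2))// -!mulrA; lra.
Qed.

Section reproduction.
Variables (W Wt Wy Wtt : R -> R -> R).
Hypothesis hW : bharmonic W Wt Wy Wtt.

(** The rate of change of the integral of [W] at the height [s] against [poisson
    tau] when [s] is raised and [tau] lowered by the same amount. By the Laplace
    equation it does not change when [s] and [tau] are both raised, and it tends
    to zero when they tend to infinity; hence it vanishes. *)
Let D s tau := intR (fun t => Wy t s * poisson tau t) - intR (fun t => W t s * poisson_y tau t).

Let near_gt0 a e y : `|y - a| < e -> a - e < y /\ y < a + e.
Proof. by rewrite ltr_distl => /andP. Qed.

Let dD0 s tau : 0 < s -> 0 < tau ->
  is_derive (0 : R) (1 : R) (fun c => D (s + c) (tau + c)) (0 : R).
Proof.
move=> s0 tau0; pose e := Num.min (s / 2) (tau / 2).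
have e0 : 0 < e by rewrite lt_min !divr_gt0.
have es : e <= s / 2 by rewrite ge_min lexx.
have et : e <= tau / 2 by rewrite ge_min lexx orbT.
have [K KP] := bh_bd hW (divr_gt0 s0 (ltr0Sn R 1)).
have [c cP] := poisson_bounds (2 * tau) (divr_gt0 tau0 (ltr0Sn R 1)).
have ns x : `|x - 0| < e -> s / 2 <= s + x /\ 0 < s + x.
  by move=> /near_gt0; rewrite sub0r add0r => -[h1 h2]; split; lra.
have nt x : `|x - 0| < e -> tau / 2 <= tau + x <= 2 * tau /\ 0 < tau + x.
  by move=> /near_gt0; rewrite sub0r add0r => -[h1 h2]; split; [apply/andP; split; lra|lra].
have dsh b x : is_derive x (1 : R) (fun x => b + x) (1 : R).
  by apply: is_derive_eqv (dD (dC b x) (dI x)) _; rewrite add0r.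
have [tP tPy tPt tPyy] := poisson_tame tau0.
have d1 := @is_derive_moment2 (fun t x => Wy t (s + x)) (fun t x => - Wtt t (s + x))
  (fun x t => poisson (tau + x) t) (fun x t => poisson_y (tau + x) t) 0 e K c e0.
have d2 := @is_derive_moment2 (fun t x => W t (s + x)) (fun t x => Wy t (s + x))
  (fun x t => poisson_y (tau + x) t) (fun x t => poisson_yy (tau + x) t) 0 e K c e0.
have [K1 K2 K3 K4] : [/\ forall t, `|W t s| <= K, forall t, `|Wt t s| <= K,
    forall t, `|Wy t s| <= K & forall t, `|Wtt t s| <= K].
  have hs : s / 2 <= s by lra.
  by split=> t; have [] := KP t s hs.
apply: is_derive_eqv (dB (d1 _ _ _ _ _ _) (d2 _ _ _ _ _ _)) _.
- by move=> x /ns[_ h]; exact: (bh_measurable_y hW).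
- by move=> x /nt[_ h]; have [[]] := poisson_tame h.
- move=> x t /ns[_ h]; apply: is_derive_eqv (dcomp (bh_yy hW t h) (dsh s x)) _.
  by rewrite mulr1.
- move=> x t /nt[_ h]; have [p1 _ _ _] := is_derive_poisson t h.
  by apply: is_derive_eqv (dcomp p1 (dsh tau x)) _; rewrite mulr1.
- by move=> x t /ns[h _]; rewrite normrN; have [] := KP t (s + x) h.
- by move=> x t /nt[h _]; have [] := cP (tau + x) t h.
- by move=> x /ns[_ h]; exact: (bh_measurable hW).
- by move=> x /nt[_ h]; have [_ []] := poisson_tame h.
- move=> x t /ns[_ h]; apply: is_derive_eqv (dcomp (bh_y hW t h) (dsh s x)) _.
  by rewrite mulr1.
- move=> x t /nt[_ h]; have [_ p1 _ _] := is_derive_poisson t h.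
  by apply: is_derive_eqv (dcomp p1 (dsh tau x)) _; rewrite mulr1.
- by move=> x t /ns[h _]; have [] := KP t (s + x) h.
- by move=> x t /nt[h _]; have [] := cP (tau + x) t h.
rewrite !addr0.
have t1 : tame (fun t => - Wtt t s * poisson tau t).
  apply: (@tameM _ K) => //; last by move=> t; rewrite normrN.
  by apply: measurableT_comp => //; exact: (bh_measurable_tt hW).
have t2 : tame (fun t => Wy t s * poisson_y tau t).
  by apply: (@tameM _ K) => //; exact: (bh_measurable_y hW).
have t3 : tame (fun t => W t s * poisson_yy tau t).
  by apply: (@tameM _ K) => //; exact: (bh_measurable hW).
rewrite (intRD t1 t2) (intRD t2 t3).
have -> : intR (fun t => - Wtt t s * poisson tau t) = intR (fun t => W t s * poisson_yy tau t).
  rewrite [LHS](_ : _ = - intR (fun t => Wtt t s * poisson tau t)); last first.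
    rewrite -intRN; last by apply: (@tameM _ K) => //; exact: (bh_measurable_tt hW).
    by congr intR; apply/funext => t; rewrite mulNr.
  have q1 t : is_derive t (1 : R) (poisson tau) (poisson_t tau t).
    by have [] := is_derive_poisson t tau0.
  have q2 t : is_derive t (1 : R) (poisson_t tau) (- poisson_yy tau t).
    by have [] := is_derive_poisson t tau0.
  have -> := moment_tt hW s0 tP tPt (tameN tPyy) q1 q2.
  rewrite -intRN; last by apply: (bh_tame hW) => //; exact: tameN.
  by congr intR; apply/funext => t; rewrite mulrN opprK.
by ring.
Qed.

Let D_small e : 0 < e -> exists2 Y : R, 0 < Y &
  forall s tau, Y <= s -> Y <= tau -> `|D s tau| <= e.
Proof.
move=> e0; have e20 : 0 < e / 2 by rewrite divr_gt0.
have [Y Y0 YP] := bh_oo hW e20; have [K KP] := bh_bd hW ltr01.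
have K0 : 0 <= K by have [h _ _ _] := KP 0 1 (lexx _); rewrite (le_trans _ h).
have K10 : 0 < K + 1 by rewrite ltr_wpDl.
exists (Num.max (Num.max Y 1) ((K + 1) * 2 / e)); first by rewrite !lt_max Y0.
move=> s tau; rewrite !ge_max => /andP[/andP[Ys s1] _] /andP[/andP[Yt t1] et].
have s0 : 0 < s by exact: lt_le_trans s1.
have tau0 : 0 < tau by exact: lt_le_trans t1.
have [tP tPy _ _] := poisson_tame tau0.
rewrite (le_trans (ler_normB _ _))// (splitr e) lerD//.
  have -> : e / 2 = intR (fun t => e / 2 * poisson tau t).
    by rewrite intRZ// intR_poisson// mulr1.
  apply: intR_norm_le; last first.
  - move=> t; rewrite normrM (ger0_norm (poisson_ge0 t tau0)) ler_wpM2r ?poisson_ge0//.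
    exact: YP.
  - exact: tameZ.
  - apply: (@tameM _ (e / 2)) => //; first exact: (bh_measurable_y hW).
    by move=> t; exact: YP.
have h t : `|poisson_y tau t| <= tau^-1 * poisson tau t.
  have q0 := sqD_gt0 t tau0; have pi0 : 0 < (pi : R) := pi_gt0 R.
  rewrite /poisson_y normrM normfV [X in _ / X]ger0_norm; last first.
    by rewrite mulr_ge0 ?sqr_ge0// ltW.
  rewrite ler_pdivrMr ?mulr_gt0 ?exprn_gt0//.
  have -> : tau^-1 * poisson tau t * (pi * (t ^+ 2 + tau ^+ 2) ^+ 2) = t ^+ 2 + tau ^+ 2.
    rewrite /poisson; move: pi0; move: (pi : R) => d d0; field; rewrite ?gt_eqF//.
  by rewrite ler_norml; have := sqr_ge0 t; have := sqr_ge0 tau; lra.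
have -> : e / 2 = intR (fun t => e / 2 * poisson tau t).
  by rewrite intRZ// intR_poisson// mulr1.
apply: intR_norm_le.
- exact: (bh_tame hW).
- exact: tameZ.
- move=> t; rewrite normrM; have [k1 _ _ _] := KP t s s1.
  rewrite (le_trans (ler_pM _ _ k1 (h t)))// mulrA ler_wpM2r ?poisson_ge0//.
  rewrite ler_pdivrMr// mulrAC ler_pdivlMr// mulrC.
  move: et; rewrite ler_pdivrMr// => et.
  rewrite (le_trans _ (le_trans et _))//; last by rewrite mulrC.
  by rewrite mulrC ler_wpM2r// lerDl.
Qed.

Let D0 s tau : 0 < s -> 0 < tau -> D s tau = 0.
Proof.
move=> s0 tau0; apply/eqP; rewrite -normr_le0; apply/ler_addgt0Pl => e e0; rewrite addr0.
have [Y Y0 YP] := D_small e0.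
have -> : D s tau = D (s + Y) (tau + Y).
  have := @is_derive0_segment (fun c => D (s + c) (tau + c)) 0 Y (ltW Y0).
  rewrite !addr0; apply => x /andP[x0 _].
  have h := dD0 (ltr_wpDr x0 s0) (ltr_wpDr x0 tau0).
  have dx : is_derive x (1 : R) (fun y => y - x) (1 : R).
    by apply: is_derive_eqv (dB (dI x) (dC x x)) _; rewrite subr0.
  have h' : is_derive (x - x) (1 : R) (fun c => D (s + x + c) (tau + x + c)) (0 : R).
    by rewrite subrr.
  have := dcomp (g := fun y => y - x) h' dx; rewrite mulr1 => h2; apply: (dcongr h2) => z.
  by congr D; ring.
by apply: YP; rewrite ler_wpDl// ltW.
Qed.

(** The Poisson semigroup. By the vanishing of [D], raising [s] and lowering
    [tau] at the same rate does not change the integral; when [tau] tends to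
    zero, the kernel concentrates at the origin. *)
Lemma poisson_reproduction s tau : 0 < s -> 0 < tau ->
  intR (fun t => W t s * poisson tau t) = W 0 (s + tau).
Proof.
move=> s0 tau0; pose Q c := intR (fun t => W t (s + c) * poisson (tau - c) t).
have [K KP] := bh_bd hW s0.
have K0 : 0 <= K by have [h _ _ _] := KP 0 _ (lexx _); rewrite (le_trans _ h).
have dQ x : 0 <= x < tau -> is_derive x (1 : R) Q (0 : R).
  move=> /andP[x0 xt]; pose e := Num.min (s / 2) ((tau - x) / 2).
  have e0 : 0 < e by rewrite lt_min !divr_gt0// subr_gt0.
  have es : e <= s / 2 by rewrite ge_min lexx.
  have et : e <= (tau - x) / 2 by rewrite ge_min lexx orbT.
  have tx0 : 0 < tau - x by rewrite subr_gt0.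
  have [c cP] := poisson_bounds (2 * tau) (divr_gt0 tx0 (ltr0Sn R 1)).
  have [K' KP'] := bh_bd hW (divr_gt0 s0 (ltr0Sn R 1)).
  have sx0 : 0 < s + x by rewrite ltr_wpDr.
  have ns z : `|z - x| < e -> s / 2 <= s + z /\ 0 < s + z.
    by move=> /near_gt0[h1 h2]; split; lra.
  have nt z : `|z - x| < e -> (tau - x) / 2 <= tau - z <= 2 * tau /\ 0 < tau - z.
    by move=> /near_gt0[h1 h2]; split; [apply/andP; split; lra|lra].
  have dsh b z : is_derive z (1 : R) (fun x => b + x) (1 : R).
    by apply: is_derive_eqv (dD (dC b z) (dI z)) _; rewrite add0r.
  have dsb b z : is_derive z (1 : R) (fun x => b - x) (-1 : R).
    by apply: is_derive_eqv (dB (dC b z) (dI z)) _; rewrite add0r.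
  have d1 := @is_derive_moment2 (fun t x => W t (s + x)) (fun t x => Wy t (s + x))
    (fun x t => poisson (tau - x) t) (fun x t => - poisson_y (tau - x) t) x e K' c e0.
  apply: is_derive_eqv (d1 _ _ _ _ _ _) _.
  - by move=> z /ns[_ h]; exact: (bh_measurable hW).
  - by move=> z /nt[_ h]; have [[]] := poisson_tame h.
  - move=> z t /ns[_ h]; apply: is_derive_eqv (dcomp (bh_y hW t h) (dsh s z)) _.
    by rewrite mulr1.
  - move=> z t /nt[_ h]; have [p1 _ _ _] := is_derive_poisson t h.
    by have := dcomp (g := fun x => tau - x) p1 (dsb tau z); rewrite mulrN1.
  - by move=> z t /ns[h _]; have [] := KP' t (s + z) h.
  - by move=> z t /nt[h _]; rewrite normrN; have [] := cP (tau - z) t h.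
  have [tP tPy _ _] := poisson_tame tx0.
  rewrite -(D0 sx0 tx0) /D -intRB; last 2 first.
  - apply: (@tameM _ K) => //; first exact: (bh_measurable_y hW).
    by move=> t; have [] := KP t (s + x) => //; rewrite lerDl.
  - exact: (bh_tame hW).
  by congr intR; apply/funext => t; rewrite mulrN.
have Qc x : 0 <= x < tau -> Q 0 = Q x.
  move=> /andP[x0 xt]; apply: is_derive0_segment => // z /andP[z0 zx].
  by apply: dQ; rewrite z0 (le_lt_trans zx).
have Q0 : Q 0 = intR (fun t => W t s * poisson tau t) by rewrite /Q addr0 subr0.
rewrite -Q0; apply/eqP; rewrite -subr_eq0 -normr_le0; apply/ler_addgt0Pl => e e0.
rewrite addr0.
pose r := e / (2 * (K + 1)).
have K1 : 0 < K + 1 by rewrite ltr_wpDl.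
have r0 : 0 < r by rewrite divr_gt0// mulr_gt0.
pose B := K + 2 * K * (1 + r ^- 2) + 1.
have r20 : 0 <= r ^- 2 by rewrite invr_ge0 sqr_ge0.
have B1 : 1 <= B by rewrite /B lerDr addr_ge0// !mulr_ge0// addr_ge0.
have B0 : 0 < B by exact: lt_le_trans B1.
pose h := Num.min (tau / 2) (e / (2 * B)).
have h0 : 0 < h by rewrite lt_min !divr_gt0// mulr_gt0.
have ht : h < tau by rewrite gt_min; apply/orP; left; lra.
have he : h <= e / (2 * B) by rewrite ge_min lexx orbT.
have th : 0 <= tau - h < tau by rewrite subr_ge0 (ltW ht)/= ltrBlDr ltrDl.
rewrite (Qc _ th) /Q subKr.
have [tP _ _ _] := poisson_tame h0.
have sth : 0 < s + (tau - h) by lra.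
have -> : W 0 (s + tau) = intR (fun t => W 0 (s + tau) * poisson h t).
  by rewrite intRZ// intR_poisson// mulr1.
rewrite -intRB; [|exact: (bh_tame hW)|exact: tameZ].
rewrite (_ : (fun t => _) = (fun t => (W t (s + (tau - h)) - W 0 (s + tau)) * poisson h t)); last first.
  by apply/funext => t; rewrite mulrBl.
have k0 z y : s <= y -> `|W z y| <= K by move=> sy; have [] := KP z y sy.
have s1 : s <= s + (tau - h) by lra.
have s2 : s <= s + tau by lra.
have lipt t : `|W t (s + (tau - h)) - W 0 (s + (tau - h))| <= K * `|t|.
  have [t0|t0] := leP 0 t.
    rewrite (ger0_norm t0) -{2}(subr0 t).
    apply: (@is_derive_lipschitz (W^~ (s + (tau - h))) (Wt^~ (s + (tau - h)))) => // z _.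
      exact: (bh_t hW).
    by have [] := KP z _ s1.
  rewrite distrC (ltr0_norm t0) -(sub0r t).
  apply: (@is_derive_lipschitz (W^~ (s + (tau - h))) (Wt^~ (s + (tau - h)))) => [|z _|z _].
  - exact: ltW.
  - exact: (bh_t hW).
  - by have [] := KP z _ s1.
have lipy : `|W 0 (s + (tau - h)) - W 0 (s + tau)| <= K * h.
  rewrite distrC [X in _ <= K * X](_ : h = s + tau - (s + (tau - h))); last by ring.
  apply: (@is_derive_lipschitz (W 0) (Wy 0)) => [|z /andP[z1 z2]|z /andP[z1 z2]].
  - by lra.
  - by apply: (bh_y hW); lra.
  - have sz : s <= z by lra.
    by have [] := KP 0 z sz.
have := @poisson_concentration (fun t => W t (s + (tau - h)) - W 0 (s + tau))
  (K * r + K * h) (2 * K) r h r0 h0.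
move=> /(_ _ _ _ _ _)/le_trans; apply.
- by rewrite addr_ge0// mulr_ge0// ltW.
- by rewrite mulr_ge0.
- by apply: measurable_funB => //; exact: (bh_measurable hW).
- by move=> t; rewrite (le_trans (ler_normB _ _))// mulr_natl mulr2n lerD// k0.
- move=> t tr; rewrite -(subrK (W 0 (s + (tau - h))) (W t _)) -addrA.
  rewrite (le_trans (ler_normD _ _))// lerD// (le_trans (lipt t))// ler_wpM2l//.
have h1 : K * r <= e / 2.
  by rewrite /r mulrA ler_pdivrMr ?mulr_gt0//; nra.
have h2 : B * h <= e / 2.
  rewrite (le_trans (ler_wpM2l (ltW B0) he))//; apply: eq_ler.
  by field; rewrite gt_eqF.
have h3 : K * h + 2 * K * (1 + r ^- 2) * h <= B * h by rewrite -mulrDl ler_wpM2r ?(ltW h0)// lerDl.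
lra.
Qed.

End reproduction.

End semigroup.

(** * Node kernels and partial fractions *)

Section nodes.
Variable R : realType.
Implicit Types (a c t x y e : R) (l : seq (R * R)).

(** The factor attached to a node [a]: multiplying the Poisson kernel of height
    [e] by it improves its decay and makes it smaller. *)
Definition node e a t : R := (a ^+ 2 - 1) * e ^+ 2 / (t ^+ 2 + (e * a) ^+ 2).

Definition node_kernel e l t : R := poisson e t * \prod_(p <- l) node e p.1 t.

(** An entry [(a, c)] of [l] is a node with its coefficient in the expansion;
    that of [poisson e] itself is one, by the normalisation of [node]. *)
Definition partial_fractions l := forall e t, 0 < e ->
  node_kernel e l t = poisson e t + \sum_(p <- l) p.2 * poisson (e * p.1) t.

Lemma poisson_node e a b t : 0 < e -> 0 < a -> 0 < b -> b ^+ 2 != a ^+ 2 ->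
  poisson (e * a) t * node e b t =
  (b ^+ 2 - 1) / (b ^+ 2 - a ^+ 2) * poisson (e * a) t -
  a / b * ((b ^+ 2 - 1) / (b ^+ 2 - a ^+ 2)) * poisson (e * b) t.
Proof.
move=> e0 a0 b0 ab.
have qa : t ^+ 2 + (e * a) ^+ 2 != 0 by rewrite gt_eqF// sqD_gt0// mulr_gt0.
have qb : t ^+ 2 + (e * b) ^+ 2 != 0 by rewrite gt_eqF// sqD_gt0// mulr_gt0.
have pi0 : (pi : R) != 0 by rewrite gt_eqF// pi_gt0.
have dab : b ^+ 2 - a ^+ 2 != 0 by rewrite subr_eq0.
rewrite /poisson /node; move: pi0; move: (pi : R) => d d0.
by field; rewrite ?qa ?qb ?d0 ?dab ?gt_eqF.
Qed.

(** The expansion after multiplication by one more factor: [poisson_node] is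
    applied to each term. *)
Definition add_node b l : seq (R * R) :=
  (b, - b^-1 - \sum_(p <- l) p.2 * (p.1 / b * ((b ^+ 2 - 1) / (b ^+ 2 - p.1 ^+ 2)))) ::
  [seq (p.1, p.2 * ((b ^+ 2 - 1) / (b ^+ 2 - p.1 ^+ 2))) | p <- l].

Lemma partial_fractions_add b l : 1 < b -> (forall p, p \in l -> 1 < p.1) ->
  (forall p, p \in l -> p.1 != b) -> partial_fractions l ->
  partial_fractions (add_node b l).
Proof.
move=> b1 l1 lb pf e t e0.
have b0 : 0 < b by rewrite (lt_trans ltr01).
have P1 : poisson e t * node e b t = poisson e t - b^-1 * poisson (e * b) t.
  have b2 : b ^+ 2 != 1 ^+ 2.
    by rewrite gt_eqF// ltr_sqr ?nnegrE ?ltW.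
  have := poisson_node t e0 ltr01 b0 b2; rewrite expr1n mulr1 => ->.
  rewrite divff; last by rewrite subr_eq0 -[1](expr1n _ 2).
  by rewrite !mul1r mulr1.
have := pf e t e0; rewrite /node_kernel => pfE.
rewrite /add_node !big_cons /= !big_map /= mulrCA pfE mulrDr.
rewrite [node _ _ _ * poisson e t]mulrC P1 mulr_sumr mulrBl mulNr -!addrA.
congr (_ + (_ + _)); rewrite mulr_suml [RHS]addrC -sumrB.
rewrite !big_seq; apply: eq_bigr => p pl.
have p0 : 0 < p.1 by rewrite (lt_trans ltr01)// l1.
have bp : b ^+ 2 != p.1 ^+ 2.
  by rewrite eqf_sqr negb_or eq_sym lb//= gt_eqF// (lt_trans _ b0)// oppr_lt0.
rewrite mulrCA [node _ _ _ * _]mulrC (poisson_node _ e0 p0 b0 bp); ring.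
Qed.

Lemma partial_fractions_nil : partial_fractions [::].
Proof. by move=> e t _; rewrite /node_kernel !big_nil mulr1 addr0. Qed.

Lemma exists_partial_fractions (s : seq R) : uniq s -> (forall a, a \in s -> 1 < a) ->
  exists l, [seq p.1 | p <- l] = s /\ partial_fractions l.
Proof.
elim: s => [|b s IH] /=; first by exists [::]; split => //; exact: partial_fractions_nil.
move=> /andP[bs us] s1.
have [|l [ls pf]] := IH us; first by move=> a ax; apply: s1; rewrite inE ax orbT.
exists (add_node b l); split.
  by rewrite /add_node/= -map_comp -ls; congr (_ :: _); apply: eq_map.
have ml p : p \in l -> p.1 \in s by move=> pl; rewrite -ls map_f.
apply: partial_fractions_add => //.
- by apply: s1; rewrite inE eqxx.
- by move=> p /ml ps; apply: s1; rewrite inE ps orbT.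
- by move=> p /ml; apply: contraTneq => ->.
Qed.

(** By induction, starting from the bound [c / 8]. A new node far above the
    others and above [2 / c] at most doubles their coefficients, and its own
    coefficient is at most its inverse plus twice the sum of the others. *)
Lemma exists_small_partial_fractions (k : nat) c : 0 < c ->
  exists l, [/\ size l = k, forall p, p \in l -> 1 < p.1, partial_fractions l &
    \sum_(p <- l) `|p.2| <= c].
Proof.
elim: k c => [|k IH] c c0.
  exists [::]; split => //; first exact: partial_fractions_nil.
  by rewrite big_nil ltW.
have [l [sl l1 pf lc]] := IH (c / 8) (divr_gt0 c0 (ltr0Sn R 7)).
pose S := \sum_(p <- l) p.1 ^+ 2.
have S0 : 0 <= S by rewrite sumr_ge0// => p _; exact: sqr_ge0.
have lS p : p \in l -> p.1 ^+ 2 <= S.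
  move=> pl; rewrite /S (big_rem p pl)/= lerDl sumr_ge0// => q _; exact: sqr_ge0.
pose b := 2 + S + 2 / c.
have c20 : 0 < 2 / c by rewrite divr_gt0.
have b2 : 2 <= b by rewrite /b -addrA lerDl addr_ge0// ltW.
have b1 : 1 < b by lra.
have b0 : 0 < b by lra.
have bS : 2 * S <= b ^+ 2.
  have : b * b >= 2 * b by rewrite ler_wpM2r// ltW.
  by rewrite -expr2; apply: le_trans; rewrite ler_wpM2l// /b; lra.
have bc : b^-1 <= c / 2.
  by rewrite -[c / 2]invrK lef_pV2 ?posrE ?invr_gt0 ?divr_gt0// invf_div /b; lra.
have ratio p : p \in l -> [/\ p.1 != b, 0 <= (b ^+ 2 - 1) / (b ^+ 2 - p.1 ^+ 2) &
    (b ^+ 2 - 1) / (b ^+ 2 - p.1 ^+ 2) <= 2].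
  move=> pl; have h := lS p pl; have p1 := l1 p pl.
  have p2 : 1 < p.1 ^+ 2 by rewrite -(expr1n _ 2) ltr_sqr// ?nnegrE// ltW// (lt_trans ltr01).
  have d0 : 0 < b ^+ 2 - p.1 ^+ 2 by lra.
  split.
  - by apply/eqP => pb; move: d0; rewrite pb subrr ltxx.
  - by rewrite divr_ge0 ?(ltW d0)//; lra.
  - by rewrite ler_pdivrMr//; lra.
exists (add_node b l); split.
- by rewrite /= size_map sl.
- move=> p; rewrite inE => /orP[/eqP->//|/mapP[q ql ->/=]]; exact: l1.
- by apply: partial_fractions_add => // p /ratio[].
rewrite /add_node big_cons/= big_map/=.
have h1 : \sum_(p <- l) `|p.2 * ((b ^+ 2 - 1) / (b ^+ 2 - p.1 ^+ 2))| <= 2 * (c / 8).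
  apply: le_trans (ler_wpM2l _ lc) => //.
  rewrite mulr_sumr !big_seq ler_sum// => p pl; have [_ r0 r2] := ratio p pl.
  by rewrite normrM mulrC (ger0_norm r0) ler_wpM2r.
have h2 : `|\sum_(p <- l) p.2 * (p.1 / b * ((b ^+ 2 - 1) / (b ^+ 2 - p.1 ^+ 2)))| <= 2 * (c / 8).
  apply: le_trans (ler_norm_sum _ _ _) _.
  apply: le_trans (ler_wpM2l _ lc) => //.
  rewrite mulr_sumr !big_seq ler_sum// => p pl; have [_ r0 r2] := ratio p pl.
  have p0 : 0 < p.1 by rewrite (lt_trans ltr01)// l1.
  have pb : p.1 / b <= 1.
    rewrite ler_pdivrMr// mul1r -ler_sqr ?nnegrE ?ltW//.
    have p2 : 0 < p.1 ^+ 2 by rewrite exprn_gt0.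
    by have := lS p pl; lra.
  have pb0 : 0 <= p.1 / b by rewrite divr_ge0// ltW.
  rewrite normrM mulrC ler_wpM2r// ger0_norm; last exact: mulr_ge0.
  by rewrite -[2]mul1r ler_pM.
have h3 : `|- b^-1 - \sum_(p <- l) p.2 * (p.1 / b * ((b ^+ 2 - 1) / (b ^+ 2 - p.1 ^+ 2)))| <=
    c / 2 + 2 * (c / 8).
  rewrite (le_trans (ler_normB _ _))// lerD// normrN ger0_norm// invr_ge0 ltW//.
lra.
Qed.

Lemma sqr_sub1_gt0 a : 1 < a -> 0 < a ^+ 2 - 1.
Proof. by move=> a1; rewrite expr2; nra. Qed.

Lemma node_ge0 e a t : 0 < e -> 1 < a -> 0 <= node e a t.
Proof.
move=> e0 a1; rewrite /node divr_ge0//; last by rewrite addr_ge0// sqr_ge0.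
by rewrite mulr_ge0 ?sqr_ge0// ltW// sqr_sub1_gt0.
Qed.

Lemma node_le e a t : 0 < e -> 1 < a -> node e a t <= 1 - a ^- 2.
Proof.
move=> e0 a1; have a0 : 0 < a by rewrite (lt_trans ltr01).
have ea : 0 < e * a by rewrite mulr_gt0.
have q0 := sqD_gt0 t ea.
have h : 0 <= a ^+ 2 - 1 by rewrite ltW// sqr_sub1_gt0.
rewrite /node ler_pdivrMr//.
have -> : (1 - a ^- 2) * (t ^+ 2 + (e * a) ^+ 2) =
    (a ^+ 2 - 1) * e ^+ 2 + (a ^+ 2 - 1) * a ^- 2 * t ^+ 2.
  by field; rewrite gt_eqF.
rewrite lerDl; apply: mulr_ge0; last exact: sqr_ge0.
by rewrite divr_ge0 ?sqr_ge0.
Qed.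

Lemma node_le1 e a t : 0 < e -> 1 < a -> node e a t <= 1.
Proof.
move=> e0 a1; rewrite (le_trans (node_le _ e0 a1))// lerBlDr lerDl invr_ge0.
exact: sqr_ge0.
Qed.

Lemma measurable_node e a : 0 < e -> 1 < a -> measurable_fun setT (node e a).
Proof.
move=> e0 a1; apply: continuous_measurable_fun => t.
have a0 : 0 < a by rewrite (lt_trans ltr01).
have q0 := sqD_gt0 t (mulr_gt0 e0 a0).
apply: cvgMr; apply: cvgV; first by rewrite gt_eqF.
by apply: cvgD; [exact: exprn_continuous|exact: cvg_cst].
Qed.

Lemma node_kernel_tame e l : 0 < e -> (forall p, p \in l -> 1 < p.1) ->
  [/\ tame (node_kernel e l), forall t, 0 <= node_kernel e l t &
      forall t, node_kernel e l t <= poisson e t].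
Proof.
move=> e0 l1; have [tP _ _ _] := poisson_tame e0.
suff [m0 m1 m2] : [/\ measurable_fun setT (fun t => \prod_(p <- l) node e p.1 t),
    forall t, 0 <= \prod_(p <- l) node e p.1 t & forall t, \prod_(p <- l) node e p.1 t <= 1].
  split.
  - have -> : node_kernel e l = (fun t => (\prod_(p <- l) node e p.1 t) * poisson e t).
      by apply/funext => t; rewrite /node_kernel mulrC.
    by apply: (@tameM _ 1) => // t; rewrite ger0_norm.
  - by move=> t; rewrite mulr_ge0// poisson_ge0.
  - by move=> t; rewrite ler_piMr// poisson_ge0.
elim: l l1 => [|p l IH] l1.
  split.
  - rewrite (_ : (fun t => _) = cst 1)//.
    by apply/funext => t; rewrite big_nil.
  - by move=> t; rewrite big_nil.
  - by move=> t; rewrite big_nil.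
have [|m0 m1 m2] := IH; first by move=> q ql; apply: l1; rewrite inE ql orbT.
have p1 : 1 < p.1 by apply: l1; rewrite inE eqxx.
split.
- rewrite (_ : (fun t => _) = (fun t => node e p.1 t * \prod_(q <- l) node e q.1 t)); last first.
    by apply/funext => t; rewrite big_cons.
  by apply: measurable_funM => //; exact: measurable_node.
- by move=> t; rewrite big_cons mulr_ge0// node_ge0.
- by move=> t; rewrite big_cons mulr_ile1// ?node_ge0// node_le1.
Qed.

Section reproduction_nodes.
Variables (W Wt Wy Wtt : R -> R -> R).
Hypothesis hW : bharmonic W Wt Wy Wtt.

Lemma node_reproduction s e l : 0 < s -> 0 < e -> (forall p, p \in l -> 1 < p.1) ->
  partial_fractions l ->
  W 0 (s + e) + \sum_(p <- l) p.2 * W 0 (s + e * p.1) =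
  intR (fun t => W t s * node_kernel e l t).
Proof.
move=> s0 e0 l1 pf.
rewrite (_ : (fun t => _) = (fun t => W t s * poisson e t +
    W t s * \sum_(p <- l) p.2 * poisson (e * p.1) t)); last first.
  by apply/funext => t; rewrite pf// mulrDr.
suff [tS IS] : tame (fun t => W t s * \sum_(p <- l) p.2 * poisson (e * p.1) t) /\
   intR (fun t => W t s * \sum_(p <- l) p.2 * poisson (e * p.1) t) =
   \sum_(p <- l) p.2 * W 0 (s + e * p.1).
  rewrite intRD//; last by apply: (bh_tame hW) => //; have [] := poisson_tame e0.
  by rewrite IS (poisson_reproduction hW).
elim: l l1 {pf} => [|p l IH] l1.
  have -> : (fun t => W t s * \sum_(p <- [::]) p.2 * poisson (e * p.1) t) =
      (fun t => 0 * (1 + t ^+ 2)^-1).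
    by apply/funext => t; rewrite big_nil mulr0 mul0r.
  by rewrite intR_cauchy big_nil mul0r; split => //; exact: tame_cauchy.
have [|tS IS] := IH; first by move=> q ql; apply: l1; rewrite inE ql orbT.
have p1 : 1 < p.1 by apply: l1; rewrite inE eqxx.
have ep : 0 < e * p.1 by rewrite mulr_gt0// (lt_trans ltr01).
have [tP _ _ _] := poisson_tame ep.
have tWP : tame (fun t => W t s * poisson (e * p.1) t) by exact: (bh_tame hW).
have -> : (fun t => W t s * \sum_(q <- p :: l) q.2 * poisson (e * q.1) t) =
    (fun t => p.2 * (W t s * poisson (e * p.1) t) +
      W t s * \sum_(q <- l) q.2 * poisson (e * q.1) t).
  by apply/funext => t; rewrite big_cons mulrDr mulrCA.
split; first by apply: tameD => //; exact: tameZ.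
rewrite intRD//; last exact: tameZ.
by rewrite intRZ// IS big_cons (poisson_reproduction hW).
Qed.

End reproduction_nodes.

End nodes.

(** * Moments of harmonic functions of polynomial growth *)

Section moments_of_polynomial_growth.
Variable R : realType.
Implicit Types (f g p : R -> R) (a b c e t x y s : R) (w : R -> R).

Lemma convex_midpoint (f f' f'' : R -> R) (x y : R) : x <= y ->
  (forall z : R, x <= z <= y -> is_derive z (1 : R) f (f' z)) ->
  (forall z : R, x <= z <= y -> is_derive z (1 : R) f' (f'' z)) ->
  (forall z : R, x <= z <= y -> 0 <= f'' z) ->
  2 * f ((x + y) / 2) <= f x + f y.
Proof.
move=> xy df df' f''0.
have mvt (g g' : R -> R) u v : x <= u -> u <= v -> v <= y ->
    (forall z, x <= z <= y -> is_derive z (1 : R) g (g' z)) ->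
    exists2 c, u <= c <= v & g v - g u = g' c * (v - u).
  move=> xu uv vy dg; have [||c cuv ->] := @MVT_segment R g g' u v uv.
  - move=> z; rewrite in_itv/= => /andP[h1 h2]; apply: dg.
    by rewrite (le_trans xu (ltW h1)) (le_trans (ltW h2) vy).
  - apply: derivable_within_continuous => z; rewrite in_itv/= => /andP[h1 h2].
    have zxy : x <= z <= y by rewrite (le_trans xu h1) (le_trans h2 vy).
    by have [] := dg z zxy.
  - by exists c => //; move: cuv; rewrite in_itv.
pose m := (x + y) / 2; have xm : x <= m by rewrite /m; lra.
have my : m <= y by rewrite /m; lra.
have [c1 /andP[h1 h2] e1] := mvt f f' x m (lexx _) xm my df.
have [c2 /andP[h3 h4] e2] := mvt f f' m y xm my (lexx _) df.
have [c3 /andP[h5 h6] e3] := mvt f' f'' c1 c2 h1 (le_trans h2 h3) h4 df'.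
have c30 : 0 <= f'' c3 by rewrite f''0// (le_trans h1 h5) (le_trans h6 h4).
have c12 : 0 <= f' c2 - f' c1 by rewrite e3 mulr_ge0// subr_ge0 (le_trans h2 h3).
have hm : y - m = m - x by rewrite /m; field.
rewrite hm in e2; have : 0 <= (f' c2 - f' c1) * (m - x) by rewrite mulr_ge0// subr_ge0.
rewrite mulrBl -e1 -e2 -/m; lra.
Qed.

(** If [|a2| <= b2] then [b0 - a0] and [b0 + a0] are convex. Their midpoint
    inequalities between [y] and 1 bound [a0 y] from both sides, and involve no
    other values of [a0] than those in the interval from 1/2 to 1. *)
Lemma barrier_bound (a0 a1 a2 b0 b1 b2 : R -> R) (A y : R) : 0 < y <= 1 ->
  (forall z : R, 0 < z -> is_derive z (1 : R) a0 (a1 z)) ->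
  (forall z : R, 0 < z -> is_derive z (1 : R) a1 (a2 z)) ->
  (forall z : R, 0 < z -> is_derive z (1 : R) b0 (b1 z)) ->
  (forall z : R, 0 < z -> is_derive z (1 : R) b1 (b2 z)) ->
  (forall z : R, 0 < z <= 1 -> `|a2 z| <= b2 z) ->
  (forall z : R, 1 / 2 <= z <= 1 -> `|a0 z| <= A) ->
  `|a0 y| <= 3 * A + b0 y + b0 1 - 2 * b0 ((y + 1) / 2).
Proof.
move=> /andP[y0 y1] da0 da1 db0 db1 ab aA.
have zp z : y <= z <= 1 -> 0 < z by move=> /andP[yz _]; exact: lt_le_trans yz.
have h1 := @convex_midpoint (fun z => b0 z - a0 z) (fun z => b1 z - a1 z)
  (fun z => b2 z - a2 z) y 1 y1.
have h2 := @convex_midpoint (fun z => b0 z + a0 z) (fun z => b1 z + a1 z)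
  (fun z => b2 z + a2 z) y 1 y1.
have a2b z : y <= z <= 1 -> - b2 z <= a2 z <= b2 z.
  move=> zy; rewrite -ler_norml ab// (zp z zy)/=.
  by case/andP: zy.
have {}h1 : 2 * (b0 ((y + 1) / 2) - a0 ((y + 1) / 2)) <= b0 y - a0 y + (b0 1 - a0 1).
  apply: h1 => z zy.
  - by apply: dB; [exact: db0 (zp z zy)|exact: da0 (zp z zy)].
  - by apply: dB; [exact: db1 (zp z zy)|exact: da1 (zp z zy)].
  - by have /andP[] := a2b z zy; lra.
have {}h2 : 2 * (b0 ((y + 1) / 2) + a0 ((y + 1) / 2)) <= b0 y + a0 y + (b0 1 + a0 1).
  apply: h2 => z zy.
  - by apply: dD; [exact: db0 (zp z zy)|exact: da0 (zp z zy)].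
  - by apply: dD; [exact: db1 (zp z zy)|exact: da1 (zp z zy)].
  - by have /andP[] := a2b z zy; lra.
have m1 : 1 / 2 <= (y + 1) / 2 <= 1 by apply/andP; split; lra.
have := aA _ m1; have := aA 1; rewrite lexx andbT.
have : 1 / 2 <= (1 : R) by lra.
move=> + /(_ _) => -> /(_ isT); rewrite !ler_norml => /andP[? ?] /andP[? ?].
by apply/andP; split; lra.
Qed.

Fixpoint Cn_bounded (n : nat) w f : Prop :=
  match n with
  | 0%N => continuous f /\ forall t, `|f t| <= w t
  | m.+1 => (forall t, `|f t| <= w t) /\
      exists f', (forall t, is_derive t (1 : R) f (f' t)) /\ Cn_bounded m w f'
  end.

Lemma Cn_le n w f : Cn_bounded n w f -> forall t, `|f t| <= w t.
Proof. by case: n => [[]|n []]. Qed.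

Lemma Cn_continuous n w f : Cn_bounded n w f -> continuous f.
Proof. by case: n => [[]//|n [_ [f' [df _]]]]; exact: is_derive_continuous df. Qed.

Lemma Cn_mono n w w' f : (forall t, w t <= w' t) -> Cn_bounded n w f -> Cn_bounded n w' f.
Proof.
move=> ww; elim: n f => [|n IH] f /=.
  by move=> [cf fw]; split => // t; rewrite (le_trans (fw t)).
move=> [fw [f' [df df']]]; split; first by move=> t; rewrite (le_trans (fw t)).
by exists f'; split => //; exact: IH.
Qed.

Lemma Cn_pred n w f : Cn_bounded n.+1 w f -> Cn_bounded n w f.
Proof.
elim: n f => [|n IH] f [fw [f' [df h]]] /=.
  by split => //; exact: is_derive_continuous df.
by split => //; exists f'; split => //; exact: IH.
Qed.

Lemma Cn_add n w1 w2 f g : Cn_bounded n w1 f -> Cn_bounded n w2 g ->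
  Cn_bounded n (fun t => w1 t + w2 t) (fun t => f t + g t).
Proof.
elim: n f g => [|n IH] f g /=.
  move=> [cf fw] [cg gw]; split; first by move=> t; apply: cvgD; [exact: cf|exact: cg].
  by move=> t; rewrite (le_trans (ler_normD _ _))// lerD.
move=> [fw [f' [df hf]]] [gw [g' [dg hg]]]; split.
  by move=> t; rewrite (le_trans (ler_normD _ _))// lerD.
exists (fun t => f' t + g' t); split; last exact: IH.
by move=> t; exact: dD.
Qed.

Lemma Cn_mul n w1 w2 f g : Cn_bounded n w1 f -> Cn_bounded n w2 g ->
  Cn_bounded n (fun t => 2 ^+ n * (w1 t * w2 t)) (fun t => f t * g t).
Proof.
elim: n w1 w2 f g => [|n IH] w1 w2 f g.
  move=> [cf fw] [cg gw]; split; first by move=> t; apply: cvgM; [exact: cf|exact: cg].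
  by move=> t; rewrite expr0 mul1r normrM ler_pM.
move=> /[dup] hf [fw [f' [df hf']]] /[dup] hg [gw [g' [dg hg']]]; split.
  move=> t; rewrite normrM (le_trans (ler_pM _ _ (fw t) (gw t)))// ler_peMl//.
    by rewrite mulr_ge0// (le_trans _ (fw t), le_trans _ (gw t)).
  by rewrite exprn_ege1// ler1n.
exists (fun t => f' t * g t + f t * g' t); split; first by move=> t; exact: dM.
have h := Cn_add (IH _ _ _ _ hf' (Cn_pred hg)) (IH _ _ _ _ (Cn_pred hf) hg').
by apply: Cn_mono h => t; rewrite exprS -!mulrA mulr_natl mulr2n.
Qed.

Lemma Cn_cst n c : Cn_bounded n (fun=> `|c|) (fun=> c).
Proof.
elim: n c => [|n IH] c /=; first by split => // t; exact: cvg_cst.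
split => //; exists (fun=> 0); split; first by move=> t; exact: dC.
by apply: Cn_mono (IH 0) => t; rewrite normr0.
Qed.

Lemma Cn_scale n c w f : Cn_bounded n w f -> Cn_bounded n (fun t => 2 ^+ n * (`|c| * w t)) (fun t => c * f t).
Proof. by move=> hf; exact: Cn_mul (Cn_cst n c) hf. Qed.

(** The constant depends only on [n] and on the bound for [w * v]; this makes
    the estimate uniform over families of functions [f]. *)
Lemma Cn_inv n : forall q : R, 0 <= q -> exists2 C, 0 <= C &
  forall w v f, (forall t, 0 <= v t) -> (forall t, w t * v t <= q) ->
  Cn_bounded n w f -> (forall t, f t != 0 /\ `|(f t)^-1| <= v t) ->
  Cn_bounded n (fun t => C * v t) (fun t => (f t)^-1).
Proof.
move=> q q0; elim: n => [|n [C C0 IH]].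
  exists 1 => // w v f v0 wv [cf _] fv; split.
    by move=> t; apply: cvgV; [case: (fv t)|exact: cf].
  by move=> t; rewrite mul1r; case: (fv t).
exists (1 + C + 2 ^+ n * 2 ^+ n * 2 ^+ n * (C * C) * q).
  by rewrite addr_ge0 ?addr_ge0// !mulr_ge0.
move=> w v f v0 wv /[dup] hf [fw [f' [df hf']]] fv.
have hi := IH w v f v0 wv (Cn_pred hf) fv.
split.
  move=> t; have [_ h] := fv t; rewrite (le_trans h)// ler_peMl//.
  by rewrite -addrA lerDl addr_ge0// !mulr_ge0.
exists (fun t => - f' t * ((f t)^-1 * (f t)^-1)); split.
  by move=> t; have [f0 _] := fv t; exact: dV.
have hN : Cn_bounded n (fun t => 2 ^+ n * (1 * w t)) (fun t => - f' t).
  have := Cn_scale (-1) hf'; rewrite normrN1.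
  by have -> : (fun t => - f' t) = (fun t => -1 * f' t) by apply/funext => t; rewrite mulN1r.
apply: Cn_mono (Cn_mul hN (Cn_mul hi hi)) => t.
have -> : 2 ^+ n * (2 ^+ n * (1 * w t) * (2 ^+ n * (C * v t * (C * v t)))) =
  2 ^+ n * 2 ^+ n * 2 ^+ n * (C * C) * (w t * v t) * v t by ring.
rewrite ler_wpM2r// ler_wpDl ?addr_ge0// ler_wpM2l// !mulr_ge0//.
Qed.

Definition weight (c : R) (M : nat) t : R := c * (1 + t ^+ 2) ^- M.+1.

Lemma weight_cauchy c M t : 0 <= c -> weight c M t <= c * (1 + t ^+ 2)^-1.
Proof.
move=> c0; rewrite /weight ler_wpM2l// lef_pV2 ?posrE ?exprn_gt0 ?oneDsqr_gt0//.
rewrite (exprS _ M) ler_peMr ?(ltW (oneDsqr_gt0 t))//.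
by rewrite exprn_ege1// lerDl sqr_ge0.
Qed.

Lemma Cn_tame n c M f : 0 <= c -> Cn_bounded n (weight c M) f -> tame f.
Proof.
move=> c0 hf; split; first exact: continuous_measurable_fun (Cn_continuous hf).
by exists c => t; rewrite (le_trans (Cn_le hf t))// weight_cauchy.
Qed.

Definition growth (W : R -> R -> R) (N : R) (M E : nat) :=
  forall t y, 0 < y <= 1 -> `|W t y| <= N * (1 + t ^+ 2) ^+ M * y ^- E.

Lemma is_derive_powV n (z : R) : 0 < z ->
  is_derive z (1 : R) (fun z => z ^- n.+1) (- (n.+1%:R * z ^- n.+2)).
Proof.
move=> z0; apply: is_derive_eqv (dV _ (dX n (dI z))) _; first by rewrite expf_neq0// gt_eqF.
have zn : z ^+ n != 0 by rewrite expf_neq0// gt_eqF.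
rewrite !exprS; move: (n.+1%:R : R) (z ^+ n) zn => k a a0.
by field; rewrite a0 gt_eqF.
Qed.

Section moments_growth.
Variables (W Wt Wy Wtt : R -> R -> R).
Hypothesis hW : bharmonic W Wt Wy Wtt.

Lemma growth_moment N c (M E n : nat) f y : 0 <= N -> 0 <= c -> growth W N M E ->
  Cn_bounded n (weight c M) f -> 0 < y <= 1 -> `|intR (fun t => W t y * f t)| <= N * c * pi * y ^- E.
Proof.
move=> N0 c0 gW hf y01; have /andP[y0 _] := y01.
rewrite mulrAC; apply: intR_norm_cauchy.
  have [m _] := bh_tame hW y0 (Cn_tame c0 hf); exact: m.
move=> t; rewrite normrM (le_trans (ler_pM _ _ (gW t y y01) (Cn_le hf t)))//.
rewrite /weight (exprS _ M) invfM; apply: eq_ler.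
have d0 := oneDsqr_gt0 t; field; rewrite !gt_eqF ?exprn_gt0//.
Qed.

End moments_growth.

(** By induction on [j]. The second derivative in [y] of a moment is a moment
    against the second derivative of [f], which is subject to a bound by
    [y^-(m+3)]; [barrier_bound] integrates this bound twice. *)
Lemma moment_growth_power (M j m : nat) : exists2 C : R, 0 <= C &
  forall W Wt Wy Wtt (N c : R) f, bharmonic W Wt Wy Wtt -> 0 <= N -> 0 <= c ->
  growth W N M (m.+1 + j.*2) -> Cn_bounded j.*2 (weight c M) f ->
  forall y, 0 < y <= 1 -> `|intR (fun t => W t y * f t)| <= C * (N * c) * y ^- m.+1.
Proof.
have pi0 : 0 <= (pi : R) := pi_ge0 R.
elim: j m => [|j IH] m.
  exists pi => // W Wt Wy Wtt N c f hW N0 c0 gW hf y y01; rewrite addn0 in gW.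
  by rewrite (le_trans (growth_moment hW N0 c0 gW hf y01))// [pi * _]mulrC.
have [C C0 CP] := IH m.+2.
exists (3 * (pi * 2 ^+ (m.+1 + j.+1.*2)) + 2 * C); first by rewrite !addr_ge0 ?mulr_ge0.
move=> W Wt Wy Wtt N c f hW N0 c0 gW hf y y01.
have [fw [f' [df [fw' [f'' [df' hf'']]]]]] := hf.
have tf := Cn_tame c0 hf; have Nc0 : 0 <= N * c by rewrite mulr_ge0.
have hf' : Cn_bounded j.*2.+1 (weight c M) f' by split => //; exists f''.
have tf' := Cn_tame c0 hf'; have tf'' := Cn_tame c0 hf''.
pose B := C * (N * c); have B0 : 0 <= B by rewrite mulr_ge0.
have gW' : growth W N M (m.+3 + j.*2).
  move=> t z z01; have := gW t z z01.
  by rewrite doubleS !addnS !addSn.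
have d1 (z : R) : 0 < z ->
    is_derive z (1 : R) (fun z => B * z ^- m.+1) (B * - (m.+1%:R * z ^- m.+2)).
  move=> z0; apply: is_derive_eqv (dM (dC B z) (is_derive_powV m z0)) _.
  by rewrite mul0r add0r.
have d2 (z : R) : 0 < z -> is_derive z (1 : R) (fun z => B * - (m.+1%:R * z ^- m.+2))
    (B * (m.+1%:R * m.+2%:R * z ^- m.+3)).
  move=> z0; apply: is_derive_eqv
    (dM (dC B z) (dN (dM (dC m.+1%:R z) (is_derive_powV m.+1 z0)))) _.
  by rewrite !mul0r !add0r !mulrN opprK !mulrA.
have bnd (z : R) : 0 < z <= 1 ->
    `|- intR (fun t => W t z * f'' t)| <= B * (m.+1%:R * m.+2%:R * z ^- m.+3).
  move=> z01; have /andP[z0 _] := z01.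
  rewrite normrN (le_trans (CP _ _ _ _ _ _ _ hW N0 c0 gW' hf'' z z01))//.
  rewrite -/B ler_wpM2l// ler_peMl ?invr_ge0 ?exprn_ge0 ?(ltW z0)//.
  by rewrite -natrM -[1]/(1%:R) ler_nat.
have A (z : R) : 1 / 2 <= z <= 1 ->
    `|intR (fun t => W t z * f t)| <= pi * 2 ^+ (m.+1 + j.+1.*2) * (N * c).
  move=> /andP[z2 z1]; have z0 : 0 < z by lra.
  have z01 : 0 < z <= 1 by rewrite z0.
  rewrite (le_trans (growth_moment hW N0 c0 gW hf z01))//.
  rewrite [leRHS](_ : _ = N * c * pi * 2 ^+ (m.+1 + j.+1.*2)); last by ring.
  rewrite ler_wpM2l ?mulr_ge0// -exprVn lerXn2r ?nnegrE ?invr_ge0 ?(ltW z0)//.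
  by rewrite -[2]invrK lef_pV2 ?posrE ?invr_gt0//; lra.
have := barrier_bound y01 (fun z z0 => is_derive_moment_y hW z0 tf)
  (fun z z0 => is_derive_moment_yy hW z0 tf tf' tf'' df df') d1 d2 bnd A.
move/le_trans; apply.
have /andP[y0 y1] := y01.
have hm : 0 <= B * ((y + 1) / 2) ^- m.+1.
  by rewrite mulr_ge0// invr_ge0 exprn_ge0//; lra.
have yE : 1 <= y ^- m.+1.
  by rewrite invf_ge1 ?exprn_gt0// exprn_ile1// ltW.
rewrite expr1n invr1 mulr1.
have h1 : B <= B * y ^- m.+1 by rewrite ler_peMr.
have h2 : 3 * (pi * 2 ^+ (m.+1 + j.+1.*2) * (N * c)) <=
    3 * (pi * 2 ^+ (m.+1 + j.+1.*2)) * (N * c) * y ^- m.+1.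
  rewrite mulrA ler_peMr// !mulr_ge0//.
have -> : (3 * (pi * 2 ^+ (m.+1 + j.+1.*2)) + 2 * C) * (N * c) * y ^- m.+1 =
    3 * (pi * 2 ^+ (m.+1 + j.+1.*2)) * (N * c) * y ^- m.+1 + 2 * (B * y ^- m.+1).
  by rewrite /B; move: (pi : R) => d; ring.
lra.
Qed.

(** The last step differs from those of [moment_growth_power]: twice integrated,
    [y^-1] is [y * ln y], which is bounded. So a smooth enough weight removes
    the growth completely. *)
Lemma moment_growth_bounded (M j : nat) : exists2 C : R, 0 <= C &
  forall W Wt Wy Wtt (N c : R) f, bharmonic W Wt Wy Wtt -> 0 <= N -> 0 <= c ->
  growth W N M j.*2.+1 -> Cn_bounded j.+1.*2 (weight c M) f ->
  forall y, 0 < y <= 1 -> `|intR (fun t => W t y * f t)| <= C * (N * c).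
Proof.
have pi0 : 0 <= (pi : R) := pi_ge0 R.
have [C C0 CP] := moment_growth_power M j 0.
exists (3 * (pi * 2 ^+ j.*2.+1) + 2 * C); first by rewrite !addr_ge0 ?mulr_ge0.
move=> W Wt Wy Wtt N c f hW N0 c0 gW hf y y01.
have [fw [f' [df [fw' [f'' [df' hf'']]]]]] := hf.
have tf := Cn_tame c0 hf; have Nc0 : 0 <= N * c by rewrite mulr_ge0.
have hf' : Cn_bounded j.*2.+1 (weight c M) f' by split => //; exists f''.
have tf' := Cn_tame c0 hf'; have tf'' := Cn_tame c0 hf''.
pose B := C * (N * c); have B0 : 0 <= B by rewrite mulr_ge0.
have d1 (z : R) : 0 < z -> is_derive z (1 : R) (fun z => B * (z * ln z)) (B * (ln z + 1)).
  move=> z0; apply: is_derive_eqv (dM (dC B z) (dM (dI z) (is_derive1_ln z0))) _.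
  by rewrite mul0r add0r mul1r divff// gt_eqF.
have d2 (z : R) : 0 < z -> is_derive z (1 : R) (fun z => B * (ln z + 1)) (B * z^-1).
  move=> z0; apply: is_derive_eqv (dM (dC B z) (dD (is_derive1_ln z0) (dC 1 z))) _.
  by rewrite mul0r add0r addr0.
have bnd (z : R) : 0 < z <= 1 -> `|- intR (fun t => W t z * f'' t)| <= B * z^-1.
  move=> z01; rewrite normrN -[z]expr1; exact: (CP _ _ _ _ _ _ _ hW N0 c0 gW hf'' z z01).
have A (z : R) : 1 / 2 <= z <= 1 ->
    `|intR (fun t => W t z * f t)| <= pi * 2 ^+ j.*2.+1 * (N * c).
  move=> /andP[z2 z1]; have z0 : 0 < z by lra.
  have z01 : 0 < z <= 1 by rewrite z0.
  rewrite (le_trans (growth_moment hW N0 c0 gW hf z01))//.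
  rewrite [leRHS](_ : _ = N * c * pi * 2 ^+ j.*2.+1); last by ring.
  rewrite ler_wpM2l ?mulr_ge0// -exprVn lerXn2r ?nnegrE ?invr_ge0 ?(ltW z0)//.
  by rewrite -[2]invrK lef_pV2 ?posrE ?invr_gt0//; lra.
have := barrier_bound y01 (fun z z0 => is_derive_moment_y hW z0 tf)
  (fun z z0 => is_derive_moment_yy hW z0 tf tf' tf'' df df') d1 d2 bnd A.
move/le_trans; apply.
have /andP[y0 y1] := y01; rewrite ln1 !mulr0.
have lnz (z : R) : 0 < z -> z <= 1 -> - 1 <= z * ln z <= 0.
  move=> z0 z1; rewrite mulr_ge0_le0 ?(ltW z0) ?ln_le0// andbT.
  have : ln (1 + (z^-1 - 1)) <= z^-1 - 1.
    have zV : 0 < z^-1 by rewrite invr_gt0.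
    by apply: le_ln1Dx; lra.
  rewrite addrC subrK lnV ?posrE// => h.
  have : z * - ln z <= z * (z^-1 - 1) by rewrite ler_wpM2l// ltW.
  by rewrite mulrBr divff ?gt_eqF// mulrN mulr1; lra.
have /andP[_ h1] := lnz y y0 y1.
have m0 : 0 < (y + 1) / 2 by lra.
have m1 : (y + 1) / 2 <= 1 by lra.
have /andP[h2 _] := lnz _ m0 m1.
have h3 : B * (y * ln y) <= 0 by rewrite mulr_ge0_le0.
have h4 : - B <= B * ((y + 1) / 2 * ln ((y + 1) / 2)).
  by rewrite -mulrN1 ler_wpM2l.
have -> : (3 * (pi * 2 ^+ j.*2.+1) + 2 * C) * (N * c) =
    3 * (pi * 2 ^+ j.*2.+1 * (N * c)) + 2 * B.
  by rewrite /B; move: (pi : R) => d; ring.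
lra.
Qed.

End moments_of_polynomial_growth.

(** * Smooth truncation of node kernels *)

Section cut_kernel.
Variable R : realType.
Implicit Types (f g : R -> R) (a b c e t x y s : R) (l : seq (R * R)).

Definition bump (k : nat) t : R := (Num.max 0 (1 - t ^+ 2)) ^+ k.

Lemma bump_ge0 k t : 0 <= bump k t.
Proof. by rewrite exprn_ge0// le_max lexx. Qed.

Lemma bump_out k t : (0 < k)%N -> 1 <= `|t| -> bump k t = 0.
Proof.
move=> k0 t1; rewrite /bump max_l ?expr0n ?gtn_eqF//.
by rewrite subr_le0 -real_normK ?num_real// exprn_ege1.
Qed.

Lemma is_derive_maxX k (v : R) :
  is_derive v (1 : R) (fun v => Num.max 0 v ^+ k.+2) (k.+2%:R * Num.max 0 v ^+ k.+1).
Proof.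
have [v0|v0|<-] := ltgtP 0 v.
- have h := dX k.+1 (dI v); rewrite mulr1 in h.
  apply: near_eq_is_derive h; near=> u; rewrite max_r// ltW//.
  by near: u; exact: lt_nbhsr.
- rewrite expr0n mulr0.
  have h := dC (0 : R) v.
  apply: near_eq_is_derive h; near=> u; rewrite max_l ?expr0n// ltW//.
  by near: u; exact: lt_nbhsl.
- rewrite expr0n mulr0.
  have h : (fun h : R => h^-1 *: (((fun v : R => Num.max 0 v ^+ k.+2) \o shift 0) (h *: 1)
      - Num.max 0 0 ^+ k.+2)) @ 0^' --> (0 : R).
    apply/cvgrPdist_le => e e0; near=> h.
    have h0 : h != 0 by near: h; exact: nbhs_dnbhs_neq.
    rewrite sub0r normrN /= addr0 /GRing.scale/= mulr1 (max_l (lexx (0 : R))) expr0n subr0.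
    have h1 : `|h| <= Num.min e 1.
      by near: h; apply: dnbhs0_le; rewrite lt_min e0 ltr01.
    have [he h2] : `|h| <= e /\ `|h| <= 1 by move: h1; rewrite le_min => /andP.
    have mh : `|Num.max 0 h| <= `|h|.
      by have [_|_] := leP 0 h; rewrite ?normr0.
    rewrite normrM normrX normfV mulrC ler_pdivrMr ?normr_gt0//.
    rewrite exprS exprS mulrA (le_trans (y := `|h| * `|h| * 1))//.
      rewrite ler_pM ?mulr_ge0 ?exprn_ge0 ?normr_ge0 ?ler_pM//.
      by rewrite exprn_ile1// (le_trans mh).
    by rewrite mulr1 ler_wpM2r.
  by apply: DeriveDef; [apply/cvg_ex; exists 0|apply/cvg_lim].
Unshelve. all: by end_near. Qed.

Lemma bump_mul k t : bump k.+2 t = (1 - t ^+ 2) * bump k.+1 t.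
Proof.
rewrite /bump exprS; have [h|h] := leP 0 (1 - t ^+ 2); first by [].
by rewrite expr0n !mulr0.
Qed.

Lemma is_derive_bump k t :
  is_derive t (1 : R) (bump k.+2) (- (2 * k.+2%:R) * t * bump k.+1 t).
Proof.
have d : is_derive t (1 : R) (fun t => 1 - t ^+ 2) (- (2 * t)).
  by apply: is_derive_eqv (dB (dC 1 t) (dX 1 (dI t))) _; ring.
apply: is_derive_eqv (dcomp (g := fun t => 1 - t ^+ 2) (is_derive_maxX k _) d) _.
by rewrite /bump; ring.
Qed.

Lemma horner_bounded (p : {poly R}) : exists2 C : R, 0 <= C &
  forall t, `|t| <= 1 -> `|p.[t]| <= C.
Proof.
elim/poly_ind: p => [|p c [C C0 CP]]; first by exists 0 => // t _; rewrite horner0 normr0.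
exists (C + `|c|); first by rewrite addr_ge0.
move=> t t1; rewrite hornerMXaddC (le_trans (ler_normD _ _))// lerD// normrM.
by rewrite -[C]mulr1 ler_pM// CP.
Qed.

(** The derivative of a polynomial times [bump k.+1] is a polynomial times [bump
    k]. *)
Lemma Cn_poly_bump n k (p : {poly R}) : exists2 C : R, 0 <= C &
  Cn_bounded n (fun=> C) (fun t => p.[t] * bump (n + k).+1 t).
Proof.
elim: n k p => [|n IH] k p.
  have [C C0 CP] := horner_bounded p; exists C => //; split.
    move=> t; apply: cvgM; first exact: continuous_horner.
    rewrite /bump; apply: (@cvg_comp _ _ _ (fun t : R => Num.max 0 (1 - t ^+ 2)) (fun v => v ^+ k.+1));
      last exact: exprn_continuous.
    apply: (@continuous_max _ _ _ _ t); first exact: cvg_cst.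
    by apply: cvgB; [exact: cvg_cst|exact: exprn_continuous].
  move=> t; have [t1|t1] := leP `|t| 1; last first.
    by rewrite bump_out// ?mulr0 ?normr0// ltW.
  rewrite normrM -[C]mulr1 ler_pM// ?CP// ger0_norm ?bump_ge0//.
  rewrite /bump exprn_ile1// ?le_max ?lexx// ge_max ler01 lerBlDr lerDl sqr_ge0//.
have [C1 C10 h1] := IH k.+1 p.
have [C2 C20 h2] := IH k (p^`() * (1 - 'X^2) - (2 * (n + k).+2%:R) *: ('X * p)).
exists (C1 + C2); first by rewrite addr_ge0.
split.
  have := Cn_le h1; rewrite addnS => h t; rewrite (le_trans (h t))// lerDl//.
exists (fun t => (p^`() * (1 - 'X^2) - (2 * (n + k).+2%:R) *: ('X * p)).[t] * bump (n + k).+1 t).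
split; last by apply: Cn_mono h2 => t; rewrite lerDr.
move=> t; rewrite addSn.
apply: is_derive_eqv (dM (is_derive_poly p t) (is_derive_bump (n + k) t)) _.
rewrite bump_mul hornerD hornerN hornerZ !hornerM hornerX hornerD hornerN hornerXn hornerC.
by move: ((n + k).+2%:R : R) => N; ring.
Qed.

(** The denominator of the Poisson kernel, changed on the unit interval only, so
    as to stay away from zero when [e] is small. *)
Definition cut_den k e t : R := t ^+ 2 + e ^+ 2 + bump k t.

Lemma Cn_sqr n : Cn_bounded n (fun t => 2 * (1 + t ^+ 2)) (fun t : R => t ^+ 2).
Proof.
have b0 t : `|t ^+ 2| <= 2 * (1 + t ^+ 2).
  by rewrite ger0_norm ?sqr_ge0//; have := sqr_ge0 t; lra.
have b1 t : `|2 * t| <= 2 * (1 + t ^+ 2).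
  rewrite normrM ger0_norm// ler_wpM2l// ler_norml.
  by have := sqr_ge0 (t + 1); have := sqr_ge0 (t - 1); rewrite !expr2; nra.
have d0 t : is_derive t (1 : R) (fun t : R => t ^+ 2) (2 * t).
  by apply: is_derive_eqv (dX 1 (dI t)) _; ring.
have d1 t : is_derive t (1 : R) (fun t : R => 2 * t) (2 : R).
  by apply: is_derive_eqv (dM (dC 2 t) (dI t)) _; ring.
case: n => [|n]; first by split => //; exact: is_derive_continuous d0.
split => //; exists (fun t => 2 * t); split => //.
case: n => [|n]; first by split => //; exact: is_derive_continuous d1.
split => //; exists (fun=> 2); split => //.
apply: Cn_mono (Cn_cst n 2) => t; rewrite ger0_norm// ler_peMr// lerDl sqr_ge0//.
Qed.

(** If [t^2 <= 1/4], then [bump k t] is at least [(3/4)^k]; otherwise [t^2] is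
    at least [(1 + t^2) / 5]. *)
Lemma cut_den_ge k e t : (3 / 4) ^+ k / 5 * (1 + t ^+ 2) <= cut_den k e t.
Proof.
have k0 : 0 <= (3 / 4 : R) ^+ k by rewrite exprn_ge0.
have k1 : (3 / 4 : R) ^+ k <= 1 by rewrite exprn_ile1//; lra.
have e0 := sqr_ge0 e; have t0 := sqr_ge0 t; have b0 := bump_ge0 k t.
rewrite /cut_den; have [h|h] := leP (t ^+ 2) (1 / 4).
  have : (3 / 4) ^+ k <= bump k t.
    by rewrite /bump lerXn2r ?nnegrE ?le_max ?lexx//; apply/orP; right; lra.
  have : (3 / 4) ^+ k * (1 + t ^+ 2) <= (3 / 4) ^+ k * (5 / 4) by rewrite ler_wpM2l//; lra.
  by lra.
have : (3 / 4) ^+ k * (1 + t ^+ 2) <= 1 * (1 + t ^+ 2) by rewrite ler_wpM2r//; lra.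
lra.
Qed.

Lemma Cn_cut_den n k : (n < k)%N -> exists2 C : R, 0 <= C &
  forall e, 0 <= e <= 1 -> Cn_bounded n (fun t => C * (1 + t ^+ 2)^-1) (fun t => (cut_den k e t)^-1).
Proof.
move=> nk; have [C1 C10 h1] := Cn_poly_bump n (k - n.+1) 1.
have kE : (n + (k - n.+1)).+1 = k by rewrite -addSn subnKC.
rewrite kE in h1.
pose c : R := (3 / 4) ^+ k / 5.
have c0 : 0 < c by rewrite divr_gt0// exprn_gt0//; lra.
have q0 : 0 <= (2 + 1 + C1) / c by rewrite divr_ge0 ?addr_ge0// ltW.
have [C C0 CP] := Cn_inv n q0.
exists (C / c); first by rewrite divr_ge0// ltW.
move=> e /andP[e0 e1].
have e21 : `|e ^+ 2| <= 1 by rewrite ger0_norm ?sqr_ge0// exprn_ile1.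
have hD : Cn_bounded n (fun t => 2 * (1 + t ^+ 2) + `|e ^+ 2| + C1) (cut_den k e).
  have -> : cut_den k e = (fun t => t ^+ 2 + e ^+ 2 + (1 : {poly R}).[t] * bump k t).
    by apply/funext => t; rewrite hornerE mul1r.
  by apply: Cn_add h1; apply: Cn_add; [exact: Cn_sqr|exact: Cn_cst].
apply: Cn_mono (CP _ (fun t => c^-1 * (1 + t ^+ 2)^-1) _ _ _ hD _) => t.
- by rewrite mulrA.
- by rewrite mulr_ge0// invr_ge0 ltW// oneDsqr_gt0.
- have d0 := oneDsqr_gt0 t; rewrite mulrA ler_pdivrMr// -mulrA [_^-1 * _]mulrC mulrA.
  rewrite ler_wpM2r ?invr_ge0 ?(ltW c0)//.
  have := sqr_ge0 t; nra.
- have d0 := oneDsqr_gt0 t.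
  have D0 : 0 < cut_den k e t by rewrite (lt_le_trans _ (cut_den_ge k e t))// mulr_gt0.
  split; first by rewrite gt_eqF.
  rewrite ger0_norm ?invr_ge0 ?(ltW D0)// -invfM lef_pV2 ?posrE ?mulr_gt0//.
  exact: cut_den_ge.
Qed.

(** The node kernel with [cut_den] for its denominators: it is the same outside
    the unit interval, but smooth uniformly in [e], and small with [e] because
    of the numerators. *)
Definition cut_kernel k e l t : R := e / pi * (cut_den k e t)^-1 *
  \prod_(p <- l) ((p.1 ^+ 2 - 1) * e ^+ 2 / cut_den k (e * p.1) t).

Lemma Cn_cut_kernel n k l : (n < k)%N -> (forall p, p \in l -> 1 < p.1) ->
  exists2 C : R, 0 <= C & forall e, 0 < e <= 1 -> (forall p, p \in l -> e * p.1 <= 1) ->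
    Cn_bounded n (weight (C * e ^+ (size l).*2.+1) (size l)) (cut_kernel k e l).
Proof.
move=> nk; have [D D0 DP] := Cn_cut_den nk.
have pi0 : 0 < (pi : R) := pi_gt0 R.
elim: l => [|q l IH] l1.
  exists (2 ^+ n * (pi^-1 * D)).
    by rewrite mulr_ge0 ?exprn_ge0// mulr_ge0// invr_ge0 ltW.
  move=> e /andP[e0 e1] _.
  have e01 : 0 <= e <= 1 by rewrite ltW.
  have -> : cut_kernel k e [::] = (fun t => e / pi * (cut_den k e t)^-1).
    by apply/funext => t; rewrite /cut_kernel big_nil mulr1.
  apply: Cn_mono (Cn_scale (e / pi) (DP e e01)) => t.
  rewrite ger0_norm ?divr_ge0 ?(ltW e0) ?(ltW pi0)// /weight/= !expr1.
  by apply: eq_ler; ring.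
have [|C C0 CP] := IH; first by move=> p pl; apply: l1; rewrite inE pl orbT.
have q1 : 1 < q.1 by apply: l1; rewrite inE eqxx.
have q20 := sqr_sub1_gt0 q1.
exists (2 ^+ n * (C * (2 ^+ n * ((q.1 ^+ 2 - 1) * D)))).
  by rewrite !mulr_ge0 ?exprn_ge0// ltW.
move=> e /andP[e0 e1] le1.
have eq1 : 0 <= e * q.1 <= 1.
  by rewrite le1 ?inE ?eqxx// andbT mulr_ge0 ?(ltW e0)// ltW// (lt_trans ltr01).
have e01 : 0 < e <= 1 by rewrite e0.
have hl : Cn_bounded n (weight (C * e ^+ (size l).*2.+1) (size l)) (cut_kernel k e l).
  by apply: CP => // p pl; apply: le1; rewrite inE pl orbT.
have -> : cut_kernel k e (q :: l) = (fun t => cut_kernel k e l t *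
    ((q.1 ^+ 2 - 1) * e ^+ 2 * (cut_den k (e * q.1) t)^-1)).
  by apply/funext => t; rewrite /cut_kernel big_cons mulrCA [RHS]mulrC.
apply: Cn_mono (Cn_mul hl (Cn_scale ((q.1 ^+ 2 - 1) * e ^+ 2) (DP _ eq1))) => t.
have n0 : 0 <= (q.1 ^+ 2 - 1) * e ^+ 2 by rewrite mulr_ge0 ?sqr_ge0// ltW.
rewrite (ger0_norm n0) /weight /= doubleS.
rewrite [(1 + t ^+ 2) ^+ (size l).+2]exprS invfM 2!(exprS e (_.+1)) (exprS e (size l).*2.+1).
by apply: eq_ler; ring.
Qed.

Lemma cut_den_bounds k e t : 0 < e -> [/\ 0 < cut_den k e t,
  (cut_den k e t)^-1 <= (t ^+ 2 + e ^+ 2)^-1 &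
  (0 < k)%N -> 1 <= `|t| -> cut_den k e t = t ^+ 2 + e ^+ 2].
Proof.
move=> e0; have q0 := sqD_gt0 t e0.
have D0 : 0 < cut_den k e t by rewrite /cut_den ltr_wpDr// bump_ge0.
split => //; first by rewrite lef_pV2 ?posrE// lerDl bump_ge0.
by move=> k0 t1; rewrite /cut_den bump_out// addr0.
Qed.

Lemma cut_kernel_bounds k e l t : 0 < e -> (forall p, p \in l -> 1 < p.1) ->
  [/\ 0 <= cut_kernel k e l t, cut_kernel k e l t <= node_kernel e l t &
   (0 < k)%N -> 1 <= `|t| -> cut_kernel k e l t = node_kernel e l t].
Proof.
move=> e0 l1; have [D0 D1 D2] := cut_den_bounds k t e0.
have pi0 : 0 < (pi : R) := pi_gt0 R.
have PE : poisson e t = e / pi * (t ^+ 2 + e ^+ 2)^-1 by rewrite /poisson invfM mulrA.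
have ep0 : 0 <= e / pi by rewrite divr_ge0// ltW.
suff [h0 h1 h2] : [/\
    0 <= \prod_(p <- l) ((p.1 ^+ 2 - 1) * e ^+ 2 / cut_den k (e * p.1) t),
    \prod_(p <- l) ((p.1 ^+ 2 - 1) * e ^+ 2 / cut_den k (e * p.1) t) <=
      \prod_(p <- l) node e p.1 t &
    (0 < k)%N -> 1 <= `|t| ->
    \prod_(p <- l) ((p.1 ^+ 2 - 1) * e ^+ 2 / cut_den k (e * p.1) t) =
      \prod_(p <- l) node e p.1 t].
  have c0 : 0 <= e / pi * (cut_den k e t)^-1 by rewrite mulr_ge0// invr_ge0 ltW.
  split; rewrite /cut_kernel /node_kernel.
  - by rewrite mulr_ge0.
  - by rewrite ler_pM// PE ler_wpM2l.
  - by move=> k0 t1; rewrite h2// D2// -PE.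
elim: l l1 => [|p l IH] l1; first by rewrite !big_nil.
have [|h0 h1 h2] := IH; first by move=> q ql; apply: l1; rewrite inE ql orbT.
have p1 : 1 < p.1 by apply: l1; rewrite inE eqxx.
have ep : 0 < e * p.1 by rewrite mulr_gt0// (lt_trans ltr01).
have [E0 E1 E2] := cut_den_bounds k t ep.
have n0 : 0 <= (p.1 ^+ 2 - 1) * e ^+ 2 by rewrite mulr_ge0 ?sqr_ge0// ltW// sqr_sub1_gt0.
have d0 : 0 <= (p.1 ^+ 2 - 1) * e ^+ 2 / cut_den k (e * p.1) t by rewrite divr_ge0// ltW.
rewrite !big_cons; split.
- by rewrite mulr_ge0.
- by rewrite ler_pM// /node ler_wpM2l.
- by move=> k0 t1; rewrite h2// E2.
Qed.

End cut_kernel.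

(** * Local reproduction and vertical extrapolation *)

Section local_lemmas.
Variable R : realType.
Implicit Types (a c e t x y s : R) (l : seq (R * R)).

(** What distinguishes the node kernel from [cut_kernel], whose moments are
    small by [moment_growth_bounded]; it only sees the unit interval. *)
Definition cut_off k e l t : R := node_kernel e l t - cut_kernel k e l t.

Lemma cut_off_bounds k e l t : (0 < k)%N -> 0 < e -> (forall p, p \in l -> 1 < p.1) ->
  [/\ 0 <= cut_off k e l t, cut_off k e l t <= poisson e t &
      1 <= `|t| -> cut_off k e l t = 0].
Proof.
move=> k0 e0 l1; have [h0 h1 h2] := cut_kernel_bounds k t e0 l1.
have [_ n0 n1] := node_kernel_tame e0 l1.
split; rewrite /cut_off.
- by rewrite subr_ge0.
- by rewrite lerBlDr (le_trans (n1 t))// lerDl.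
- by move=> t1; rewrite h2// subrr.
Qed.

(** By [node_reproduction], the sum of the values of [W] is the moment of [W]
    against the node kernel. The part of this kernel that is smooth uniformly in
    [e], [cut_kernel], contributes only the error term. *)
Lemma local_reproduction (M j : nat) l : (forall p, p \in l -> 1 < p.1) ->
  partial_fractions l -> (M <= size l)%N ->
  exists2 C : R, 0 <= C & forall W Wt Wy Wtt (N e s : R), bharmonic W Wt Wy Wtt -> 0 <= N ->
    growth W N M j.*2.+1 -> 0 < s <= 1 -> 0 < e <= 1 -> (forall p, p \in l -> e * p.1 <= 1) ->
    tame (fun t => W t s * cut_off j.+2.*2 e l t) /\
    `|W 0 (s + e) + \sum_(p <- l) p.2 * W 0 (s + e * p.1)
      - intR (fun t => W t s * cut_off j.+2.*2 e l t)| <= C * N * e ^+ (size l).*2.+1.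
Proof.
move=> l1 pf Ml.
have [|C1 C10 C1P] := @Cn_cut_kernel R j.+1.*2 j.+2.*2 l _ l1.
  by rewrite !doubleS !ltnS leqW.
have [C2 C20 C2P] := moment_growth_bounded R M j.
exists (C2 * C1); first by rewrite mulr_ge0.
move=> W Wt Wy Wtt N e s hW N0 gW s01 e01 le1.
have /andP[e0 e1] := e01; have /andP[s0 s1] := s01.
have dc := C1P e e01 le1.
have c0 : 0 <= C1 * e ^+ (size l).*2.+1 by rewrite mulr_ge0// exprn_ge0// ltW.
have tc := Cn_tame c0 dc.
have [tn _ _] := node_kernel_tame e0 l1.
have t1 : tame (fun t => W t s * node_kernel e l t) by exact: (bh_tame hW).
have t2 : tame (fun t => W t s * cut_kernel j.+2.*2 e l t) by exact: (bh_tame hW).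
have E : (fun t => W t s * cut_off j.+2.*2 e l t) =
    (fun t => W t s * node_kernel e l t - W t s * cut_kernel j.+2.*2 e l t).
  by apply/funext => t; rewrite /cut_off mulrBr.
rewrite E; split; first exact: tameB.
rewrite (node_reproduction hW)// intRB// opprB addrC subrK.
rewrite (le_trans (C2P _ _ _ _ _ _ _ hW N0 c0 gW _ s s01))//; last first.
  by apply: eq_ler; ring.
apply: Cn_mono dc => t; rewrite /weight ler_wpM2l//.
by rewrite lef_pV2 ?posrE ?exprn_gt0 ?oneDsqr_gt0// ler_weXn2l// lerDl sqr_ge0.
Qed.

Lemma cut_off_average (f : R -> R) k e l c : (0 < k)%N -> 0 < e ->
  (forall p, p \in l -> 1 < p.1) -> 0 <= c -> (forall t, `|t| < 1 -> `|f t| <= c) ->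
  tame (fun t => f t * cut_off k e l t) -> `|intR (fun t => f t * cut_off k e l t)| <= c.
Proof.
move=> k0 e0 l1 c0 fc tf; have [tP _ _ _] := poisson_tame e0.
have -> : c = intR (fun t => c * poisson e t) by rewrite intRZ// intR_poisson// mulr1.
apply: intR_norm_le => //; first exact: tameZ.
move=> t; have [z0 z1 z2] := cut_off_bounds t k0 e0 l1.
have [t1|t1] := leP 1 `|t|; first by rewrite z2// mulr0 normr0 mulr_ge0// poisson_ge0.
by rewrite normrM (ger0_norm z0) ler_pM// fc.
Qed.

(** Without nodes, the node kernel is the Poisson kernel. The degree of
    smoothness is the one that suits a growth of order [y^-(2 * j + 1)]. *)
Definition poisson_cut j e : R -> R := cut_off j.+2.*2 e [::].

Let no_node (p : R * R) : p \in [::] -> 1 < p.1. Proof. by []. Qed.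

Lemma poisson_cut_bounds j e t : 0 < e ->
  [/\ 0 <= poisson_cut j e t, poisson_cut j e t <= poisson e t &
      1 <= `|t| -> poisson_cut j e t = 0].
Proof. by move=> e0; apply: cut_off_bounds. Qed.

(** The price for having no nodes is an error that is only linear in the height,
    and a growth bound that has to be uniform along the boundary. *)
Lemma poisson_cut_reproduction (j : nat) : exists2 C : R, 0 <= C &
  forall W Wt Wy Wtt (N e s : R), bharmonic W Wt Wy Wtt -> 0 <= N ->
    growth W N 0 j.*2.+1 -> 0 < s <= 1 -> 0 < e <= 1 ->
    tame (fun t => W t s * poisson_cut j e t) /\
    `|W 0 (s + e) - intR (fun t => W t s * poisson_cut j e t)| <= C * N * e.
Proof.
have [C C0 h] := @local_reproduction 0 j [::] no_node (@partial_fractions_nil R) isT.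
exists C => // W Wt Wy Wtt N e s hW N0 gW s01 e01.
by have [] := h _ _ _ _ N e s hW N0 gW s01 e01 (fun p pl => ltac:(by [])); rewrite big_nil addr0 expr1.
Qed.

Lemma norm_le3 (x y z a b c : R) : `|x + y - z| <= c -> `|y| <= a -> `|z| <= b ->
  `|x| <= a + b + c.
Proof.
rewrite !ler_norml => /andP[? ?] /andP[? ?] /andP[? ?].
by apply/andP; split; lra.
Qed.

Lemma norm_le2 (x z b c : R) : `|x - z| <= c -> `|z| <= b -> `|x| <= b + c.
Proof.
by move=> xz zb; rewrite -[b]add0r; apply: (@norm_le3 x 0 z); rewrite ?addr0// normr0.
Qed.

(** [M] of the factors compensate the polynomial growth [d ^+ M], and the
    remaining [k] make the product small. *)
Lemma prod_decay (s : seq R) (f : R -> R) (M k : nat) (d q B : R) :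
  0 <= d -> 0 <= q -> 0 <= B ->
  (forall b, b \in s -> [/\ 0 <= f b, f b <= q & d * f b <= B]) -> size s = (M + k)%N ->
  d ^+ M * \prod_(b <- s) f b <= B ^+ M * q ^+ k.
Proof.
move=> d0 q0 B0; elim: s M k => [|b s IH] M k sf /=.
  by case: M => // -[]; case: k => // _; rewrite big_nil !expr0.
have [fb0 fbq fbB] := sf b (mem_head _ _).
have sf' c : c \in s -> [/\ 0 <= f c, f c <= q & d * f c <= B].
  by move=> cs; apply: sf; rewrite inE cs orbT.
have p0 : 0 <= \prod_(c <- s) f c.
  by rewrite big_seq prodr_ge0// => c /sf'[].
rewrite big_cons; case: M => [|M].
  case: k => [//|k]; rewrite add0n => -[sk].
  have := IH 0%N k sf' sk; rewrite !expr0 !mul1r exprS => h.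
  by rewrite ler_pM.
rewrite addSn => -[sk]; rewrite !exprS mulrACA -[leRHS]mulrA ler_pM//.
- by rewrite mulr_ge0.
- by rewrite mulr_ge0// exprn_ge0.
- exact: IH.
Qed.

(** Many nodes in an interval [a, a + 1] make the integral in
    [node_reproduction] negligible by [prod_decay]; what remains expresses the
    value at the height 1 by those at the nodes, and [a] may be taken as large
    as desired. So values of [W] can be estimated from those far above. *)
Lemma vertical_extrapolation (M : nat) (L c : R) : 0 < c -> exists l : seq (R * R),
  (forall p, p \in l -> L <= p.1 /\ 1 <= p.1) /\
  forall W Wt Wy Wtt (N : R), bharmonic W Wt Wy Wtt -> 0 <= N ->
  (forall t, `|W t (1 / 2)| <= N * (1 + t ^+ 2) ^+ M) ->
  `|W 0 1| <= \sum_(p <- l) `|p.2| * `|W 0 p.1| + c * N.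
Proof.
move=> c0; pose a : R := Num.max 2 (2 * L).
have a2 : 2 <= a by rewrite le_max lexx.
have aL : 2 * L <= a by rewrite le_max lexx orbT.
have h0 : 0 < 1 / 2 :> R by lra.
pose q : R := 1 - (a + 1) ^- 2; pose B := (a + 1) ^+ 2.
have a10 : 0 < a + 1 by lra.
have q1 : q < 1 by rewrite ltrBlDr ltrDl invr_gt0 exprn_gt0.
have q0 : 0 <= q.
  by rewrite subr_ge0 invf_le1 ?exprn_gt0// exprn_ege1//; lra.
have B0 : 0 < B by rewrite exprn_gt0.
have [k kP] : exists k : nat, B ^+ M * q ^+ k <= c.
  have := @cvg_expr R q; rewrite (ger0_norm q0) => /(_ q1) h.
  have e0 : 0 < c / B ^+ M by rewrite divr_gt0// exprn_gt0.
  move/cvgrPdist_le : h => /(_ _ e0)[k _ /(_ k (leqnn _))].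
  rewrite sub0r normrN ger0_norm ?exprn_ge0// ler_pdivlMr ?exprn_gt0// mulrC => h.
  by exists k.
pose s := [seq a + i%:R / (M + k).+1%:R | i <- iota 0 (M + k)].
have sa (b : R) : b \in s -> a <= b <= a + 1.
  move=> /mapP[n]; rewrite mem_iota add0n => /andP[_ nk] ->.
  rewrite lerDl lerD2l divr_ge0//= ler_pdivrMr ?ltr0Sn// mul1r ler_nat.
  by rewrite ltnW// ltnW.
have s1 (b : R) : b \in s -> 1 < b by move=> /sa/andP[]; lra.
have us : uniq s.
  rewrite map_inj_in_uniq ?iota_uniq// => i j _ _ /addrI.
  move/(mulIf _); rewrite invr_eq0 pnatr_eq0 => /(_ isT)/eqP.
  by rewrite eqr_nat => /eqP.
have [l0 [ls pf]] := exists_partial_fractions us s1.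
have l01 p : p \in l0 -> 1 < p.1 by move=> pl; apply: s1; rewrite -ls map_f.
pose l := [seq (1 / 2 + 1 / 2 * p.1, p.2) | p <- l0].
exists l; split.
  move=> p /mapP[r rl ->/=]; have : r.1 \in s by rewrite -ls map_f.
  by move=> /sa/andP[ra _]; split; lra.
move=> W Wt Wy Wtt N hW N0 WN.
have := node_reproduction hW h0 h0 l01 pf.
have -> : 1 / 2 + 1 / 2 = 1 :> R by lra.
move=> E; have {E} -> : W 0 1 = intR (fun t => W t (1 / 2) * node_kernel (1 / 2) l0 t)
    - \sum_(p <- l0) p.2 * W 0 (1 / 2 + 1 / 2 * p.1) by rewrite -E addrK.
rewrite (le_trans (ler_normB _ _))// addrC lerD//.
  rewrite /l big_map/= (le_trans (ler_norm_sum _ _ _))//.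
  by apply: ler_sum => p _; rewrite normrM.
have [tP _ _ _] := poisson_tame h0.
have [tn n0 _] := node_kernel_tame h0 l01.
have -> : c * N = intR (fun t => c * N * poisson (1 / 2) t).
  by rewrite intRZ// intR_poisson// mulr1.
apply: intR_norm_le.
- exact: (bh_tame hW).
- exact: tameZ.
move=> t; rewrite normrM (ger0_norm (n0 t)).
rewrite (le_trans (ler_wpM2r (n0 t) (WN t)))//.
rewrite /node_kernel; have P0 := poisson_ge0 t h0.
have := @prod_decay s (fun b => node (1 / 2) b t) M k (1 + t ^+ 2) q B
  (ltW (oneDsqr_gt0 t)) q0 (ltW B0).
rewrite size_map size_iota => /(_ _ erefl) h.
have {}h : (1 + t ^+ 2) ^+ M * \prod_(p <- l0) node (1 / 2) p.1 t <= c.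
  have -> : \prod_(p <- l0) node (1 / 2) p.1 t = \prod_(b <- s) node (1 / 2) b t.
    by rewrite -ls big_map.
  apply: le_trans (h _) kP => b bs; have b1 := s1 b bs; have /andP[ab ba] := sa b bs.
  have nb := node_le t h0 b1; have b0 : 0 < b by lra.
  split; first exact: node_ge0.
  - rewrite (le_trans nb)// lerB// lef_pV2 ?posrE ?exprn_gt0//.
    by rewrite lerXn2r ?nnegrE ?(ltW b0) ?(ltW a10).
  - have d0 := sqD_gt0 t (mulr_gt0 h0 b0); rewrite /node mulrA ler_pdivrMr//.
    have b24 : 4 <= b ^+ 2 by rewrite expr2; nra.
    have bB : b ^+ 2 <= B by rewrite lerXn2r ?nnegrE ?(ltW b0) ?(ltW a10).
    have t0 := sqr_ge0 t.
    rewrite (le_trans (y := B * (1 + t ^+ 2)))//.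
      rewrite mulrC ler_wpM2r ?addr_ge0//; lra.
    by rewrite ler_wpM2l ?(ltW B0)//; lra.
rewrite [leLHS](_ : _ = ((1 + t ^+ 2) ^+ M * \prod_(p <- l0) node (1 / 2) p.1 t) *
   (N * poisson (1 / 2) t)); last by ring.
by rewrite -[c * N * _]mulrA ler_wpM2r// mulr_ge0.
Qed.

End local_lemmas.

(** * Weights *)

Section weights.
Variable R : realType.
Implicit Types (a b c d e k r t x y z s : R).

(** The growth of [U] is comparable to [blow E d] for each [d > 0], whereas a
    bound by [blow E d] is uniform above the height [d]: estimates with
    constants that do not depend on [d] become uniform as [d] tends to zero. *)
Definition blow (E : nat) d y : R := Num.max 1 (d / y) ^+ E.

Lemma blow_ge1 E d y : 1 <= blow E d y.
Proof. by rewrite /blow exprn_ege1// le_max lexx. Qed.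

Lemma blow_ge0 E d y : 0 <= blow E d y.
Proof. exact: le_trans ler01 (blow_ge1 _ _ _). Qed.

Lemma max1_ge0 x : 0 <= Num.max 1 x.
Proof. by rewrite le_max ler01. Qed.

Lemma blow_anti E d y z : 0 <= d -> 0 < y -> y <= z -> blow E d z <= blow E d y.
Proof.
move=> d0 y0 yz; rewrite /blow lerXn2r ?nnegrE ?max1_ge0// ge_max le_max lexx/=.
rewrite le_max; apply/orP; right; rewrite ler_wpM2l// lef_pV2 ?posrE//.
exact: lt_le_trans yz.
Qed.

Lemma blow_scale E d y k : 0 <= d -> 0 < y -> 0 < k <= 1 ->
  blow E d (y * k) <= blow E d y * k ^- E.
Proof.
move=> d0 y0 /andP[k0 k1]; rewrite /blow -exprVn -exprMn.
have k1' : 1 <= k^-1 by rewrite invf_ge1.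
rewrite lerXn2r ?nnegrE ?mulr_ge0 ?max1_ge0 ?invr_ge0 ?(ltW k0)//.
rewrite ge_max; apply/andP; split.
  by rewrite -[leLHS]mulr1 ler_pM// le_max lexx.
by rewrite invfM mulrA ler_wpM2r ?invr_ge0 ?(ltW k0)// le_max lexx orbT.
Qed.

Lemma blow1_le E d y : 0 < d <= 1 -> 0 < y -> blow E 1 y <= d ^- E * blow E d y.
Proof.
move=> /andP[d0 d1] y0; rewrite /blow -exprVn -exprMn.
have d1' : 1 <= d^-1 by rewrite invf_ge1.
rewrite lerXn2r ?nnegrE ?mulr_ge0 ?max1_ge0 ?invr_ge0 ?(ltW d0)//.
rewrite ge_max; apply/andP; split.
  by rewrite -[leLHS]mulr1 ler_pM// le_max lexx.
rewrite -[leLHS](mulKf (lt0r_neq0 d0)) ler_wpM2l ?invr_ge0 ?(ltW d0)//.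
by rewrite mul1r le_max lexx orbT.
Qed.

Lemma blow1_small E y : 0 < y <= 1 -> blow E 1 y = y ^- E.
Proof.
by move=> /andP[y0 y1]; rewrite /blow mul1r max_r ?exprVn// invf_ge1.
Qed.

Lemma blow_far E d y : 0 < y -> d <= y -> blow E d y = 1.
Proof.
by move=> y0 dy; rewrite /blow max_l ?expr1n// ler_pdivrMr// mul1r.
Qed.

Definition tent r x0 x : R := Num.max 0 (r - `|x - x0|).

Lemma tent_ge0 r x0 x : 0 <= tent r x0 x.
Proof. by rewrite le_max lexx. Qed.

Lemma tent_le r x0 x : 0 <= r -> tent r x0 x <= r.
Proof. by move=> r0; rewrite ge_max r0/= lerBlDr lerDl. Qed.

Lemma tent_out r x0 x : r <= `|x - x0| -> tent r x0 x = 0.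
Proof. by move=> rx; rewrite /tent max_l// subr_le0. Qed.

Lemma tent_lip r x0 x t : tent r x0 x <= tent r x0 (x + t) + `|t|.
Proof.
rewrite ge_max; apply/andP; split; first by rewrite addr_ge0// tent_ge0.
have : `|x + t - x0| <= `|x - x0| + `|t| by rewrite addrAC ler_normD.
have : r - `|x + t - x0| <= tent r x0 (x + t) by rewrite le_max lexx orbT.
lra.
Qed.

Lemma continuous_tent r x0 : continuous (tent r x0).
Proof.
move=> x; apply: (@continuous_max _ _ _ _ x); first exact: cvg_cst.
apply: cvgB; first exact: cvg_cst.
by apply: cvg_norm; apply: cvgB; [exact: cvg_id|exact: cvg_cst].
Qed.

Lemma measurable_tentX r x0 n : measurable_fun setT (fun x => tent r x0 x ^+ n).
Proof.
apply: measurable_funX; apply: continuous_measurable_fun; exact: continuous_tent.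
Qed.

Lemma exprD_le (n : nat) a b : 0 <= a -> 0 <= b -> (a + b) ^+ n <= 2 ^+ n * (a ^+ n + b ^+ n).
Proof.
move=> a0 b0; wlog ab : a b a0 b0 / a <= b => [h|].
  by have [ab|/ltW ba] := leP a b; [exact: h|rewrite addrC [_ + b ^+ n]addrC h].
rewrite (@le_trans _ _ ((2 * b) ^+ n))//.
  by rewrite lerXn2r ?nnegrE ?addr_ge0 ?mulr_ge0//; lra.
by rewrite exprMn ler_wpM2l ?exprn_ge0// lerDr exprn_ge0.
Qed.

(** An integrable majorant, of integral independent of [x0], for functions
    bounded by 1 and supported at distance at most 1 from [x0]. *)
Definition bell x0 x : R := 2 * (1 + (x - x0) ^+ 2)^-1.

Lemma bell_ge0 x0 x : 0 <= bell x0 x.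
Proof. by rewrite mulr_ge0// invr_ge0 ltW// oneDsqr_gt0. Qed.

Lemma bell_ge1 x0 x : `|x - x0| <= 1 -> 1 <= bell x0 x.
Proof.
move=> h; rewrite /bell ler_pdivlMr ?oneDsqr_gt0// mul1r.
have : (x - x0) ^+ 2 <= 1 by rewrite -real_normK ?num_real// exprn_ile1.
lra.
Qed.

Lemma bell_tame x0 : tame (bell x0).
Proof. exact: tame_shift (tame_cauchy 2). Qed.

Lemma intR_bell x0 : intR (bell x0) = 2 * pi.
Proof.
rewrite -(intR_cauchy (2 : R)) -(intR_shift (- x0) (tame_cauchy 2)).
by [].
Qed.

Lemma le_bell_tame x0 (b : R -> R) : measurable_fun setT b -> (forall x, `|b x| <= bell x0 x) -> tame b.
Proof. by move=> mb bb; apply: le_tame (bell_tame x0). Qed.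

Lemma tentX_bell r x0 n x : 0 <= r <= 1 -> tent r x0 x ^+ n.+1 <= bell x0 x.
Proof.
move=> /andP[r0 r1]; have [h|h] := leP r `|x - x0|.
  by rewrite tent_out// exprS mul0r bell_ge0.
have t1 := le_trans (tent_le x0 x r0) r1.
rewrite (le_trans (exprn_ile1 _ (tent_ge0 _ _ _) t1))// bell_ge1//; lra.
Qed.

Lemma tentX_tame r x0 n : 0 <= r <= 1 -> tame (fun x => tent r x0 x ^+ n.+1).
Proof.
move=> r01; apply: (@le_bell_tame x0); first exact: measurable_tentX.
by move=> x; rewrite ger0_norm ?tentX_bell// exprn_ge0// tent_ge0.
Qed.

Lemma indic_tame (b : R -> R) (A : set R) : measurable A -> tame b -> tame (fun x => \1_A x * b x).
Proof.
move=> mA tb; apply: (@tameM _ 1) => // x.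
by rewrite indicE; case: (_ \in _); rewrite ?normr1 ?normr0.
Qed.

(** Reproduction formulas are available at the heights [s + e], with [s > 0];
    their consequences pass to the height [e] by continuity, even if they hold
    only for arbitrarily small [s]. *)
Lemma frequent_limit_le (f : R -> R) e B df : is_derive e (1 : R) f df ->
  (forall t s0, 0 < t -> 0 < s0 -> exists2 s : R, 0 < s < s0 & `|f (s + e)| <= B + t) ->
  `|f e| <= B.
Proof.
move=> d h; apply/ler_addgt0Pr => t t0.
have t20 : 0 < t / 2 by rewrite divr_gt0.
have ce : {for e, continuous f}.
  by apply: differentiable_continuous; apply/derivable1_diffP; case: d.
have /cvgrPdist_le/(_ _ t20) : f x @[x --> e] --> f e by exact: ce.
rewrite near_nbhs => /nbhs_ballP[r /= r0 rP].
have [s /andP[s1 sr] fs] := h _ _ t20 r0.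
have /rP/= : ball e r (s + e).
  by rewrite /ball/= opprD addrCA subrr addr0 normrN gtr0_norm.
have := ler_normD (f e - f (s + e)) (f (s + e)); rewrite subrK.
lra.
Qed.

Lemma right_limit_le (f : R -> R) e B df : is_derive e (1 : R) f df ->
  (forall t, 0 < t -> exists2 s0 : R, 0 < s0 & forall s, 0 < s < s0 -> `|f (s + e)| <= B + t) ->
  `|f e| <= B.
Proof.
move=> d h; apply: frequent_limit_le d _ => t s0 t0 s00; have [s1 s10 fs] := h t t0.
exists (Num.min s0 s1 / 2).
  have : 0 < Num.min s0 s1 by rewrite lt_min s00.
  have : Num.min s0 s1 <= s0 by rewrite ge_min lexx.
  lra.
apply: fs; have : 0 < Num.min s0 s1 by rewrite lt_min s00.
have : Num.min s0 s1 <= s1 by rewrite ge_min lexx orbT.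
lra.
Qed.

End weights.

(** * Masses and averages *)

Section averages.
Variables (R : realType) (U Ut Uy Utt : R -> R -> R).
Hypothesis hU : bharmonic U Ut Uy Utt.
Implicit Types (b w : R -> R) (r t x y s : R).

Definition mass w y : R := intR (fun x => `|U x y| * w x).

Definition avg b t y : R := intR (fun x => U (x + t) y * b x).

Lemma mass_tame w y : 0 < y -> tame w -> tame (fun x => `|U x y| * w x).
Proof.
move=> y0 tw; have [K KP] := bh_bd hU y0; apply: (@tameM _ K) => //.
  by apply: measurableT_comp => //; exact: (bh_measurable hU).
by move=> x; rewrite normr_id; have [] := KP x y (lexx _).
Qed.

Lemma mass_ge0 w y : (forall x, 0 <= w x) -> 0 <= mass w y.
Proof. by move=> w0; apply: intR_ge0 => x; rewrite mulr_ge0. Qed.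

Lemma mass_le w w' y : 0 < y -> tame w -> tame w' ->
  (forall x, w x <= w' x) -> mass w y <= mass w' y.
Proof.
move=> y0 tw tw' ww'; apply: intR_le; [exact: mass_tame|exact: mass_tame|].
by move=> x; rewrite ler_wpM2l.
Qed.

Lemma massD w w' y : 0 < y -> tame w -> tame w' ->
  mass (fun x => w x + w' x) y = mass w y + mass w' y.
Proof.
move=> y0 tw tw'; rewrite /mass -intRD; [|exact: mass_tame|exact: mass_tame].
by congr intR; apply/funext => x; rewrite mulrDr.
Qed.

Lemma massZ k w y : 0 < y -> tame w -> mass (fun x => k * w x) y = k * mass w y.
Proof.
move=> y0 tw; rewrite /mass -intRZ; last exact: mass_tame.
by congr intR; apply/funext => x; rewrite mulrCA.
Qed.

Lemma mass_bell w y K x0 : 0 < y -> tame w -> (forall x, 0 <= w x <= bell x0 x) ->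
  (forall x, w x != 0 -> `|U x y| <= K) -> 0 <= K -> mass w y <= K * (2 * pi).
Proof.
move=> y0 tw wb UK K0; rewrite -(intR_bell x0) -intRZ; last exact: bell_tame.
apply: intR_le; [exact: mass_tame|by apply: tameZ; exact: bell_tame|].
move=> x; have /andP[w0 w1] := wb x.
have [->|wx] := eqVneq (w x) 0; first by rewrite mulr0 mulr_ge0// bell_ge0.
by rewrite ler_pM// UK.
Qed.

Lemma avg_le b w t y : 0 < y -> tame b -> tame w ->
  (forall x, `|b x| <= w (x + t)) -> `|avg b t y| <= mass w y.
Proof.
move=> y0 tb tw bw.
have -> : mass w y = intR (fun x => `|U (x + t) y| * w (x + t)).
  by rewrite (intR_shift (f := fun x => `|U x y| * w x))//; exact: mass_tame.
have tm := tame_shift t (mass_tame y0 tw).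
apply: intR_norm_le => //; last by move=> x; rewrite normrM ler_wpM2l.
have [K KP] := bh_bd hU y0; apply: (@tameM _ K) => //.
  apply: (@measurableT_comp _ _ _ _ _ _ (fun x => U x y)) => //.
    exact: (bh_measurable hU).
  exact: measurable_funD.
by move=> x; have [] := KP (x + t) y (lexx _).
Qed.

(** With the sign of [U x y] included in the weight, the mass at a given height
    becomes the value at one point of a harmonic function, to which the
    reproduction formulas apply. *)
Lemma mass_avg w y : 0 < y -> tame w -> (forall x, 0 <= w x) ->
  exists b, [/\ tame b, forall x, `|b x| = w x & mass w y = avg b 0 y].
Proof.
move=> y0 tw w0; pose A := [set x | 0 <= U x y].
have mU := bh_measurable hU y0.
have mA : measurable A.
  have -> : A = setT `&` (fun x => U x y) @^-1` `[0, +oo[.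
    by apply/seteqP; split => x /=; rewrite in_itv/= andbT; [split|case].
  exact: mU.
pose b x : R := (2 * \1_A x - 1) * w x.
have bE x : b x = if 0 <= U x y then w x else - w x.
  rewrite /b indicE; case: ifPn => h.
    by rewrite mem_set//=; lra.
  by rewrite memNset/=; [lra|exact/negP].
exists b; split.
- have -> : b = (fun x => 2 * (\1_A x * w x) - w x).
    by apply/funext => x; rewrite /b; ring.
  by apply: tameB => //; apply: tameZ; exact: indic_tame.
- by move=> x; rewrite bE; case: ifP; rewrite ?normrN ger0_norm.
- congr intR; apply/funext => x; rewrite addr0 bE; case: ifPn => h.
    by rewrite ger0_norm.
  by move: h; rewrite -ltNge => h; rewrite ltr0_norm// mulNr mulrN.
Qed.

Lemma mass_split w y (A : set R) : 0 < y -> measurable A -> tame w ->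
  mass w y = mass (fun x => \1_A x * w x) y + mass (fun x => \1_(~` A) x * w x) y.
Proof.
move=> y0 mA tw; rewrite -massD//; [|exact: indic_tame|apply: indic_tame => //; exact: measurableC].
congr intR; apply/funext => x; congr (_ * _); rewrite !indicE -mulrDl.
have [h|h] := pselect (A x).
  by rewrite (mem_set h) memNset ?addr0 ?mul1r//= => /(_ h).
by rewrite (memNset h) mem_set// add0r mul1r.
Qed.

Lemma bharmonic_mean b : tame b ->
  exists Wt Wy Wtt : R -> R -> R, bharmonic (avg b) Wt Wy Wtt.
Proof. by move=> tb; do 3 eexists; exact: bharmonic_avg tb hU. Qed.

Lemma bharmonic_scaled_mean b k : 0 < k -> tame b ->
  exists Wt Wy Wtt : R -> R -> R, bharmonic (fun t y => avg b (k * t) (k * y)) Wt Wy Wtt.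
Proof.
move=> k0 tb; have [Wt [Wy [Wtt h]]] := bharmonic_mean tb.
have := bharmonic_affine 0 k0 h => h'; do 3 eexists.
have <- : (fun t y => avg b (0 + k * t) (k * y)) = (fun t y => avg b (k * t) (k * y)).
  by apply/funext => t; apply/funext => y; rewrite add0r.
exact: h'.
Qed.

End averages.

(** * Linear vanishing at the boundary *)

Section linear_vanishing.
Variable R : realType.
Implicit Types (U : R -> R -> R) (a x y s t : R) (S : set R).

(** A single constant bounds the radius and the rate, which makes this visibly
    an open condition on [a]. *)
Definition lin_vanish U a := exists2 C : R, 0 < C &
  forall x s, `|x - a| < C^-1 -> 0 < s < C^-1 -> `|U x s| <= C * s.

Lemma lin_vanish_uniform U (K : set R) t : compact K -> K `<=` lin_vanish U -> 0 < t ->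
  exists2 s0 : R, 0 < s0 & forall x s, K x -> 0 < s < s0 -> `|U x s| <= t.
Proof.
move=> /compact_near_coveringP cK KU t0.
have /cK h : forall x, K x -> \forall x' \near x & s \near 0^'+, `|U x' s| <= t.
  move=> a /KU[C C0 CP]; have Ci : 0 < C^-1 by rewrite invr_gt0.
  exists (ball a C^-1, [set s | 0 < s < Num.min C^-1 (t / C)]); first split => /=.
  - exact: nbhsx_ballx.
  - near=> s; apply/andP; split; first by near: s; exact: nbhs_right_gt.
    by near: s; apply: nbhs_right_lt; rewrite lt_min Ci divr_gt0.
  - move=> [x s] /= [xa /andP[s0]]; rewrite lt_min => /andP[s1 s2].
    rewrite (le_trans (CP x s _ _)) ?s0//; first by rewrite distrC.
    by rewrite mulrC -ler_pdivlMr// ltW.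
have {h} [s0 /= s00 s0P] : \forall s \near 0^'+, K `<=` fun x => `|U x s| <= t.
  exact: h.
exists s0 => // x s Kx /andP[s1 s2]; apply: s0P => //=.
by rewrite sub0r normrN gtr0_norm.
Unshelve. all: end_near. Qed.

Lemma far_closed S d : closed [set x | forall a, S a -> d <= `|x - a|].
Proof.
have -> : [set x | forall a, S a -> d <= `|x - a|] =
    \bigcap_(a in S) ((fun x => `|x - a|) @^-1` [set v | d <= v]).
  by apply/seteqP; split.
apply: closed_bigI => a _; apply: preimage_closed; last exact: closed_ge.
by move=> x _; apply: cvg_norm; apply: cvgB; [exact: cvg_id|exact: cvg_cst].
Qed.

Lemma far_compact S d x0 r : compact [set x | `|x - x0| <= r /\ forall a, S a -> d <= `|x - a|].
Proof.
apply: (@subclosed_compact _ _ `[x0 - r, x0 + r]); last 1 first.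
- by move=> x [+ _] /=; rewrite in_itv/= ler_distl.
- apply: closedI; last exact: far_closed.
  apply: (@preimage_closed _ _ (fun x => `|x - x0|) [set v | v <= r]); last exact: closed_le.
  by move=> x _; apply: cvg_norm; apply: cvgB; [exact: cvg_id|exact: cvg_cst].
- exact: segment_compact.
Qed.

Lemma near_measurable S d : measurable [set x | exists2 a, S a & `|x - a| < d].
Proof.
apply: open_measurable.
have -> : [set x | exists2 a, S a & `|x - a| < d] = \bigcup_(a in S) ball a d.
  by apply/seteqP; split => [x [a Sa h]|x [a Sa h]]; exists a => //; rewrite /ball/= distrC.
by apply: bigcup_open => a _; exact: ball_open.
Qed.

Lemma seq_bounded (l : seq (R * R)) : exists2 P : R, 0 < P & forall p, p \in l -> p.1 <= P.
Proof.
elim: l => [|p l [P P0 h]]; first by exists 1.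
exists (P + `|p.1|); first by rewrite ltr_wpDr.
move=> q; rewrite inE => /orP[/eqP ->|/h ql]; first by rewrite (le_trans (ler_norm _))// lerDr ltW.
by rewrite (le_trans ql)// lerDl.
Qed.

End linear_vanishing.

(** * Boundedness of the mass near an exceptional set *)

Section mass_bound.
Variables (R : realType) (U Ut Uy Utt : R -> R -> R) (j : nat) (Ag x0 r : R).
Hypothesis hU : bharmonic U Ut Uy Utt.
Hypothesis Ag0 : 0 <= Ag.
Let E := j.*2.+1.
Let M := j.+1.
Hypothesis gU : forall x y, 0 < y -> `|U x y| <= Ag * blow E 1 y.
Hypothesis r01 : 0 < r <= 1.
Implicit Types (A b d e k t x y s : R) (w : R -> R) (S : set R).

Let om x := tent r x0 x ^+ M.*2.
Let c4 : R := 2 ^+ M.*2.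

Let r0 : 0 < r. Proof. by case/andP: r01. Qed.
Let r01' : 0 <= r <= 1. Proof. by rewrite ltW//=; case/andP: r01. Qed.

Lemma om_ge0 x : 0 <= om x. Proof. by rewrite exprn_ge0// tent_ge0. Qed.

Lemma om_tame : tame om. Proof. exact: tentX_tame. Qed.

(** Translating the weight by [t] costs [|t| ^ (2 * M)]. Since [2 * M > E], this
    beats the growth of [U] when [t] is of the order of the height. *)
Lemma om_shift t x : om x <= c4 * (om (x + t) + `|t| ^+ M.*2 * bell (x0 + t) (x + t)).
Proof.
have bE : bell (x0 + t) (x + t) = bell x0 x by rewrite /bell opprD addrACA subrr addr0.
rewrite bE; have [h|h] := leP r `|x - x0|.
  rewrite {1}/om tent_out// doubleS expr0n/= mulr_ge0 ?exprn_ge0//.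
  by rewrite addr_ge0 ?om_ge0// mulr_ge0 ?exprn_ge0 ?bell_ge0.
have b1 : 1 <= bell x0 x by rewrite bell_ge1//; case/andP: r01 => _; lra.
rewrite (@le_trans _ _ ((tent r x0 (x + t) + `|t|) ^+ M.*2))//.
  by rewrite lerXn2r ?nnegrE ?addr_ge0 ?tent_ge0// tent_lip.
rewrite (le_trans (exprD_le _ _ _)) ?tent_ge0// ler_wpM2l ?exprn_ge0// lerD2l.
by rewrite ler_peMr// exprn_ge0.
Qed.

Lemma mass_om_bound A d (b : R -> R) t y : 0 <= A -> 0 <= d ->
  (forall y, 0 < y -> mass U om y <= A * blow E d y) -> tame b ->
  (forall x, `|b x| <= om x) -> 0 < y ->
  `|avg U b t y| <= c4 * (A * blow E d y + `|t| ^+ M.*2 * (Ag * blow E 1 y * (2 * pi))).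
Proof.
move=> A0 d0 hA tb bom y0.
have tbell := bell_tame (x0 + t).
have tbt : tame (fun x => `|t| ^+ M.*2 * bell (x0 + t) x) by exact: tameZ.
have tw : tame (fun x => om x + `|t| ^+ M.*2 * bell (x0 + t) x).
  by apply: tameD => //; exact: om_tame.
rewrite (le_trans (avg_le hU (w := fun x => c4 * (om x + `|t| ^+ M.*2 * bell (x0 + t) x)) y0 tb _ _))//.
- exact: tameZ.
- by move=> x; rewrite (le_trans (bom x))// om_shift.
rewrite (massZ hU)// ler_wpM2l ?exprn_ge0// (massD hU)//; last exact: om_tame.
rewrite lerD ?hA// (massZ hU)// ler_wpM2l ?exprn_ge0//.
apply: (mass_bell hU (x0 := x0 + t)) => //; first by move=> x; rewrite lexx bell_ge0.
  by move=> x _; exact: gU.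
by rewrite mulr_ge0// blow_ge0.
Qed.

(** Bounds on the mass become bounds of polynomial growth, uniform in the scale
    [k], on the rescaled averages, as extrapolation and local reproduction
    require. *)
Lemma mass_growth A d (b : R -> R) k : 0 <= A -> 0 <= d ->
  (forall y, 0 < y -> mass U om y <= A * blow E d y) -> tame b ->
  (forall x, `|b x| <= om x) -> 0 < k <= 1 ->
  growth (fun t y => avg U b (k * t) (k * y)) (c4 * (A * blow E d k + Ag * (2 * pi))) M E.
Proof.
move=> A0 d0 hA tb bom /andP[k0 k1] t y /andP[y0 y1].
have ky0 : 0 < k * y by rewrite mulr_gt0.
have ky1 : k * y <= 1 by rewrite mulr_ile1// ltW.
have t0 : 0 <= (1 + t ^+ 2) ^+ M by rewrite exprn_ge0// ltW// oneDsqr_gt0.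
have t1 : 1 <= (1 + t ^+ 2) ^+ M by rewrite exprn_ege1// lerDl sqr_ge0.
have yE : 0 <= y ^- E by rewrite invr_ge0 exprn_ge0// ltW.
rewrite (le_trans (mass_om_bound (k * t) A0 d0 hA tb bom ky0))//.
rewrite -!(mulrA c4) ler_wpM2l ?exprn_ge0//.
set T := (1 + t ^+ 2) ^+ M in t0 t1 *.
have -> : (A * blow E d k + Ag * (2 * pi)) * T / y ^+ E =
    A * blow E d k * T / y ^+ E + Ag * (2 * pi) * T / y ^+ E by ring.
rewrite lerD//.
  rewrite -!(mulrA A) ler_wpM2l// (@le_trans _ _ (blow E d k * y ^- E))//.
    by apply: blow_scale => //; rewrite y0.
  by rewrite -mulrA ler_wpM2l ?blow_ge0// ler_peMl.
rewrite blow1_small ?ky0//.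
rewrite [leLHS](_ : _ = Ag * (2 * pi) * (`|k * t| ^+ M.*2 * (k * y) ^- E)); last by ring.
rewrite -[leRHS]mulrA ler_wpM2l ?mulr_ge0 ?pi_ge0//.
rewrite exprMn invfM mulrA ler_wpM2r//.
rewrite normrM exprMn (gtr0_norm k0) mulrAC.
have -> : k ^+ M.*2 / k ^+ E = k.
  by rewrite doubleS exprS mulfK// expf_neq0// gt_eqF.
rewrite -[leRHS]mul1r ler_pM ?exprn_ge0 ?(ltW k0)//.
rewrite -mul2n exprM real_normK ?num_real// lerXn2r ?nnegrE//; have := sqr_ge0 t; lra.
Qed.

Variables (S : set R) (c0 eta KG : R).
Hypothesis c00 : 0 < c0.
Hypothesis eta0 : 0 < eta.
Let near_set d := [set x | exists2 a, S a & `|x - a| < d].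
Hypothesis good : forall y w, 0 < y < eta -> tame w -> (forall x, 0 <= w x <= om x) ->
  (forall x, w x != 0 -> near_set (c0 * y) x) -> mass U w y <= KG.

(** Near the exceptional set, the average at the height [k] is extrapolated from
    greater heights, at which the same points are seen from the exceptional set
    under the aperture [c0], so that [good] applies. *)
Lemma good_bound C : 0 < C -> exists2 d1 : R, 0 < d1 & exists2 C1 : R, 0 <= C1 &
  forall A d k, 0 <= A -> 0 <= d -> (forall y, 0 < y -> mass U om y <= A * blow E d y) ->
  0 < k < d1 -> mass U (fun x => \1_(near_set (C * k)) x * om x) k <= C1 + A * blow E d k / 4.
Proof.
move=> C0; pose c := (4 * c4 * 2 ^+ E)^-1.
have c40 : 0 < c4 by rewrite exprn_gt0.
have cgt : 0 < c by rewrite invr_gt0 mulr_gt0 ?exprn_gt0// mulr_gt0.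
have [l [lL hl]] := vertical_extrapolation M (C / c0) cgt.
have [P P0 lP] := seq_bounded l.
have KG0 : 0 <= KG.
  apply: le_trans (good (y := eta / 2) (w := fun=> 0) _ _ _ _).
  - by apply: mass_ge0.
  - by move: eta0 => h; apply/andP; split; lra.
  - by have := tameZ 0 om_tame; congr tame; apply/funext => x; rewrite mul0r.
  - by move=> x; rewrite lexx om_ge0.
  - by move=> x; rewrite eqxx.
have pi0 : 0 <= (pi : R) := pi_ge0 R.
exists (Num.min 1 (eta / P)); first by rewrite lt_min ltr01 divr_gt0.
exists ((\sum_(p <- l) `|p.2|) * KG + Ag * (2 * pi) / 4).
  by rewrite addr_ge0 ?divr_ge0 ?mulr_ge0// sumr_ge0.
move=> A d k A0 d0 hA /andP[k0]; rewrite lt_min => /andP[k1 kP].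
set w := fun x => \1_(near_set (C * k)) x * om x.
have tw : tame w by apply: indic_tame; [exact: near_measurable|exact: om_tame].
have w01 x : 0 <= w x <= om x.
  rewrite /w indicE; case: (_ \in _); rewrite ?mul1r ?mul0r ?lexx om_ge0//.
have w0 x : 0 <= w x by case/andP: (w01 x).
have [b [tb bw ->]] := mass_avg hU k0 tw w0.
have bom x : `|b x| <= om x by rewrite bw; case/andP: (w01 x).
have [Wt [Wy [Wtt hW]]] := bharmonic_scaled_mean hU k0 tb.
have k01 : 0 < k <= 1 by rewrite k0 ltW.
have gW := mass_growth A0 d0 hA tb bom k01.
set N := c4 * _ in gW.
have N0 : 0 <= N.
  apply: mulr_ge0; first exact: ltW.
  by apply: addr_ge0; apply: mulr_ge0; rewrite ?blow_ge0// mulr_ge0.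
have hN : 0 <= 2 ^+ E * N by rewrite mulr_ge0 ?exprn_ge0.
have := hl _ _ _ _ _ hW hN; rewrite mulr0 mulr1 => h.
have {h} : `|avg U b 0 k| <= \sum_(p <- l) `|p.2| * `|avg U b 0 (k * p.1)| + c * (2 ^+ E * N).
  apply: h => t; rewrite (le_trans (gW t (1 / 2) _))//; first by lra.
  apply: eq_ler.
  by rewrite -exprVn invfM invrK invr1 mul1r; ring.
move=> h; rewrite (le_trans (ler_norm _))// (le_trans h)// -addrA lerD//.
  rewrite big_distrl/= big_seq [leRHS]big_seq; apply: ler_sum => p pl.
  have [p1 p2] := lL p pl; have p0 : 0 < p.1 by lra.
  have kp0 : 0 < k * p.1 by rewrite mulr_gt0.
  rewrite ler_wpM2l// (le_trans (avg_le hU kp0 tb tw _))//.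
    by move=> x; rewrite addr0 bw.
  apply: good => //.
    rewrite kp0/= (le_lt_trans (y := k * P))//; first by rewrite ler_pM2l// lP.
    by rewrite -ltr_pdivlMr.
  move=> x; rewrite /w indicE; have [[a Sa xa]|nx] := pselect (near_set (C * k) x).
    move=> _; exists a => //; rewrite (lt_le_trans xa)//.
    have -> : c0 * (k * p.1) = p.1 * c0 * k by ring.
    by rewrite ler_wpM2r ?(ltW k0)// -ler_pdivrMr.
  by rewrite memNset// mul0r eqxx.
rewrite [c * _](_ : _ = (A * blow E d k + Ag * (2 * pi)) / 4); last first.
  have gen (a z v : R) : a != 0 -> z != 0 -> (4 * a * z)^-1 * (z * (a * v)) = v / 4.
    by move=> an zn; field; rewrite an zn.
  by apply: gen; rewrite ?expf_neq0//; exact: lt0r_neq0.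
by rewrite mulrDl addrC.
Qed.

Hypothesis vanish : forall x, `|x - x0| <= 2 * r -> (forall a, S a -> x != a) -> lin_vanish U x.

(** Away from the exceptional set, [U] vanishes at the boundary near each point.
    In the limit, only the values at the nodes, which have small coefficients,
    and the error term remain in the local reproduction. *)
Lemma bad_bound : exists2 e : R, 0 < e <= 1 & exists2 C2 : R, 0 <= C2 &
  forall A d k, 0 <= A -> 0 <= d -> (forall y, 0 < y -> mass U om y <= A * blow E d y) ->
  0 < k <= e * r / 2 ->
  mass U (fun x => \1_(~` near_set (2 / e * k)) x * om x) k <= C2 + A * blow E d k / 4.
Proof.
have [l [ls l1 pf lsum]] := @exists_small_partial_fractions R M (1 / 8) ltac:(by lra).
have Ml : (M <= size l)%N by rewrite ls.
have [Cl Cl0 hl] := local_reproduction j l1 pf Ml.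
have [P P0 lP] := seq_bounded l.
have c40 : 0 < c4 by rewrite exprn_gt0.
have pi0 : 0 <= (pi : R) := pi_ge0 R.
(* With this [e], the heights [e * p.1] of the nodes are at most 1, and the
   error term is at most an eighth of the growth bound. *)
pose e := Num.min 1 (Num.min P^-1 (8 * (Cl * c4 + 1))^-1).
have CC : 0 < Cl * c4 + 1 by rewrite ltr_wpDl// mulr_ge0// ltW.
have e0 : 0 < e by rewrite !lt_min ltr01 !invr_gt0 P0 mulr_gt0.
have e1 : e <= 1 by rewrite ge_min lexx.
have eP : e * P <= 1.
  by rewrite -ler_pdivlMr// mul1r !ge_min lexx orbT.
have eC : Cl * c4 * e <= 1 / 8.
  have : e * (8 * (Cl * c4 + 1)) <= 1.
    by rewrite -ler_pdivlMr ?mulr_gt0// mul1r !ge_min lexx !orbT.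
  by nra.
exists e; first by rewrite e0.
exists (Ag * (2 * pi) / 8); first by rewrite divr_ge0 ?mulr_ge0.
move=> A d k A0 d0 hA /andP[k0 ker].
set D := near_set _; set w := fun x => _ * _.
have tw : tame w.
  by apply: indic_tame; [apply: measurableC; exact: near_measurable|exact: om_tame].
have w01 x : 0 <= w x <= om x.
  by rewrite /w indicE; case: (_ \in _); rewrite ?mul1r ?mul0r ?lexx om_ge0.
have w0 x : 0 <= w x by case/andP: (w01 x).
have [b [tb bw ->]] := mass_avg hU k0 tw w0.
have bom x : `|b x| <= om x by rewrite bw; case/andP: (w01 x).
(* The scale at which the height [k] becomes [e]; the unit interval then stands
   for points at distance [q] along the boundary. *)
pose q := k / e; have q0 : 0 < q by rewrite divr_gt0.
have qe : q * e = k by rewrite /q divfK// gt_eqF.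
have /andP[_ r1] := r01.
have q2r : 2 * q <= r by rewrite mulrC -ler_pdivlMr// /q ler_pdivrMr//; lra.
have qr : q <= r by lra.
have q1 : q <= 1 by exact: le_trans r1.
have [Wt [Wy [Wtt hW]]] := bharmonic_scaled_mean hU q0 tb.
have q01 : 0 < q <= 1 by rewrite q0.
have gW := mass_growth A0 d0 hA tb bom q01.
set N := c4 * _ in gW.
have bq : blow E d q <= blow E d k.
  by apply: blow_anti => //; rewrite ler_pdivlMr// ler_piMr// ltW.
have N0 : 0 <= N.
  apply: mulr_ge0; first exact: ltW.
  by apply: addr_ge0; apply: mulr_ge0; rewrite ?blow_ge0// mulr_ge0.
have AB0 : 0 <= A * blow E d k by rewrite mulr_ge0// blow_ge0.
have := bh_y hW 0 e0; set F := fun y => avg _ _ _ _ => dF.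
have -> : avg U b 0 k = F e by rewrite /F mulr0 qe.
apply: le_trans (ler_norm _) _.
apply: right_limit_le dF _ => t t0.
pose K := [set x | `|x - x0| <= 2 * r /\ forall a, S a -> q <= `|x - a|].
have t20 : 0 < t / (2 * pi + 1) by rewrite divr_gt0// ltr_wpDl// mulr_ge0.
have KU : K `<=` lin_vanish U.
  move=> x [xr xS]; apply: vanish => // a Sa; apply/eqP => xa.
  by have := xS a Sa; rewrite xa subrr normr0 leNgt q0.
have [s0 s00 s0P] := lin_vanish_uniform (@far_compact R S q x0 (2 * r)) KU t20.
exists (Num.min 1 (s0 / q)); first by rewrite lt_min ltr01 divr_gt0.
move=> s /andP[sgt0]; rewrite lt_min => /andP[s1 ss0].
have s01 : 0 < s <= 1 by rewrite sgt0 ltW.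
have e01 : 0 < e <= 1 by rewrite e0.
have le1 p : p \in l -> e * p.1 <= 1.
  by move=> pl; apply: le_trans eP; rewrite ler_pM2l// lP.
have qs0 : 0 < q * s by rewrite mulr_gt0.
have qsk : k <= q * (s + e) by rewrite mulrDr qe lerDr ltW.
have [tz hz] := hl _ _ _ _ N e s hW N0 gW s01 e01 le1.
rewrite mulr0 in hz; rewrite /F mulr0.
(* Over the unit interval, [b] only meets points at distance at least [q] from
   [S], where [U] tends to zero uniformly. *)
have zeta : `|intR (fun t => avg U b (q * t) (q * s) * cut_off j.+2.*2 e l t)| <= t.
  apply: cut_off_average => //; first exact: ltW.
  move=> v v1.
  have -> : t = t / (2 * pi + 1) * (2 * pi + 1).
    by rewrite divfK// gt_eqF// ltr_wpDl// mulr_ge0.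
  rewrite (@le_trans _ _ (t / (2 * pi + 1) * (2 * pi)))//; last first.
    by rewrite ler_wpM2l ?(ltW t20)// lerDl.
  have -> : t / (2 * pi + 1) * (2 * pi) = intR (fun x => t / (2 * pi + 1) * bell x0 x).
    by rewrite intRZ ?intR_bell//; exact: bell_tame.
  apply: intR_norm_le; [|by apply: tameZ; exact: bell_tame|].
    have [Vt [Vy [Vtt hV]]] := bharmonic_scaled_mean hU q0 tb.
    have hs := bharmonic_affine (q * v) ltr01 hU.
    have := bh_tame hs qs0 tb; congr tame; apply/funext => x.
    by rewrite !mul1r addrC.
  move=> x; have [bx|bx] := eqVneq (b x) 0.
    by rewrite bx mulr0 normr0 mulr_ge0 ?bell_ge0// ltW.
  have wx : w x != 0 by rewrite -bw normr_eq0.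
  rewrite normrM ler_pM//; last first.
    by rewrite (le_trans (bom x))// tentX_bell.
  have om0 : om x != 0.
    by apply: contraNneq wx => ox; rewrite /w ox mulr0.
  have xr : `|x - x0| < r.
    rewrite ltNge; apply: contra om0 => /tent_out h.
    by rewrite /om h doubleS expr0n.
  have xD : ~ D x.
    by move=> Dx; move: wx; rewrite /w indicE memNset ?mul0r ?eqxx//= => /(_ Dx).
  have qv : `|q * v| <= q by rewrite normrM (gtr0_norm q0) ler_piMr ?(ltW q0)// ltW.
  apply: s0P; last by rewrite qs0/= mulrC -ltr_pdivlMr.
  split.
    rewrite addrAC (le_trans (ler_normD _ _))// mulr_natl mulr2n lerD ?(ltW xr)//.
    exact: le_trans qv qr.
  move=> a Sa; rewrite leNgt; apply/negP => h; apply: xD; exists a => //.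
  have -> : x - a = (x + q * v - a) - q * v by ring.
  rewrite (le_lt_trans (ler_normB _ _))//.
  have -> : 2 / e * k = q + q by rewrite /q; ring.
  exact: ltr_leD h qv.
have sumb : `|\sum_(p <- l) p.2 * avg U b (q * 0) (q * (s + e * p.1))| <= A * blow E d k / 8.
  rewrite (le_trans (ler_norm_sum _ _ _))// (@le_trans _ _ (\sum_(p <- l) `|p.2| * (A * blow E d k)))//.
    rewrite big_seq [leRHS]big_seq; apply: ler_sum => p pl; have p1 := l1 p pl.
    have p0 : 0 < p.1 by exact: lt_trans p1.
    have sp : 0 < s + e * p.1 by rewrite addr_gt0// mulr_gt0.
    have qp0 : 0 < q * (s + e * p.1) by rewrite mulr_gt0.
    rewrite normrM ler_wpM2l// mulr0 (le_trans (avg_le hU qp0 tb om_tame _))//.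
      by move=> x; rewrite addr0.
    rewrite (le_trans (hA _ qp0))// ler_wpM2l// blow_anti//.
    rewrite (le_trans qsk)// ler_pM2l// lerD2l ler_peMr ?ltW//.
  by rewrite -big_distrl/= mulrC ler_wpM2l// (le_trans lsum)// mul1r.
have err : Cl * N * e ^+ (size l).*2.+1 <= A * blow E d k / 8 + Ag * (2 * pi) / 8.
  have eK : e ^+ (size l).*2.+1 <= e by rewrite exprS ler_piMr ?(ltW e0)// exprn_ile1// ltW.
  rewrite (@le_trans _ _ (Cl * N * e))//; first by apply: ler_wpM2l => //; exact: mulr_ge0.
  rewrite [leLHS](_ : _ = Cl * c4 * e * (A * blow E d q + Ag * (2 * pi))); last by rewrite /N; ring.
  rewrite -mulrDl mulrC [leRHS](_ : _ = (A * blow E d k + Ag * (2 * pi)) * (1 / 8)); last by ring.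
  have Cl4e : 0 <= Cl * c4 * e by apply: mulr_ge0; [apply: mulr_ge0|] => //; exact: ltW.
  have Ap : 0 <= Ag * (2 * pi) by rewrite !mulr_ge0.
  apply: ler_pM => //; last by rewrite lerD2r ler_wpM2l.
  by rewrite addr_ge0// mulr_ge0// blow_ge0.
rewrite mulr0 in sumb.
apply: le_trans (norm_le3 hz sumb zeta) _; apply: le_trans (lerD (lexx _) err) _.
by apply: eq_ler; field.
Qed.

(** A bound [A * blow E d] improves to [(C0 + A / 2) * blow E d], where [C0]
    does not depend on [d]. The best constant [A], which is finite by the growth
    of [U], is thus at most [2 * C0]; for a given height, take [d] below it. *)
Lemma mass_bounded : exists C : R, forall y, 0 < y -> mass U om y <= C.
Proof.
have [e /andP[e0 e1] [C2 C20 h2]] := bad_bound.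
have [|d1 d10 [C1 C10 h1]] := @good_bound (2 / e); first by rewrite divr_gt0.
pose d2 := Num.min d1 (e * r / 2).
have d20 : 0 < d2 by rewrite lt_min d10 divr_gt0// mulr_gt0.
have pi0 : 0 <= (pi : R) := pi_ge0 R.
have raw y : 0 < y -> mass U om y <= Ag * blow E 1 y * (2 * pi).
  move=> y0; apply: (mass_bell hU (x0 := x0)) => //; first exact: om_tame.
  - by move=> x; rewrite om_ge0 tentX_bell.
  - by move=> x _; exact: gU.
  - by rewrite mulr_ge0// blow_ge0.
pose C0 := C1 + C2 + Ag * blow E 1 d2 * (2 * pi).
have C3 : 0 <= Ag * blow E 1 d2 * (2 * pi) by rewrite !mulr_ge0// blow_ge0.
have C00 : 0 <= C0 by rewrite !addr_ge0.
have step A d k : 0 <= A -> 0 <= d -> (forall y, 0 < y -> mass U om y <= A * blow E d y) ->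
    0 < k -> mass U om k <= (C0 + A / 2) * blow E d k.
  move=> A0 d0 hA k0; have b1 := blow_ge1 E d k.
  have [kd|kd] := ltP k d2.
    have /andP[kd1 kd2] : (k < d1) && (k < e * r / 2) by rewrite -lt_min.
    rewrite (mass_split hU k0 (near_measurable S (2 / e * k)) om_tame).
    have h1' := h1 A d k A0 d0 hA; have h2' := h2 A d k A0 d0 hA.
    have {}h1' := h1' ltac:(by rewrite k0); have {}h2' := h2' ltac:(by rewrite k0 ltW).
    have : C0 <= C0 * blow E d k by rewrite ler_peMr.
    move=> C0b; apply: le_trans (lerD h1' h2') _.
    rewrite mulrDl; move: C0b; rewrite {1}/C0; lra.
  rewrite (le_trans (raw k k0))// (@le_trans _ _ C0)//.
    rewrite (@le_trans _ _ (Ag * blow E 1 d2 * (2 * pi)))//.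
      by rewrite ler_wpM2r ?mulr_ge0// ler_wpM2l// blow_anti.
    by rewrite /C0 lerDr addr_ge0.
  rewrite (@le_trans _ _ (C0 * blow E d k))//; first by rewrite ler_peMr.
  by rewrite ler_wpM2r ?blow_ge0// lerDl divr_ge0.
exists (2 * C0) => y y0; pose d := Num.min 1 y.
have d0 : 0 < d by rewrite lt_min ltr01.
have d1' : d <= 1 by rewrite ge_min lexx.
pose X := [set mass U om z / blow E d z | z in [set z | 0 < z]].
have bz z : 0 < blow E d z by rewrite (lt_le_trans ltr01)// blow_ge1.
have Xub : ubound X (Ag * d ^- E * (2 * pi)).
  move=> _ [z z0 <-]; rewrite ler_pdivrMr// (le_trans (raw z z0))//.
  have -> : Ag / d ^+ E * (2 * pi) * blow E d z = Ag * (d ^- E * blow E d z) * (2 * pi) by ring.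
  rewrite ler_wpM2r ?mulr_ge0// ler_wpM2l//.
  by apply: blow1_le => //; rewrite d0.
have Xz z : 0 < z -> mass U om z / blow E d z <= sup X.
  by move=> z0; apply: ub_le_sup; [exists (Ag * d ^- E * (2 * pi))|exists z].
have s0 : 0 <= sup X.
  apply: le_trans (Xz y y0); rewrite divr_ge0 ?blow_ge0//; apply: mass_ge0; exact: om_ge0.
have sX z : 0 < z -> mass U om z <= sup X * blow E d z.
  by move=> z0; rewrite -ler_pdivrMr// Xz.
have : sup X <= C0 + sup X / 2.
  apply: ge_sup; first by exists (mass U om y / blow E d y); exists y.
  by move=> _ [z z0 <-]; rewrite ler_pdivrMr//; apply: step => //; exact: ltW.
move=> sC; rewrite (le_trans (sX y y0))// blow_far ?mulr1//; last by rewrite ge_min lexx orbT.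
lra.
Qed.

End mass_bound.

(** * Positive functionals *)

Section egorov.
Variable R : realType.
Implicit Types (p q : R -> R) (a d e r t x : R).

Definition unit_valued p := continuous p /\ forall x, 0 <= p x <= 1.

Lemma unit_valued_min p q : unit_valued p -> unit_valued q ->
  unit_valued (fun x => Num.min (p x) (q x)).
Proof.
move=> [cp p01] [cq q01]; split.
  by move=> x; apply: (@continuous_min _ _ _ _ x); [exact: cp|exact: cq].
move=> x; have /andP[p0 p1] := p01 x; have /andP[q0 q1] := q01 x.
by rewrite le_min p0 q0 ge_min p1.
Qed.

Lemma unit_valued_max p q : unit_valued p -> unit_valued q ->
  unit_valued (fun x => Num.max (p x) (q x)).
Proof.
move=> [cp p01] [cq q01]; split.
  by move=> x; apply: (@continuous_max _ _ _ _ x); [exact: cp|exact: cq].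
move=> x; have /andP[p0 p1] := p01 x; have /andP[q0 q1] := q01 x.
by rewrite le_max p0 ge_max p1 q1.
Qed.

(** Dini's theorem. *)
Lemma dini (f : nat -> R -> R) (K : set R) e : compact K -> 0 < e ->
  (forall n, continuous (f n)) -> (forall n x, f n.+1 x <= f n x) ->
  (forall x, exists n, f n x <= 0) -> exists n, forall x, K x -> f n x <= e.
Proof.
move=> /compact_near_coveringP cK e0 cf fS f0.
have fanti n m x : (n <= m)%N -> f m x <= f n x.
  elim: m => [|m IH]; first by rewrite leqn0 => /eqP ->.
  rewrite leq_eqVlt => /orP[/eqP -> //|/IH]; exact: le_trans.
have /cK h : forall x, K x -> \forall x' \near x & n \near \oo, f n x' <= e.
  move=> x _; have [n fn] := f0 x.
  have /cvgrPdist_lt/(_ _ e0) h := cf n x.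
  exists ([set x' | `|f n x - f n x'| < e], [set m | (n <= m)%N]); first split => //=.
    by exists n.
  move=> [x' m] /= [fx nm]; rewrite (le_trans (fanti _ _ _ nm))//.
  by move: fx; rewrite ltr_distlC => /andP[_ h2]; lra.
have [N _ NP] : \forall n \near \oo, K `<=` fun x => f n x <= e by exact: h.
by exists N => x; apply: NP; exact: leqnn.
Qed.

(** The countable additivity of a positive functional, from Dini's theorem. If
    the conclusion failed, the successive minima of nearly optimal test
    functions would decrease to zero, whereas the functional, by its modularity,
    would lose at most [e / 2] on the way. *)
Lemma functional_egorov (l : (R -> R) -> R) (O : nat -> set R) (K : set R) C e :
  compact K -> 0 <= C ->
  (forall p q, unit_valued p -> unit_valued q ->
     l (fun x => Num.min (p x) (q x)) + l (fun x => Num.max (p x) (q x)) = l p + l q) ->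
  (forall p t, unit_valued p -> (forall x, K x -> p x <= t) -> l p <= t * C) ->
  (forall n, O n.+1 `<=` O n) -> (forall x, exists n, ~ O n x) -> 0 < e ->
  exists n, forall p, unit_valued p -> (forall x, ~ O n x -> p x = 0) -> l p <= e.
Proof.
move=> cK C0 lmM lK OS O0 e0; apply: contrapT => H.
pose T n := [set l p | p in [set p | unit_valued p /\ forall x, ~ O n x -> p x = 0]].
have Tub n : has_sup (T n).
  split.
    exists (l (fun=> 0)), (fun=> 0) => //; split => //; split.
      by move=> x; exact: cvg_cst.
    by move=> x; rewrite lexx ler01.
  exists (1 * C) => _ [p [up _] <-]; apply: lK => // x _.
  by have [_ /(_ x)/andP[]] := up.
have TS n p : unit_valued p -> (forall x, ~ O n x -> p x = 0) -> l p <= sup (T n).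
  by move=> up p0; apply: ub_le_sup; [have [] := Tub n|exists p].
pose h n : R := e / 2 * (1 / 2) ^+ n.+1.
have h0 n : 0 < h n by rewrite mulr_gt0 ?exprn_gt0//; lra.
have hS n : h n.+1 = h n / 2 by rewrite /h (exprS _ n.+1); field.
have /choice[p pP] : forall n, exists p, [/\ unit_valued p, forall x, ~ O n x -> p x = 0 &
    sup (T n) - h n < l p].
  move=> n; have [_ [q [uq q0] <-] lq] := sup_adherent (h0 n) (Tub n).
  by exists q.
have Tn n : e <= sup (T n).
  rewrite leNgt; apply/negP => Te; apply: H; exists n => q uq q0.
  by rewrite (le_trans (TS n q uq q0))// ltW.
pose f := fix f n := if n is n'.+1 then fun x => Num.min (f n' x) (p n'.+1 x) else p 0%N.
have fP n : [/\ unit_valued (f n), forall x, ~ O n x -> f n x = 0 &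
    sup (T n) - (e / 2 - h n) <= l (f n)].
  elim: n => [|n [uf f0 fl]].
    have [up p0 pl] := pP 0%N; split => //; apply: ltW.
    by have -> : e / 2 - h 0%N = h 0%N; [rewrite /h expr1; field|].
  have [up p0 pl] := pP n.+1.
  split; first exact: unit_valued_min.
    move=> x Ox; rewrite /= p0//.
    by have [_ /(_ x)/andP[h1 _]] := uf; rewrite min_r.
  have lM : l (fun x => Num.max (f n x) (p n.+1 x)) <= sup (T n).
    apply: TS; first exact: unit_valued_max.
    by move=> x Ox; rewrite f0// p0 ?maxxx// => /OS.
  have := lmM _ _ uf up; rewrite /= hS; rewrite hS in pl; lra.
have fe n : e / 2 <= l (f n).
  have [_ _ fl] := fP n; have := h0 n; have := Tn n; lra.
have C10 : 0 < C + 1 by lra.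
have t0 : 0 < e / (4 * (C + 1)) by rewrite divr_gt0// mulr_gt0.
have [n fn] : exists n, forall x, K x -> f n x <= e / (4 * (C + 1)).
  apply: dini => //.
  - by move=> n; have [[]] := fP n.
  - by move=> n x; rewrite /= ge_min lexx.
  - move=> x; have [n On] := O0 x; exists n.
    by have [_ -> //] := fP n.
have [uf _ _] := fP n.
have := lK _ _ uf fn; have := fe n.
have : e / (4 * (C + 1)) * C <= e / 4.
  rewrite (@le_trans _ _ (e / (4 * (C + 1)) * (C + 1)))//.
    by rewrite ler_wpM2l ?(ltW t0)// lerDl.
  by apply: eq_ler; field; rewrite gt_eqF.
lra.
Qed.

(** One minus the normalised supremum over [K] of tents, which is Lipschitz as
    each tent is. *)
Lemma separating_function (K : set R) d : 0 < d ->
  exists p, [/\ unit_valued p, forall x, K x -> p x = 0 &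
    forall x, (forall a, K a -> d <= `|x - a|) -> p x = 1].
Proof.
move=> d0; pose T x := [set tent d a x | a in K].
have [K0|/set0P[a0 Ka0]] := eqVneq K set0.
  exists (fun=> 1); split => //; last by move=> x; rewrite K0.
  by split => [x|x]; [exact: cvg_cst|rewrite ler01 lexx].
have Tn x : has_sup (T x).
  split; first by exists (tent d a0 x), a0.
  by exists d => _ [a _ <-]; rewrite tent_le// ltW.
pose s x := sup (T x).
have sK x a : K a -> tent d a x <= s x.
  by move=> Ka; apply: ub_le_sup; [have [] := Tn x|exists a].
have sle x b : (forall a, K a -> tent d a x <= b) -> s x <= b.
  move=> h; apply: ge_sup; first by have [] := Tn x.
  by move=> _ [a Ka <-]; exact: h.
have s0 x : 0 <= s x by apply: le_trans (sK x a0 Ka0); exact: tent_ge0.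
have sd x : s x <= d by apply: sle => a _; rewrite tent_le// ltW.
have slip x t : s x <= s (x + t) + `|t|.
  by apply: sle => a Ka; rewrite (le_trans (tent_lip d a x t))// lerD2r sK.
have cs : continuous s.
  move=> x; apply/cvgrPdist_le => e e0; near=> y.
  have xy : `|x - y| <= e.
    by near: y; apply/nbhs_ballP; exists e => // y /= /ltW.
  rewrite distrC in xy.
  have := slip x (y - x); have := slip y (x - y).
  rewrite !(addrC _ (_ - _)) !subrK distrC => h1 h2.
  by rewrite ler_norml; apply/andP; split; lra.
exists (fun x => 1 - s x / d); split.
- split; first by move=> x; apply: cvgB; [exact: cvg_cst|apply: cvgMl; exact: cs].
  move=> x; rewrite subr_ge0 ler_pdivrMr// mul1r sd lerBlDr lerDl divr_ge0// ltW//.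
- move=> x Kx; have -> : s x = d; last by rewrite divff ?subrr// gt_eqF.
  apply/eqP; rewrite eq_le sd/= (le_trans _ (sK x x Kx))//.
  by rewrite /tent subrr normr0 subr0 le_max lexx orbT.
- move=> x h; have -> : s x = 0; last by rewrite mul0r subr0.
  apply/eqP; rewrite eq_le s0 andbT; apply: sle => a Ka.
  by rewrite tent_out// h.
Unshelve. all: end_near. Qed.

Lemma ultra_bounded_cvg (G : set_system R) (f : R -> R) C : UltraFilter G ->
  (\forall s \near G, `|f s| <= C) -> f s @[s --> G] --> lim (f s @[s --> G]).
Proof.
move=> GU fC; apply/cvg_ex.
have [] := @segment_compact R (- C) C (f s @[s --> G]) _ _.
  by apply: filterS fC => s; rewrite /= in_itv/= ler_norml.
move=> l [_ fl]; exists l => V lV.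
have [//|GV] := @in_ultra_setVsetC _ G (f @^-1` V) GU.
have [x [nVx Vx]] := fl (~` V) V GV lV.
by case: nVx.
Qed.

End egorov.

(** * Distribution of the mass of the Poisson kernel *)

Section poisson_moments.
Variable R : realType.
Implicit Types (a c e t : R).

(** Bounds the kernel below by its values at the ends of the interval. By
    homogeneity, the mass of this interval is a definite fraction that does not
    depend on [e]. *)
Lemma poisson_center c e : 0 < c -> 0 < e ->
  2 * c / (pi * (1 + c ^+ 2)) <=
    intR (fun t => \1_[set t | `|t| < c * e] t * poisson e t).
Proof.
move=> c0 e0; have pi0 : 0 < (pi : R) := pi_gt0 R.
have a0 : 0 < c * e by rewrite mulr_gt0.
pose A := [set t : R | `|t| < c * e].
have AE : A = ball (0 : R) (c * e).
  by apply/seteqP; split => t; rewrite /A /ball /= sub0r normrN.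
have mA : measurable A by rewrite AE; exact: measurable_ball.
have q0 : 0 < e ^+ 2 * (1 + c ^+ 2) by rewrite mulr_gt0 ?exprn_gt0 ?oneDsqr_gt0.
pose k := e / (pi * (e ^+ 2 * (1 + c ^+ 2))).
have k0 : 0 <= k by apply: divr_ge0; [exact: ltW|apply: mulr_ge0; exact: ltW].
have tA : tame (fun t => \1_A t).
  have := indic_tame mA (tame_cauchy (1 + (c * e) ^+ 2)) => tb.
  apply: le_tame tb; first exact: measurable_indic.
  move=> t; rewrite indicE; have [At|At] := pselect (A t).
    rewrite mem_set// normr1 mul1r ler_pdivlMr ?oneDsqr_gt0// mul1r lerD2l.
    by rewrite -(real_normK (num_real t)) lerXn2r ?nnegrE ?(ltW a0)// ltW.
  by rewrite memNset// normr0 mul0r.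
have IA : intR (fun t => \1_A t) = 2 * (c * e).
  have mB : lebesgue_measure A = ((c * e) *+ 2)%:E.
    by rewrite AE; apply: lebesgue_measure_ball; exact: ltW.
  rewrite /intR /Rintegral integral_indic// setIT.
  by transitivity (fine ((c * e) *+ 2)%:E); [congr fine; exact: mB|rewrite /= mulr2n; ring].
rewrite (@le_trans _ _ (intR (fun t => k * \1_A t)))//.
  rewrite intRZ// IA /k; apply: eq_ler.
  have pn : (pi : R) != 0 by exact: lt0r_neq0.
  have en := lt0r_neq0 e0; have cn := lt0r_neq0 (oneDsqr_gt0 c).
  by move: (pi : R) pn => P pn; field; rewrite ?pn ?en ?cn.
have [tP _ _ _] := poisson_tame e0.
apply: intR_le; [exact: tameZ|exact: indic_tame|].
move=> t; rewrite mulrC indicE; have [At|At] := pselect (A t); last first.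
  by rewrite memNset// !mul0r.
rewrite mem_set// !mul1r /k /poisson ler_wpM2l ?(ltW e0)// lef_pV2 ?posrE ?mulr_gt0 ?sqD_gt0 ?oneDsqr_gt0//.
rewrite ler_wpM2l ?(ltW pi0)// mulrDr mulr1 addrC lerD2l -exprMn mulrC.
by rewrite -(real_normK (num_real t)) lerXn2r ?nnegrE ?(ltW a0)// ltW.
Qed.

(** The first moment of the Poisson kernel is infinite, but on bounded intervals
    it is small with [e]; [t] separates the near part from the tail. *)
Lemma poisson_first_moment e t a : 0 < e -> 0 < t -> `|a| * poisson e a <= t * poisson e a + e / t.
Proof.
move=> e0 t0; have P0 := poisson_ge0 a e0.
have [ta|ta] := leP `|a| t.
  by rewrite (le_trans (ler_wpM2r P0 ta))// lerDl divr_ge0 ?ltW.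
rewrite (@le_trans _ _ (e / t))//; last by rewrite lerDr mulr_ge0// ltW.
have pi1 : 1 <= (pi : R) by have := pi_ge2 R; lra.
have a0 : 0 < `|a| by exact: lt_trans ta.
have q0 := sqD_gt0 a e0.
rewrite /poisson mulrCA ler_wpM2l ?(ltW e0)// ler_pdivrMr ?mulr_gt0//; last lra.
rewrite mulrC ler_pdivlMr// -(real_normK (num_real a)).
have e20 := sqr_ge0 e.
rewrite (@le_trans _ _ (`|a| ^+ 2))//.
  by rewrite expr2 ler_wpM2l// ltW.
rewrite (@le_trans _ _ (`|a| ^+ 2 + e ^+ 2))// ?lerDl//.
by rewrite ler_peMl// addr_ge0// exprn_ge0.
Qed.

End poisson_moments.

(** * Vanishing of the mass at a point *)

Section concentration.
Variables (R : realType) (U Ut Uy Utt : R -> R -> R) (j : nat) (Ag x0 r CB : R).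
Hypothesis hU : bharmonic U Ut Uy Utt.
Hypothesis Ag0 : 0 <= Ag.
Let E := j.*2.+1.
Let M := j.+1.
Hypothesis gU : forall x y, 0 < y -> `|U x y| <= Ag * blow E 1 y.
Hypothesis r01 : 0 < r <= 1.
Hypothesis mB : forall y, 0 < y -> mass U (fun x => tent r x0 x ^+ M.*2) y <= CB.
Implicit Types (d e k t x y s : R) (w p b : R -> R) (K : set R).

Let r0 : 0 < r. Proof. by case/andP: r01. Qed.
Let r1 : r <= 1. Proof. by case/andP: r01. Qed.
Let om := tent (r / 2) x0.
Let rho := r / 4.
Let rho0 : 0 < rho. Proof. by rewrite divr_gt0. Qed.
(** At least 1 near the support of [om], and of bounded mass: it absorbs the
    cost of small translations of [om]. *)
Let chi x := (4 / r) ^+ M.*2 * tent r x0 x ^+ M.*2.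
Let C1 := (4 / r) ^+ M.*2 * CB.

Let chi_ge0 x : 0 <= chi x.
Proof. by rewrite mulr_ge0 ?exprn_ge0 ?tent_ge0 ?divr_ge0 ?(ltW r0). Qed.

Let chi_ge1 x : `|x - x0| <= 3 * r / 4 -> 1 <= chi x.
Proof.
move=> h; rewrite /chi -exprMn exprn_ege1// mulrAC ler_pdivlMr// mul1r.
have : r - `|x - x0| <= tent r x0 x by rewrite le_max lexx orbT.
lra.
Qed.

Let chi_tame : tame chi.
Proof. by apply: tameZ; apply: tentX_tame; rewrite (ltW r0). Qed.

Let om_tame : tame om.
Proof. by apply: (@tentX_tame R (r / 2) x0 0); apply/andP; split; have := r0; have := r1; lra. Qed.

Let om_ge0 x : 0 <= om x. Proof. exact: tent_ge0. Qed.

Let om_bell x : om x <= bell x0 x.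
Proof. by apply: (@tentX_bell R (r / 2) x0 0); apply/andP; split; have := r0; have := r1; lra. Qed.

Let om_le1 x : om x <= 1.
Proof. by rewrite (le_trans (tent_le _ _ _))//; have := r0; have := r1; lra. Qed.

Let om_shift x t : `|t| <= rho -> om x <= om (x + t) + `|t| * chi (x + t).
Proof.
move=> t1; have [h|h] := leP (r / 2) `|x - x0|.
  by rewrite {1}/om tent_out// addr_ge0// mulr_ge0.
rewrite (le_trans (tent_lip _ _ _ t))// lerD2l ler_peMr// chi_ge1//.
rewrite addrAC (le_trans (ler_normD _ _))//; move: t1; rewrite /rho; have := r0; lra.
Qed.

Let om_chi x : om x <= chi x.
Proof.
have [h|h] := leP (r / 2) `|x - x0|; first by rewrite {1}/om tent_out.
by rewrite (le_trans (om_le1 x))// chi_ge1//; have := r0; lra.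
Qed.

Let mass_chi y : 0 < y -> mass U chi y <= C1.
Proof.
move=> y0; rewrite /C1 (massZ hU)//; last by apply: tentX_tame; rewrite (ltW r0).
by rewrite ler_wpM2l ?mB// exprn_ge0// divr_ge0 ?(ltW r0).
Qed.

Let C10 : 0 <= C1.
Proof. by apply: le_trans (mass_chi ltr01); apply: mass_ge0. Qed.

Let sel p y := mass U (fun x => p x * om x) y.

Let sel_tame p : unit_valued p -> tame (fun x => p x * om x).
Proof.
move=> [cp p01]; apply: (@tameM _ 1) => //; first exact: continuous_measurable_fun.
by move=> x; have /andP[p0 p1] := p01 x; rewrite ger0_norm.
Qed.

Let sel_ge0 p y : unit_valued p -> 0 <= sel p y.
Proof.
by move=> [_ p01]; apply: mass_ge0 => x; rewrite mulr_ge0//; have /andP[] := p01 x.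
Qed.

Let one_uv : unit_valued (fun _ : R => 1 : R).
Proof. by split => x; [exact: cvg_cst|rewrite ler01 lexx]. Qed.

Let selE y : sel (fun=> 1) y = mass U om y.
Proof. by congr (mass U _ y); apply/funext => x; rewrite mul1r. Qed.

Let sel_le p t y : 0 < y -> unit_valued p -> 0 <= t -> (forall x, `[x0 - r / 2, x0 + r / 2]%classic x -> p x <= t) ->
  sel p y <= t * C1.
Proof.
move=> y0 up t0 pt; rewrite (@le_trans _ _ (t * mass U chi y))//; last first.
  by rewrite ler_wpM2l// mass_chi.
rewrite -(massZ hU)//; apply: (mass_le hU) => //; [exact: sel_tame|exact: tameZ|].
move=> x; have [h|h] := leP (r / 2) `|x - x0|.
  by rewrite {1}/om tent_out// mulr0 mulr_ge0.
by rewrite ler_pM ?om_chi//; [have [_ /(_ x)/andP[]] := up|apply: pt; rewrite /= in_itv/= -ler_distl ltW].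
Qed.

Variable c0 : R.
Hypothesis c00 : 0 < c0.
Let c1 := c0 / 2.
Let c10 : 0 < c1. Proof. by rewrite divr_gt0. Qed.
(** Half the aperture of the cones carries at least this fraction of the mass of
    the Poisson kernel, by [poisson_center]. *)
Let th := 2 * c1 / (pi * (1 + c1 ^+ 2)).

(** In the reproduction at the height [d], translations by at most [c0 * d / 2]
    keep the support of [b] away from [K]; there, only the mass selected by [p]
    is seen. The other translations see at most the whole mass, but carry at
    most the fraction [1 - th] of the kernel. *)
Lemma far_average : exists2 C : R, 0 <= C & forall K d t p b s,
  0 < d <= rho -> 0 < t -> 0 < s <= 1 -> unit_valued p ->
  (forall x, (forall a, K a -> c0 * d / 2 <= `|x - a|) -> p x = 1) ->
  tame b -> (forall x, `|b x| <= om x) ->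
  (forall x, b x != 0 -> forall a, K a -> c0 * d <= `|x - a|) ->
  `|avg U b 0 (rho * (s + d / rho))| <= sel p (rho * s) + (1 - th) * sel (fun=> 1) (rho * s)
     + C1 * (t + 2 * pi * (d / rho) / t) + C * (d / rho).
Proof.
have [Cl Cl0 hl] := poisson_cut_reproduction R j.
have pi0 : 0 <= (pi : R) := pi_ge0 R.
pose N := Ag * (2 * pi) * rho ^- E.
have rhoE : 0 <= rho ^- E by rewrite invr_ge0 exprn_ge0// ltW.
have N0 : 0 <= N by apply: mulr_ge0 => //; rewrite !mulr_ge0.
exists (Cl * N); first exact: mulr_ge0.
move=> K d t p b s /andP[d0 d1] t0 s01 up pK tb bom bK.
have [cp p01] := up; have /andP[s0 s1] := s01.
pose e := d / rho; have e0 : 0 < e by rewrite divr_gt0.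
have e1 : e <= 1 by rewrite ler_pdivrMr// mul1r.
have re : rho * e = d by rewrite /e mulrC divfK// gt_eqF.
have rho1 : rho <= 1 by rewrite /rho; have := r1; lra.
have [Wt [Wy [Wtt hW]]] := bharmonic_scaled_mean hU rho0 tb.
have gW : growth (fun t y => avg U b (rho * t) (rho * y)) N 0 E.
  move=> v y /andP[y0 y1]; have ry0 : 0 < rho * y by rewrite mulr_gt0.
  have ry1 : rho * y <= 1 by rewrite mulr_ile1// ltW.
  rewrite expr0 mulr1 (le_trans (avg_le hU (w := bell (x0 + rho * v)) ry0 tb (bell_tame _) _))//.
    move=> x; have -> : bell (x0 + rho * v) (x + rho * v) = bell x0 x.
      by rewrite /bell opprD addrACA subrr addr0.
    exact: le_trans (bom x) (om_bell x).
  rewrite (le_trans (mass_bell hU (K := Ag * blow E 1 (rho * y)) (x0 := x0 + rho * v) ry0 (bell_tame _) _ _ _))//.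
  - by move=> x; rewrite lexx bell_ge0.
  - by move=> x _; exact: gU.
  - by rewrite mulr_ge0// blow_ge0.
  by rewrite blow1_small ?ry0// /N exprMn invfM; apply: eq_ler; ring.
have e01 : 0 < e <= 1 by rewrite e0.
have [tz] := hl _ _ _ _ N e s hW N0 gW s01 e01; rewrite mulr0 -/e.
have rs0 : 0 < rho * s by rewrite mulr_gt0.
set Z := sel (fun=> 1) (rho * s); set a := sel p (rho * s).
have a0 : 0 <= a by exact: sel_ge0.
have Z0 : 0 <= Z by exact: sel_ge0.
have [tP _ _ _] := poisson_tame e0.
pose B := [set v : R | `|v| < c1 * e].
have mB' : measurable B.
  have -> : B = ball (0 : R) (c1 * e).
    by apply/seteqP; split => v; rewrite /B /ball /= sub0r normrN.
  exact: measurable_ball.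
have tBP : tame (fun v => \1_B v * poisson e v) by exact: indic_tame.
pose F v := a * poisson e v + Z * (poisson e v - \1_B v * poisson e v)
     + C1 * (t * poisson e v + e / t * bell 0 v).
have tF1 : tame (fun v => a * poisson e v) by exact: tameZ.
have tF2 : tame (fun v => Z * (poisson e v - \1_B v * poisson e v)) by apply: tameZ; exact: tameB.
have tF3' : tame (fun v => t * poisson e v + e / t * bell 0 v).
  by apply: tameD; apply: tameZ => //; exact: bell_tame.
have tF3 : tame (fun v => C1 * (t * poisson e v + e / t * bell 0 v)) by exact: tameZ.
have tF12 := tameD tF1 tF2.
have hF : `|intR (fun v => avg U b (rho * v) (rho * s) * poisson_cut j e v)| <= intR F.
  apply: intR_norm_le => //; first exact: tameD.
  move=> v; have [z0 z1 z2] := poisson_cut_bounds j v e0.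
  have P0 := poisson_ge0 v e0.
  have IP : \1_B v * poisson e v <= poisson e v.
    by rewrite indicE; case: (_ \in _); rewrite ?mul1r ?mul0r.
  have et0 : 0 <= e / t by rewrite divr_ge0 ?ltW.
  have bl := bell_ge0 0 v.
  have [v1|v1] := leP 1 `|v|.
    rewrite z2// mulr0 normr0 /F.
    apply: addr_ge0; first apply: addr_ge0; apply: mulr_ge0 => //; first by rewrite subr_ge0.
    by apply: addr_ge0; apply: mulr_ge0 => //; exact: ltW.
  have rv : `|rho * v| <= rho by rewrite normrM (gtr0_norm rho0) ler_piMr ?(ltW rho0)// ltW.
  have F3 : C1 * (`|v| * poisson_cut j e v) <= C1 * (t * poisson e v + e / t * bell 0 v).
    rewrite ler_wpM2l// (@le_trans _ _ (`|v| * poisson e v))//; first by rewrite ler_wpM2l.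
    rewrite (le_trans (poisson_first_moment v e0 t0))// lerD2l ler_peMr//.
    by rewrite bell_ge1// subr0 ltW.
  have split q : unit_valued q -> (forall x, `|b x| <= q (x + rho * v) * om (x + rho * v)
       + `|rho * v| * chi (x + rho * v)) ->
      `|avg U b (rho * v) (rho * s)| * poisson_cut j e v
        <= sel q (rho * s) * poisson e v + C1 * (`|v| * poisson_cut j e v).
    move=> uq bq.
    have tq : tame (fun x => `|rho * v| * chi x) by exact: tameZ.
    have tw := tameD (sel_tame uq) tq.
    have := avg_le hU (w := fun x => q x * om x + `|rho * v| * chi x) rs0 tb tw bq.
    rewrite (massD hU)//; last exact: sel_tame.
    rewrite (massZ hU)// -/(sel q (rho * s)) => h.
    have {}h : `|avg U b (rho * v) (rho * s)| <= sel q (rho * s) + `|v| * C1.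
      rewrite (le_trans h)// lerD2l ler_pM//; first by apply: mass_ge0.
        by rewrite normrM (gtr0_norm rho0) ler_piMl.
      exact: mass_chi.
    rewrite (le_trans (ler_wpM2r z0 h))// mulrDl lerD//.
      by rewrite ler_wpM2l// sel_ge0.
    by apply: eq_ler; ring.
  rewrite normrM (ger0_norm z0).
  have [vB|vB] := ltP `|v| (c1 * e).
    rewrite (le_trans (split p up _))//.
      move=> x; have [-> //|bx] := eqVneq (b x) 0.
        rewrite normr0; apply: addr_ge0; apply: mulr_ge0 => //.
        by have /andP[] := p01 (x + rho * v).
      rewrite (le_trans (bom x))// pK; last first.
        move=> k Kk; have := bK x bx k Kk.
        have -> : x - k = x + rho * v - k - rho * v by ring.
        have := ler_normB (x + rho * v - k) (rho * v).
        have : `|rho * v| <= c0 * d / 2.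
          rewrite normrM (gtr0_norm rho0) (@le_trans _ _ (rho * (c1 * e)))//.
            by rewrite ler_wpM2l ?(ltW rho0)// ltW.
          by rewrite mulrCA re /c1; apply: eq_ler; ring.
        lra.
      by rewrite mul1r om_shift.
    rewrite lerD// lerDl mulr_ge0// subr_ge0//.
  rewrite (le_trans (split (fun=> 1) one_uv _))//.
    by move=> x; rewrite mul1r (le_trans (bom x))// om_shift.
  rewrite /F; have -> : \1_B v = 0 :> R.
    by rewrite indicE memNset// /B /= => h; move: vB; rewrite leNgt h.
  by rewrite mul0r subr0 lerD// lerDr mulr_ge0.
have IF : intR F <= a + (1 - th) * Z + C1 * (t + 2 * pi * e / t).
  have tbl := tameZ (e / t) (bell_tame 0); have tp := tameZ t tP.
  rewrite /F (intRD tF12 tF3) (intRD tF1 tF2) intRZ// intRZ; last exact: tameB.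
  rewrite (intRB tP tBP) (intRZ C1 tF3') (intRD tp tbl) (intRZ t tP) (intRZ (e / t) (bell_tame 0)).
  rewrite intR_poisson// intR_bell !mulr1.
  have -> : e / t * (2 * pi) = 2 * pi * e / t by ring.
  rewrite lerD2r lerD2l mulrC ler_wpM2r// lerD2l lerN2.
  exact: poisson_center.
have -> : rho * (s + e) = rho * (s + d / rho) by [].
move=> err; apply: le_trans (norm_le2 err (le_trans hF IF)) _.
exact: lexx.
Qed.

Variables (flat : R -> R -> set R) (KG : R).
Hypothesis KG0 : 0 <= KG.
Hypothesis flat_mono : forall e n n', n' <= n -> flat e n `<=` flat e n'.
Hypothesis flat_ex : forall e x, 0 < e -> exists2 n : R, 0 < n & flat e n x.
Hypothesis flat_mass : forall e n y w, 0 < e -> 0 < y < n -> tame w -> (forall x, 0 <= w x <= 1) ->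
  (forall x, w x != 0 -> `|x - x0| <= 1 /\ exists2 a, flat e n a & `|x - a| < c0 * y) ->
  mass U w y <= e * KG.

Let th_gt0 : 0 < th.
Proof. by rewrite divr_gt0 ?mulr_gt0 ?pi_gt0 ?oneDsqr_gt0. Qed.

Let th_le1 : th <= 1.
Proof.
have pi1 : 1 <= (pi : R) by have := pi_ge2 R; lra.
have h := oneDsqr_gt0 c1; rewrite ler_pdivrMr ?mulr_gt0 ?pi_gt0// mul1r.
rewrite (@le_trans _ _ (1 + c1 ^+ 2))//; last by rewrite ler_peMl// ltW.
by have := sqr_ge0 (c1 - 1); rewrite !expr2; lra.
Qed.

(** Let [l p] be the limit, along an ultrafilter of heights tending to zero, of
    the masses weighted by [p]. For each [e], the complement of the points that
    are flat from a fixed height on carries little of [l], by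
    [functional_egorov]. Near flat points the mass is at most [e * KG], and far
    from them [far_average] applies. So [l 1 <= (1 - th) * l 1 + O(e)], and [l
    1] is zero. *)
Lemma mass_vanishes t s0 : 0 < t -> 0 < s0 -> exists2 y, 0 < y < s0 & mass U om y <= t.
Proof.
have [G [GU G0]] := ultraFilterLemma (at_right_proper_filter (0 : R)).
have GP : ProperFilter G by exact: ultra_proper.
have GF : Filter G by exact _.
have pos s1 : 0 < s1 -> \forall s \near G, 0 < s < s1.
  move=> s10; apply: G0; near=> s; apply/andP; split.
    by near: s; exact: nbhs_right_gt.
  by near: s; exact: nbhs_right_lt.
pose l p := lim (sel p s @[s --> G]).
have lP p : unit_valued p -> sel p s @[s --> G] --> l p.
  move=> up; apply: (@ultra_bounded_cvg _ _ _ C1) => //.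
  apply: filterS (pos 1 ltr01) => s /andP[s00 _].
  rewrite ger0_norm ?sel_ge0// -[C1]mul1r; apply: sel_le => // x _.
  by have [_ /(_ x)/andP[]] := up.
pose K := `[x0 - r / 2, x0 + r / 2]%classic : set R.
have x0K : K x0 by rewrite /K /= in_itv/= gerBl lerDl; have := r0; lra.
have l_le p z : unit_valued p -> (\forall s \near G, sel p s <= z) -> l p <= z.
  by move=> up pb; apply: limr_le => //; apply/cvg_ex; exists (l p); exact: lP.
have lmM p q : unit_valued p -> unit_valued q ->
    l (fun x => Num.min (p x) (q x)) + l (fun x => Num.max (p x) (q x)) = l p + l q.
  move=> up uq; have um := unit_valued_min up uq; have uM := unit_valued_max up uq.
  have h1 := cvgD (lP _ um) (lP _ uM); have h2 := cvgD (lP _ up) (lP _ uq).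
  rewrite -(cvg_lim (@Rhausdorff R) (h2 GF)); apply/esym/(cvg_lim (@Rhausdorff R)).
  apply: cvg_trans (h1 GF); apply: near_eq_cvg; apply: filterS (pos 1 ltr01) => s /andP[s00 _].
  rewrite -[LHS](massD hU)//; [|exact: sel_tame|exact: sel_tame].
  rewrite -[RHS](massD hU)//; [|exact: sel_tame|exact: sel_tame].
  congr (mass U _ s); apply/funext => x; rewrite -!mulrDl; congr (_ * _).
  by rewrite addrC addr_max_min.
have lK p z : unit_valued p -> (forall x, K x -> p x <= z) -> l p <= z * C1.
  move=> up pb; apply: l_le => //; apply: filterS (pos 1 ltr01) => s /andP[s00 _].
  apply: sel_le => //; rewrite (le_trans _ (pb _ x0K))//.
  by have [_ /(_ x0)/andP[]] := up.
have [Cf Cf0 far] := far_average.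
have pi0 : 0 <= (pi : R) := pi_ge0 R.
have main e : 0 < e -> th * l (fun=> 1) <= e * (KG + C1 + 2).
  move=> e0.
  have [||n nP] := @functional_egorov R l (fun n => ~` flat e n.+1%:R^-1) K C1 e
      (@segment_compact _ _ _) C10 lmM lK _ _ e0.
  - move=> n; apply: subsetC; apply: flat_mono.
    by rewrite lef_pV2 ?posrE// ler_nat.
  - move=> x; have [m m0 mx] := flat_ex x e0.
    exists (Num.truncn m^-1); apply; apply: flat_mono mx.
    by rewrite invf_ple ?posrE// ltW// truncnS_gt.
  set h := n.+1%:R^-1 in nP; have h0 : 0 < h by rewrite invr_gt0.
  pose Q := C1 * (2 * pi) / (rho * e) + Cf / rho.
  have Q0 : 0 <= Q.
    apply: addr_ge0; last by apply: divr_ge0 => //; exact: ltW.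
    by apply: divr_ge0; [apply: mulr_ge0 => //; exact: mulr_ge0|apply/ltW/mulr_gt0].
  have Q1 : 0 < Q + 1 by lra.
  pose d1 := Num.min h (Num.min rho (e / (Q + 1))).
  have d10 : 0 < d1 by rewrite !lt_min h0 rho0 divr_gt0.
  suff step d : 0 < d < d1 -> mass U om d <= (1 - th) * l (fun=> 1) + e * (KG + C1 + 2).
    have : l (fun=> 1) <= (1 - th) * l (fun=> 1) + e * (KG + C1 + 2); last lra.
    apply: l_le => //; apply: filterS (pos d1 d10) => s sd.
    by rewrite selE; exact: step.
  rewrite !lt_min => /andP[d0 /and3P[dh drho dQ]].
  pose D := [set x | exists2 a, flat e h a & `|x - a| < c0 * d].
  have mD : measurable D by exact: near_measurable.
  rewrite (mass_split hU d0 mD om_tame).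
  have good : mass U (fun x => \1_D x * om x) d <= e * KG.
    apply: (flat_mass (n := h)) => //; first by rewrite d0.
    - exact: indic_tame.
    - move=> x; rewrite indicE; case: (_ \in _); rewrite ?mul1r ?mul0r ?lexx ?ler01//.
      by rewrite om_ge0 om_le1.
    - move=> x; rewrite indicE; have [Dx|Dx] := pselect (D x); last first.
        by rewrite memNset// mul0r eqxx.
      rewrite mem_set// mul1r => ox; split => //; rewrite ltW// (lt_le_trans _ r1)//.
      rewrite ltNge; apply: contra ox => rx; rewrite /om tent_out//.
      by rewrite (le_trans _ rx)//; have := r0; lra.
  set w := fun x => \1_(~` D) x * om x.
  have tw : tame w by apply: indic_tame => //; exact: measurableC.
  have w01 x : 0 <= w x <= om x.
    by rewrite /w indicE; case: (_ \in _); rewrite ?mul1r ?mul0r ?lexx om_ge0.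
  have w0 x : 0 <= w x by case/andP: (w01 x).
  have [b [tb bw wE]] := mass_avg hU d0 tw w0.
  have cd0 : 0 < c0 * d / 2 by rewrite divr_gt0// mulr_gt0.
  have [p [up pK p1]] := separating_function (flat e h) cd0.
  have lp : l p <= e.
    by apply: nP => // x Ox; apply: pK; apply: contrapT.
  have [Wt [Wy [Wtt hW]]] := bharmonic_scaled_mean hU rho0 tb.
  have dr0 : 0 < d / rho by rewrite divr_gt0.
  have dF := bh_y hW 0 dr0.
  have wF : avg U b 0 d = avg U b (rho * 0) (rho * (d / rho)).
    by rewrite mulr0 mulrC divfK// gt_eqF.
  have bom x : `|b x| <= om x by rewrite bw; case/andP: (w01 x).
  have bad : mass U w d <= l p + (1 - th) * l (fun=> 1)
      + C1 * (e + 2 * pi * (d / rho) / e) + Cf * (d / rho).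
    rewrite wE wF; apply: le_trans (ler_norm _) _.
    apply: frequent_limit_le dF _ => t' s1 t'0 s10.
    have t'2 : 0 < t' / 2 by rewrite divr_gt0.
    have m0 : 0 < rho * Num.min s1 1 by rewrite mulr_gt0// lt_min s10 ltr01.
    have := lP _ up => /cvgrPdist_le/(_ _ t'2) n1.
    have := lP _ one_uv => /cvgrPdist_le/(_ _ t'2) n2.
    have [u [[u1 u2] /andP[u0 um]]] := filter_ex (filterI (filterI n1 n2) (pos _ m0)).
    have ur : rho * (u / rho) = u by rewrite mulrC divfK// gt_eqF.
    move: um; rewrite mulrC -ltr_pdivrMr// lt_min => /andP[us1 u11].
    have ur0 : 0 < u / rho by rewrite divr_gt0.
    exists (u / rho); first by rewrite ur0.
    have := far (flat e h) d e p b (u / rho); rewrite ur => {}far.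
    rewrite mulr0 (le_trans (far _ _ _ _ _ _ _ _))//; [by rewrite d0 ltW|by rewrite ur0 ltW| |].
      move=> x bx a fa; rewrite leNgt; apply/negP => xa.
      have Dx : D x by exists a.
      by move: bx; rewrite -normr_eq0 bw /w indicE memNset ?mul0r ?eqxx//= => /(_ Dx).
    have h1 : sel p u <= l p + t' / 2.
      exact: ler_distlCDr.
    have h2 : sel (fun=> 1) u <= l (fun=> 1) + t' / 2.
      exact: ler_distlCDr.
    have th1 : 0 <= 1 - th by rewrite subr_ge0.
    have h3 := ler_wpM2l th1 h2.
    have h4 : (1 - th) * (t' / 2) <= t' / 2.
      by rewrite ler_piMl ?(ltW t'2)// lerBlDr lerDl ltW.
    apply: (@le_trans _ _ (l p + t' / 2 + ((1 - th) * l (fun=> 1) + t' / 2)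
        + C1 * (e + 2 * pi * (d / rho) / e) + Cf * (d / rho))).
      by rewrite !lerD2r lerD// (le_trans h3)// mulrDr lerD2l.
    by apply: eq_ler; field; rewrite !gt_eqF.
  have small : C1 * (2 * pi * (d / rho) / e) + Cf * (d / rho) <= e.
    rewrite [leLHS](_ : _ = d * Q); last first.
      by rewrite /Q; field; rewrite !gt_eqF.
    rewrite (@le_trans _ _ (d * (Q + 1)))//; first by rewrite ler_wpM2l ?(ltW d0)// lerDl.
    by rewrite -ler_pdivlMr// ltW.
  move: good bad small; rewrite mulrDr; lra.
have l10 : l (fun=> 1) <= 0.
  rewrite leNgt; apply/negP => l1.
  have B0 : 0 < KG + C1 + 2 by rewrite ltr_wpDl ?addr_ge0.
  have tl : 0 < th * l (fun=> 1) by rewrite mulr_gt0.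
  have e0 : 0 < th * l (fun=> 1) / (2 * (KG + C1 + 2)) by rewrite divr_gt0// mulr_gt0.
  have := main _ e0.
  have -> : th * l (fun=> 1) / (2 * (KG + C1 + 2)) * (KG + C1 + 2) = th * l (fun=> 1) / 2.
    by field; rewrite gt_eqF.
  lra.
move=> t0 s00.
have := lP _ one_uv => /cvgrPdist_le/(_ _ t0) n1.
have [u [u1 us]] := filter_ex (filterI n1 (pos _ s00)).
exists u => //; rewrite -selE.
by rewrite (le_trans (ler_distlCDr u1))// gerDr.
Unshelve. all: end_near. Qed.

(** Along heights at which the mass near the point tends to zero, the integral
    in [poisson_cut_reproduction] disappears, and the error, linear in the
    height, is all that remains. *)
Lemma lin_vanish_point : lin_vanish U x0.
Proof.
have [Cl Cl0 hl] := poisson_cut_reproduction R j.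
have pi0 : 0 <= (pi : R) := pi_ge0 R.
pose q := r / 8; have q0 : 0 < q by rewrite divr_gt0.
have q1 : q <= 1 by rewrite /q; have := r1; lra.
pose N := Ag * q ^- E.
have qE : 0 <= q ^- E by rewrite invr_ge0 exprn_ge0// ltW.
have N0 : 0 <= N by exact: mulr_ge0.
have CN0 : 0 <= Cl * N / q by rewrite divr_ge0 ?mulr_ge0// ltW.
exists (Cl * N / q + q^-1); first by rewrite ltr_wpDl ?invr_gt0.
have Ci : (Cl * N / q + q^-1)^-1 <= q.
  by rewrite invf_ple ?posrE ?ltr_wpDl ?invr_gt0// lerDr.
move=> x d xd /andP[d0 dq]; have {}xd := lt_le_trans xd Ci; have {}dq := lt_le_trans dq Ci.
pose e := d / q; have e0 : 0 < e by rewrite divr_gt0.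
have e1 : e <= 1 by rewrite ler_pdivrMr// mul1r ltW.
have qe : q * e = d by rewrite /e mulrC divfK// gt_eqF.
have hW := bharmonic_affine x q0 hU.
have gW : growth (fun v y => U (x + q * v) (q * y)) N 0 E.
  move=> v y /andP[y0 y1]; have qy0 : 0 < q * y by rewrite mulr_gt0.
  have qy1 : q * y <= 1 by rewrite mulr_ile1// ltW.
  rewrite expr0 mulr1 (le_trans (gU _ qy0))// blow1_small ?qy0//.
  by rewrite /N exprMn invfM mulrA.
have e01 : 0 < e <= 1 by rewrite e0.
rewrite (@le_trans _ _ (Cl * N * e))//; last first.
  have -> : Cl * N * e = Cl * N / q * d by rewrite /e mulrA mulrAC.
  by rewrite mulrDl lerDl mulr_ge0 ?invr_ge0// ltW.
have dF := bh_y hW 0 e0.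
have -> : U x d = U (x + q * 0) (q * e) by rewrite mulr0 addr0 qe.
apply: frequent_limit_le dF _ => t s0 t0 s00.
have pe0 : 0 < pi * e * q * (r / 4).
  apply: mulr_gt0; last exact: divr_gt0.
  by apply: mulr_gt0 => //; apply: mulr_gt0 => //; exact: pi_gt0.
have tq0 : 0 < t * (pi * e * q * (r / 4)) by rewrite mulr_gt0.
have qs0 : 0 < q * Num.min s0 1 by rewrite mulr_gt0// lt_min s00 ltr01.
have [u /andP[u0 um] mu] := mass_vanishes tq0 qs0.
move: um; rewrite mulrC -ltr_pdivrMr// lt_min => /andP[us1 u11].
pose s := u / q; have s1 : 0 < s by rewrite divr_gt0.
exists s; first by rewrite s1.
have s01 : 0 < s <= 1 by rewrite s1 ltW.
have qs : q * s = u by rewrite /s mulrC divfK// gt_eqF.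
have [tz err] := hl _ _ _ _ N e s hW N0 gW s01 e01; rewrite qs in err.
have zeta : `|intR (fun v => U (x + q * v) u * poisson_cut j e v)| <= t.
  have tm := mass_tame hU u0 om_tame.
  pose H z := `|U (x + z) u| * om (x + z).
  have HE : intR H = mass U om u.
    rewrite /mass -(intR_shift x tm); congr intR; apply/funext => z.
    by rewrite /H addrC.
  have cH : continuous H.
    have cU : continuous (fun z => U z u) by apply: (is_derive_continuous (f' := fun z => Ut z u)) => z; exact: (bh_t hU).
    have cx : continuous (fun z : R => x + z) by move=> z; apply: cvgD; [exact: cvg_cst|exact: cvg_id].
    move=> z; apply: cvgM.
      apply: cvg_norm; apply: (@continuous_comp _ _ _ (fun z : R => x + z) (fun z => U z u)); [exact: cx|exact: cU].
    by apply: (@continuous_comp _ _ _ (fun z : R => x + z) om); [exact: cx|exact: continuous_tent].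
  have H0 z : 0 <= H z by rewrite mulr_ge0.
  have IH : intR (fun v => H (q * v) * q) = mass U om u by rewrite intR_scale.
  have Hq v : 1 <= `|v / 6| -> H (q * v) * q = 0.
    rewrite normrM normfV (gtr0_norm (_ : 0 < 6 :> R))// ler_pdivlMr// mul1r => v6.
    rewrite /H /om tent_out ?mulr0 ?mul0r//.
    have : `|q * v| = q * `|v| by rewrite normrM (gtr0_norm q0).
    have : q * 6 <= q * `|v| by rewrite ler_wpM2l// ltW.
    have := ler_normB (x + q * v - x0) (x - x0).
    have -> : x + q * v - x0 - (x - x0) = q * v by ring.
    move: xd; have := r0; rewrite /q; lra.
  have [KU UK] := bh_bd hU u0.
  have tH : tame (fun v => H (q * v) * q).
    have tb := tame_cauchy (KU * q * 37).
    apply: le_tame tb.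
      apply: continuous_measurable_fun => v; apply: cvgMl.
      apply: (@continuous_comp _ _ _ (fun v : R => q * v) H); last exact: cH.
      by apply: cvgMr; exact: cvg_id.
    move=> v; have [h|h] := leP 1 `|v / 6|.
      rewrite Hq// normr0 mulr_ge0 ?invr_ge0 ?(ltW (oneDsqr_gt0 _))// mulr_ge0// mulr_ge0 ?(ltW q0)//.
      by rewrite (le_trans (normr_ge0 (U 0 u)))//; have [] := UK 0 u (lexx _).
    have v37 : 1 <= 37 * (1 + v ^+ 2)^-1.
      rewrite ler_pdivlMr ?oneDsqr_gt0// mul1r.
      have : (v / 6) ^+ 2 <= 1 by rewrite -(real_normK (num_real _)) exprn_ile1// ltW.
      by rewrite exprMn exprVn; lra.
    have K0 : 0 <= KU by rewrite (le_trans (normr_ge0 (U 0 u)))//; have [] := UK 0 u (lexx _).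
    have HK : `|H (q * v) * q| <= KU * q.
      rewrite normrM (gtr0_norm q0) ler_wpM2r ?(ltW q0)// ger0_norm// /H.
      by rewrite -[leRHS]mulr1 ler_pM//; have [] := UK (x + q * v) u (lexx _).
    by rewrite (le_trans HK)// -mulrA ler_peMr// mulr_ge0// ltW.
  have -> : t = (pi * e * q * (r / 4))^-1 * (t * (pi * e * q * (r / 4))).
    by rewrite mulrC mulfK// gt_eqF.
  have pi00 : 0 <= (pi * e * q * (r / 4))^-1 by rewrite invr_ge0 ltW.
  apply: le_trans (ler_wpM2l pi00 mu); rewrite -IH -intRZ//.
  apply: intR_norm_le; [by rewrite -qs; exact: tz|exact: tameZ|].
  move=> v; have [z0 z1 z2] := poisson_cut_bounds j v e0.
  have [v1|v1] := leP 1 `|v|.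
    by rewrite z2// mulr0 normr0 mulr_ge0// mulr_ge0 ?(ltW q0).
  have pe : 0 < pi * e by apply: mulr_gt0 => //; exact: pi_gt0.
  have cP : poisson_cut j e v <= (pi * e)^-1.
    rewrite (le_trans z1)// /poisson ler_pdivrMr ?mulr_gt0 ?pi_gt0 ?sqD_gt0//.
    rewrite ler_pdivlMl// -mulrA ler_wpM2l//.
    by rewrite -expr2 lerDr sqr_ge0.
  have omv : r / 4 <= om (x + q * v).
    rewrite /om /tent le_max; apply/orP; right.
    have : `|q * v| <= q by rewrite normrM (gtr0_norm q0) ler_piMr ?(ltW q0)// ltW.
    have := ler_normD (x - x0) (q * v).
    have -> : x - x0 + q * v = x + q * v - x0 by ring.
    move: xd; rewrite /q; lra.
  rewrite normrM (ger0_norm z0) /H.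
  have -> : (pi * e * q * (r / 4))^-1 * (`|U (x + q * v) u| * om (x + q * v) * q) =
     `|U (x + q * v) u| * ((pi * e)^-1 * (om (x + q * v) / (r / 4))).
    have pn : (pi : R) != 0 by rewrite gt_eqF// pi_gt0.
    have en := lt0r_neq0 e0; have qn := lt0r_neq0 q0; have rn := lt0r_neq0 r0.
    by move: (pi : R) pn => P pn; field; rewrite ?pn ?en ?qn ?rn.
  rewrite ler_wpM2l// (le_trans cP)// ler_peMr//; first by rewrite invr_ge0 ltW.
  by rewrite ler_pdivlMr ?mul1r// divr_gt0.
by rewrite [leRHS]addrC; exact: norm_le2 err zeta.
Qed.

End concentration.

(** * Uniqueness in the half-plane *)

Section half_plane.
Variables (R : realType) (U Ut Uy Utt : R -> R -> R) (j : nat) (Ag : R).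
Hypothesis hU : bharmonic U Ut Uy Utt.
Hypothesis Ag0 : 0 <= Ag.
Let E := j.*2.+1.
Hypothesis gU : forall x y, 0 < y -> `|U x y| <= Ag * blow E 1 y.
Variables (G : R -> R -> R) (c0 KG : R).
Hypothesis c00 : 0 < c0.
Hypothesis G0 : forall x y, 0 < y -> 0 <= G x y.
Hypothesis mG : forall y, 0 < y -> measurable_fun setT (G^~ y).
Hypothesis intG : forall a y, 0 < y ->
  (\int[@lebesgue_measure R]_(x in `[(a - 1)%R, (a + 1)%R]) (G x y)%:E <= KG%:E)%E.
Implicit Types (a e n x y : R) (w : R -> R).

(** The cone over [a] plays the part of a Stolz region, and [e] bounds, in this
    cone, the factor of [U] that tends to zero. *)
Definition flat e n : set R :=
  [set a | forall x y, `|x - a| < c0 * y -> 0 < y < n -> `|U x y| <= e * G x y].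

Hypothesis flat_ex : forall e x, 0 < e -> exists2 n : R, 0 < n & flat e n x.

Lemma flat_mono e n n' : n' <= n -> flat e n `<=` flat e n'.
Proof. by move=> nn a fa x y xa /andP[y0 yn]; apply: fa; rewrite // y0 (lt_le_trans yn). Qed.

Lemma flat_closed e n a : ~ flat e n a ->
  exists2 r : R, 0 < r & forall a', `|a' - a| < r -> ~ flat e n a'.
Proof.
move=> /existsNP[x /existsNP[y /not_implyP[xa /not_implyP[yn Uxy]]]].
exists (c0 * y - `|x - a|); first by rewrite subr_gt0.
move=> a' aa' /(_ x y) h; apply: Uxy; apply: h => //.
have -> : x - a' = (x - a) - (a' - a) by ring.
have := ler_normB (x - a) (a' - a); lra.
Qed.

Lemma intG_ge0 : 0 <= KG.
Proof.
have := intG 0 ltr01; rewrite -lee_fin; apply: le_trans.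
by apply: integral_ge0 => x _; rewrite lee_fin G0.
Qed.

(** Where [w] does not vanish, [|U|] is at most [e * G]. *)
Lemma flat_mass x0 e n y w : 0 < e -> 0 < y < n -> tame w -> (forall x, 0 <= w x <= 1) ->
  (forall x, w x != 0 -> `|x - x0| <= 1 /\ exists2 a, flat e n a & `|x - a| < c0 * y) ->
  mass U w y <= e * KG.
Proof.
move=> e0 yn tw w01 wn; have /andP[y0 _] := yn.
have tm := mass_tame hU y0 tw; have im := tame_integrable tm.
rewrite -lee_fin /mass /intR /Rintegral fineK; last exact: integrable_fin_num im.
pose D := `[x0 - 1, x0 + 1]%classic : set R.
have mGe : measurable_fun setT (fun x => (e * G x y)%:E).
  by apply/measurable_EFinP; apply: measurable_funM => //; exact: mG.
rewrite (@le_trans _ _ (\int[lebesgue_measure]_(x in D) (e * G x y)%:E)%E)//.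
  rewrite [leRHS]integral_mkcond; apply: ge0_le_integral => //.
  - by move=> x _; rewrite lee_fin mulr_ge0//; have /andP[] := w01 x.
  - by apply/measurable_EFinP; case: tm.
  - apply/(measurable_restrict _ _ _).1 => //.
      exact: measurable_itv.
    by rewrite setTI; apply: measurable_funTS.
  - move=> x _; have [wx|wx] := eqVneq (w x) 0.
      rewrite wx mulr0 /patch; case: ifP => // _.
      by rewrite lee_fin mulr_ge0 ?G0 ?ltW.
    have [xx0 [a fa xa]] := wn x wx.
    rewrite /patch mem_set; last by rewrite /D /= in_itv/= -ler_distl.
    have /andP[w0 w1] := w01 x.
    rewrite lee_fin (@le_trans _ _ `|U x y|)//; first by rewrite ler_piMr.
    exact: fa.
under eq_integral do rewrite EFinM.
rewrite ge0_integralZl_EFin//=.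
- rewrite EFinM lee_wpmul2l//; first by rewrite lee_fin ltW.
  exact: intG.
- exact: measurable_itv.
- by move=> x _; rewrite lee_fin G0.
- by apply/measurable_EFinP; apply: measurable_funTS; exact: mG.
- exact: ltW.
Qed.

(** Baire's theorem. The cones over each point of the line have some height, and
    those of a given height are found over a closed set of points; nested
    intervals centred in [S] therefore do as well as a closed set [S]. *)
Lemma flat_portion (S : set R) : S !=set0 -> exists x0 r n : R,
  [/\ S x0, 0 < r <= 1, 0 < n & forall a, S a -> `|a - x0| <= 2 * r -> flat 1 n a].
Proof.
move=> [p0 Sp0]; apply: contrapT => H.
pose P (p : R * R) := S p.1 /\ 0 < p.2 <= 1.
have /choice[step stepP] : forall kp : nat * (R * R), exists q : R * R, P kp.2 ->
    [/\ P q, `|q.1 - kp.2.1| + q.2 <= kp.2.2 &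
     forall z, `|z - q.1| <= q.2 -> ~ flat 1 kp.1.+1%:R^-1 z].
  move=> [k [a r]] /=; have [[/= Sa /andP[r0 r1]]|nP] := pselect (P (a, r)); last by exists (a, r).
  have [b [Sb ba nb]] : exists b, [/\ S b, `|b - a| <= r / 2 & ~ flat 1 k.+1%:R^-1 b].
    apply: contrapT => h; apply: H; exists a, (r / 4), k.+1%:R^-1; split => //.
    - by apply/andP; split; lra.
    - move=> b Sb ba; apply: contrapT => fb; apply: h; exists b; split => //; lra.
  have [s s0 hs] := flat_closed nb.
  exists (b, Num.min (s / 2) (r / 2)) => _ /=.
  have m0 : 0 < Num.min (s / 2) (r / 2) by rewrite lt_min; apply/andP; split; lra.
  have m1 : Num.min (s / 2) (r / 2) <= s / 2 by rewrite ge_min lexx.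
  have m2 : Num.min (s / 2) (r / 2) <= r / 2 by rewrite ge_min lexx orbT.
  split; [by split => //=; apply/andP; split; lra|by rewrite /=; lra|].
  by move=> z /= zb; apply: hs; lra.
pose f := fix f k := if k is k'.+1 then step (k', f k') else (p0, 1 : R).
have fP k : P (f k).
  elim: k => [|k IH]; first by split => //=; rewrite ltr01 lexx.
  by have [] := stepP (k, f k) IH.
have fS k : `|(f k.+1).1 - (f k).1| + (f k.+1).2 <= (f k).2.
  by have [] := stepP (k, f k) (fP k).
have fN k z : `|z - (f k.+1).1| <= (f k.+1).2 -> ~ flat 1 k.+1%:R^-1 z.
  by have [_ _] := stepP (k, f k) (fP k); apply.
have fle k m : (k <= m)%N -> `|(f m).1 - (f k).1| + (f m).2 <= (f k).2.
  elim: m => [|m IH]; first by rewrite leqn0 => /eqP ->; rewrite subrr normr0 add0r.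
  rewrite leq_eqVlt => /orP[/eqP ->|/IH h]; first by rewrite subrr normr0 add0r.
  have := fS m.
  have -> : (f m.+1).1 - (f k).1 = ((f m.+1).1 - (f m).1) + ((f m).1 - (f k).1) by ring.
  have := ler_normD ((f m.+1).1 - (f m).1) ((f m).1 - (f k).1); lra.
pose T := [set (f k).1 - (f k).2 | k in [set: nat]].
have Tub k : ubound T ((f k).1 + (f k).2).
  move=> _ [m _ <-].
  have [_ /andP[/= fk0 _]] := fP k; have [_ /andP[/= fm0 _]] := fP m.
  have [km|/ltnW mk] := leqP k m.
    have := fle k m km; have := ler_norm ((f m).1 - (f k).1); lra.
  have := fle m k mk; have := ler_norm (- ((f k).1 - (f m).1)); rewrite normrN; lra.
pose z := sup T.
have zk k : `|z - (f k).1| <= (f k).2.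
  rewrite ler_distl; apply/andP; split.
    by apply: ub_le_sup; [exists ((f 0%N).1 + (f 0%N).2); exact: Tub|exists k].
  by apply: ge_sup; [exists ((f 0%N).1 - (f 0%N).2); exists 0%N|exact: Tub].
have [n n0 fz] := flat_ex z ltr01.
apply: (fN (Num.truncn n^-1) z (zk _)); apply: flat_mono fz.
by rewrite invf_ple ?posrE// ltW// truncnS_gt.
Qed.

(** On the portion of the exceptional set given by [flat_portion], the mass is
    bounded by [mass_bounded], and then [lin_vanish_point] shows that the centre
    of the portion is not exceptional. *)
Lemma lin_vanish_everywhere x : lin_vanish U x.
Proof.
apply: contrapT => xS.
have [x0 [r [n [Sx0 r01 n0 Sn]]]] := @flat_portion (~` lin_vanish U) (ex_intro _ x xS).
have /andP[r0 r1] := r01.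
pose eta := Num.min n (r / c0).
have eta0 : 0 < eta by rewrite lt_min n0 divr_gt0.
have [C CP] : exists C : R, forall y, 0 < y ->
    mass U (fun x => tent r x0 x ^+ j.+1.*2) y <= C.
  apply: (@mass_bounded R U Ut Uy Utt j Ag x0 r hU Ag0 gU r01 (~` lin_vanish U) c0 eta (1 * KG)) => //.
    move=> y w /andP[y0]; rewrite lt_min => /andP[yn yr] tw w01 wn.
    have yc : c0 * y < r by rewrite mulrC -ltr_pdivlMr.
    apply: (@flat_mass x0 _ n) => //; first by rewrite y0.
      move=> z; have /andP[w0 w1] := w01 z; rewrite w0/= (le_trans w1)//.
      by rewrite exprn_ile1 ?tent_ge0// (le_trans (tent_le _ _ _))// ltW.
    move=> z wz; have [a Sa za] := wn z wz; have /andP[w0 w1] := w01 z.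
    have zr : `|z - x0| < r.
      rewrite ltNge; apply/negP => h; move: wz w1 w0; rewrite tent_out// doubleS expr0n/=.
      by move=> /eqP wz w1 w0; apply: wz; apply/eqP; rewrite eq_le w1.
    split; first lra.
    exists a => //; apply: Sn => //.
    have -> : a - x0 = (z - x0) - (z - a) by ring.
    by have := ler_normB (z - x0) (z - a); lra.
  by move=> z _ zS; apply: contrapT => nz; have := zS z nz; rewrite eqxx.
apply: Sx0; apply: (@lin_vanish_point R U Ut Uy Utt j Ag x0 r C hU Ag0 gU r01 CP c0 c00 flat KG).
- exact: intG_ge0.
- exact: flat_mono.
- exact: flat_ex.
- by move=> e m y w; exact: flat_mass.
Qed.

(** The integral in [poisson_cut_reproduction] tends to zero at every point, and
    the constant in the error does not depend on the point. *)
Lemma uniform_linear_bound : exists2 C : R, 0 <= C & forall x d, 0 < d <= 1 -> `|U x d| <= C * d.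
Proof.
have [Cl Cl0 hl] := poisson_cut_reproduction R j.
exists (Cl * Ag); first exact: mulr_ge0.
move=> x d d01; have /andP[d0 d1] := d01.
have hW := bharmonic_affine x ltr01 hU.
have gW : growth (fun v y => U (x + 1 * v) (1 * y)) Ag 0 E.
  move=> v y y01; have /andP[y0 _] := y01.
  by rewrite expr0 mulr1 (mul1r y) (le_trans (gU _ y0))// blow1_small.
have -> : U x d = U (x + 1 * 0) (1 * d) by rewrite mulr0 addr0 mul1r.
apply: right_limit_le (bh_y hW 0 d0) _ => t t0.
have sub : `[x - 1, x + 1]%classic `<=` lin_vanish U by move=> z _; exact: lin_vanish_everywhere.
have [s0 s00 hs] := lin_vanish_uniform (@segment_compact _ _ _) sub t0.
exists (Num.min s0 1); first by rewrite lt_min s00 ltr01.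
move=> s /andP[s1]; rewrite lt_min => /andP[ss0 s11].
have s01 : 0 < s <= 1 by rewrite s1 ltW.
have [tz err] := hl _ _ _ _ Ag d s hW Ag0 gW s01 d01.
rewrite [leRHS]addrC; apply: norm_le2 err _.
apply: cut_off_average => //; first exact: ltW.
move=> v v1; apply: hs; last by rewrite mul1r s1.
by rewrite /= in_itv/= -ler_distl mul1r addrAC subrr add0r ltW.
Qed.

(** The values at the height [y] are averages of those at the height [s], which
    are [O(s)]. *)
Lemma half_plane_uniqueness x y : 0 < y -> U x y = 0.
Proof.
move=> y0; have [C C0 UC] := uniform_linear_bound.
have hW := bharmonic_affine x ltr01 hU.
have -> : U x y = U (x + 1 * 0) (1 * y) by rewrite mulr0 addr0 mul1r.
apply/eqP; rewrite -normr_le0.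
apply: right_limit_le (bh_y hW 0 y0) _ => t t0.
exists (Num.min 1 (t / (C + 1))); first by rewrite lt_min ltr01 divr_gt0//; lra.
move=> s /andP[s0]; rewrite lt_min => /andP[s1 st].
have [tP _ _ _] := poisson_tame y0.
rewrite -(poisson_reproduction hW s0 y0) add0r.
have -> : t = intR (fun v => t * poisson y v) by rewrite intRZ// intR_poisson// mulr1.
apply: intR_norm_le; [exact: (bh_tame hW)|exact: tameZ|].
have Ct : C * s <= t.
  have : s * (C + 1) < t by rewrite -ltr_pdivlMr//; lra.
  by rewrite mulrDr mulr1 mulrC; lra.
move=> v; rewrite normrM (ger0_norm (poisson_ge0 _ y0)) ler_wpM2r ?poisson_ge0//.
by rewrite (mul1r s) (le_trans (UC _ _ _))// s0 ltW.
Qed.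

End half_plane.

(** * Calculus in the disc *)

Section plane_calculus.
Variable R : realType.
Implicit Types (z w : R * R) (v h : R * R -> R) (a b d e t x y r : R).

Lemma disc_sqr z : disc z <-> z.1 ^+ 2 + z.2 ^+ 2 < 1.
Proof.
have s0 : 0 <= z.1 ^+ 2 + z.2 ^+ 2 by rewrite addr_ge0 ?sqr_ge0.
have -> : disc z = (Num.sqrt (z.1 ^+ 2 + z.2 ^+ 2) < Num.sqrt 1 :> R) by rewrite sqrtr1.
by rewrite ltr_sqrt.
Qed.

Lemma continuous_sqr_norm : continuous (fun z => z.1 ^+ 2 + z.2 ^+ 2).
Proof.
move=> z; apply: cvgD.
  by apply: (@continuous_comp _ _ _ fst (fun x : R => x ^+ 2)); [exact: cvg_fst|exact: exprn_continuous].
by apply: (@continuous_comp _ _ _ snd (fun x : R => x ^+ 2)); [exact: cvg_snd|exact: exprn_continuous].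
Qed.

Lemma disc_box z : disc z -> exists2 d : R, 0 < d &
  forall w, `|w.1 - z.1| < d -> `|w.2 - z.2| < d -> disc w.
Proof.
move=> /disc_sqr z1.
have /cvgrPdist_lt/(_ (1 - (z.1 ^+ 2 + z.2 ^+ 2))) := @continuous_sqr_norm z.
rewrite subr_gt0 => /(_ z1); rewrite near_nbhs => /nbhs_ballP[d /= d0 dP].
exists d => // w w1 w2; apply/disc_sqr.
have /dP/= : ball z d w by split; rewrite /ball/= distrC.
by rewrite ltr_distl => /andP[]; lra.
Qed.

Lemma continuous_box h z e : {for z, continuous h} -> 0 < e -> exists2 d : R, 0 < d &
  forall w, `|w.1 - z.1| < d -> `|w.2 - z.2| < d -> `|h w - h z| <= e.
Proof.
move=> /cvgrPdist_le hz /hz; rewrite near_nbhs => /nbhs_ballP[d /= d0 dP].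
exists d => // w w1 w2; rewrite distrC; apply: dP.
by split; rewrite /ball/= distrC.
Qed.

Lemma box_continuous h z : (forall e, 0 < e -> exists2 d : R, 0 < d &
  forall w, `|w.1 - z.1| < d -> `|w.2 - z.2| < d -> `|h w - h z| <= e) -> {for z, continuous h}.
Proof.
move=> H; apply/cvgrPdist_le => e e0; have [d d0 dP] := H e e0.
exists (ball z.1 d, ball z.2 d); first by split; exact: nbhsx_ballx.
by move=> w [/= w1 w2]; rewrite distrC; apply: dP; rewrite distrC.
Qed.

Lemma partial1 v z : derivable v z (e1 R) -> is_derive z.1 (1 : R) (fun t => v (t, z.2)) ('D_(e1 R) v z).
Proof.
have E : (fun h : R => h^-1 *: (((fun t => v (t, z.2)) \o shift z.1) (h *: (1 : R)) - v (z.1, z.2)))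
    = (fun h : R => h^-1 *: ((v \o shift z) (h *: e1 R) - v z)).
  apply/funext => h /=; case: z => x y /=; congr (_ *: (v _ - _)).
  by congr (_, _); rewrite /= ?scaler0 ?add0r.
by move=> dz; apply: DeriveDef; rewrite /derivable /derive E.
Qed.

Lemma partial2 v z : derivable v z (e2 R) -> is_derive z.2 (1 : R) (fun t => v (z.1, t)) ('D_(e2 R) v z).
Proof.
have E : (fun h : R => h^-1 *: (((fun t => v (z.1, t)) \o shift z.2) (h *: (1 : R)) - v (z.1, z.2)))
    = (fun h : R => h^-1 *: ((v \o shift z) (h *: e2 R) - v z)).
  apply/funext => h /=; case: z => x y /=; congr (_ *: (v _ - _)).
  by congr (_, _); rewrite /= ?scaler0 ?add0r.
by move=> dz; apply: DeriveDef; rewrite /derivable /derive E.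
Qed.

Lemma segment_lipschitz (f f' : R -> R) k e a b :
  (forall t, `|t - a| <= `|b - a| -> is_derive t (1 : R) f (f' t)) ->
  (forall t, `|t - a| <= `|b - a| -> `|f' t - k| <= e) ->
  `|f b - f a - k * (b - a)| <= e * `|b - a|.
Proof.
move=> df fe.
pose F t := f t - k * t.
have dF t : `|t - a| <= `|b - a| -> is_derive t (1 : R) F (f' t - k).
  by move=> ht; apply: is_derive_eqv (dB (df t ht) (dM (dC k t) (dI t))) _; ring.
have -> : f b - f a - k * (b - a) = F b - F a by rewrite /F; ring.
have [ab|/ltW ba] := leP a b.
  rewrite (ger0_norm (_ : 0 <= b - a)) ?subr_ge0//.
  apply: (@is_derive_lipschitz R F (fun t => f' t - k)) => // t /andP[at_ tb].
    by apply: dF; rewrite !ger0_norm ?subr_ge0//; lra.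
  by apply: fe; rewrite !ger0_norm ?subr_ge0//; lra.
rewrite distrC (distrC b) (ger0_norm (_ : 0 <= a - b)) ?subr_ge0//.
apply: (@is_derive_lipschitz R F (fun t => f' t - k)) => // t /andP[bt ta].
  by apply: dF; rewrite (distrC t) (distrC b) !ger0_norm ?subr_ge0//; lra.
by apply: fe; rewrite (distrC t) (distrC b) !ger0_norm ?subr_ge0//; lra.
Qed.

(** Continuous partial derivatives give a first-order expansion: move along one
    axis and then along the other. *)
Lemma C1_expansion v z e : C1_on (@disc R) v -> disc z -> 0 < e -> exists2 d : R, 0 < d &
  forall w, `|w.1 - z.1| < d -> `|w.2 - z.2| < d ->
  `|v w - v z - ('D_(e1 R) v z * (w.1 - z.1) + 'D_(e2 R) v z * (w.2 - z.2))|
    <= e * (`|w.1 - z.1| + `|w.2 - z.2|).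
Proof.
move=> C1v Dz e0; have [_ _ c1 c2] := C1v z Dz.
have [d1 d10 D1] := disc_box Dz.
have [d2 d20 D2] := continuous_box c1 e0; have [d3 d30 D3] := continuous_box c2 e0.
exists (Num.min d1 (Num.min d2 d3)); first by rewrite !lt_min d10 d20.
move=> w; rewrite !lt_min => /and3P[w11 w12 w13] /and3P[w21 w22 w23].
have h1 : `|v (w.1, w.2) - v (z.1, w.2) - 'D_(e1 R) v z * (w.1 - z.1)| <= e * `|w.1 - z.1|.
  apply: (@segment_lipschitz (fun t => v (t, w.2)) (fun t => 'D_(e1 R) v (t, w.2))) => t ht.
    apply: (@partial1 v (t, w.2)).
    by have [] := C1v (t, w.2) (D1 (t, w.2) (le_lt_trans ht w11) w21).
  exact: (D2 (t, w.2) (le_lt_trans ht w12) w22).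
have z0 c : 0 < c -> `|z.1 - z.1| < c by rewrite subrr normr0.
have h2 : `|v (z.1, w.2) - v (z.1, z.2) - 'D_(e2 R) v z * (w.2 - z.2)| <= e * `|w.2 - z.2|.
  apply: (@segment_lipschitz (fun t => v (z.1, t)) (fun t => 'D_(e2 R) v (z.1, t))) => t ht.
    apply: (@partial2 v (z.1, t)).
    by have [] := C1v (z.1, t) (D1 (z.1, t) (z0 _ d10) (le_lt_trans ht w21)).
  exact: (D3 (z.1, t) (z0 _ d30) (le_lt_trans ht w23)).
rewrite [leRHS]mulrDr (le_trans _ (lerD h1 h2))// (le_trans _ (ler_normD _ _))//.
rewrite -!surjective_pairing; apply: eq_ler; congr Num.norm.
by rewrite /=; ring.
Qed.

Lemma C1_continuous v z : C1_on (@disc R) v -> disc z -> {for z, continuous v}.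
Proof.
move=> C1v Dz; apply: box_continuous => e e0.
have [d d0 dP] := C1_expansion C1v Dz ltr01.
pose k := 2 + `|'D_(e1 R) v z| + `|'D_(e2 R) v z|.
have k0 : 0 < k by rewrite /k ltr_wpDr// ltr_wpDr.
exists (Num.min d (e / k)); first by rewrite lt_min d0 divr_gt0.
move=> w; rewrite !lt_min => /andP[w1 w1e] /andP[w2 w2e].
have := dP w w1 w2; rewrite mul1r.
set p := 'D_(e1 R) v z in k k0 w1e w2e *; set q := 'D_(e2 R) v z in k k0 w1e w2e *.
set A := w.1 - z.1 in w1 w1e *; set B := w.2 - z.2 in w2 w2e *.
have hp : `|p * A| <= `|p| * (e / k) by rewrite normrM ler_wpM2l// ltW.
have hq : `|q * B| <= `|q| * (e / k) by rewrite normrM ler_wpM2l// ltW.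
have ek : e / k * 2 + `|p| * (e / k) + `|q| * (e / k) = e.
  have -> : e / k * 2 + `|p| * (e / k) + `|q| * (e / k) = e / k * k by rewrite {5}/k; ring.
  by rewrite divfK// gt_eqF.
have := ler_normD (v w - v z - (p * A + q * B)) (p * A + q * B); rewrite subrK.
have := ler_normD (p * A) (q * B).
lra.
Qed.

Lemma C1_partials v z : C1_on (@disc R) v -> disc z ->
  {for z, continuous (fun w => 'D_(e1 R) v w)} /\ {for z, continuous (fun w => 'D_(e2 R) v w)}.
Proof. by move=> C1v Dz; case: (C1v z Dz) => _ _ c1 c2; exact: (conj c1 c2). Qed.

Lemma is_derive_smallo (f : R -> R) t l : is_derive t (1 : R) f l -> forall e, 0 < e ->
  exists2 d : R, 0 < d & forall h : R, `|h| < d -> `|f (t + h) - f t - l * h| <= e * `|h|.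
Proof.
move=> [df <-] e e0.
have /cvgrPdist_le/(_ _ e0) : h^-1 *: ((f \o shift t) (h *: (1 : R)) - f t) @[h --> 0^'] --> 'D_1 f t by exact: df.
move=> [d /= d0 dP]; exists d => // h hd.
have [->|h0] := eqVneq h 0; first by rewrite addr0 subrr mulr0 subr0 normr0 mulr0.
have := dP h; rewrite /= sub0r normrN => /(_ hd h0).
rewrite [h *: 1]mulr1 [_ *: _]/(h^-1 * _) distrC.
rewrite -(ler_pM2r (_ : 0 < `|h|)) ?normr_gt0// -normrM mulrBl mulrAC mulVf// mul1r.
by rewrite (addrC h).
Qed.

Lemma smallo_is_derive (f : R -> R) t l : (forall e, 0 < e ->
  exists2 d : R, 0 < d & forall h : R, `|h| < d -> `|f (t + h) - f t - l * h| <= e * `|h|) ->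
  is_derive t (1 : R) f l.
Proof.
move=> H.
have c : h^-1 *: ((f \o shift t) (h *: (1 : R)) - f t) @[h --> 0^'] --> l.
  apply/cvgrPdist_le => e e0; have [d d0 dP] := H e e0.
  exists d => // h /=; rewrite sub0r normrN => hd h0.
  rewrite [h *: 1]mulr1 [_ *: _]/(h^-1 * _) distrC.
  rewrite -(ler_pM2r (_ : 0 < `|h|)) ?normr_gt0// -normrM mulrBl mulrAC mulVf// mul1r.
  by rewrite (addrC h) dP.
apply: DeriveDef; first by apply/cvg_ex; exists l.
exact: (cvg_lim (@Rhausdorff R) c).
Qed.

(** [C1_expansion] with an accuracy [c], small enough for the four error terms
    to add up to [e]. *)
Lemma is_derive_curve v (a b : R -> R) t a' b' : C1_on (@disc R) v -> disc (a t, b t) ->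
  is_derive t (1 : R) a a' -> is_derive t (1 : R) b b' ->
  is_derive t (1 : R) (fun s => v (a s, b s))
    (a' * 'D_(e1 R) v (a t, b t) + b' * 'D_(e2 R) v (a t, b t)).
Proof.
move=> C1v Dz da db; apply: smallo_is_derive => e e0.
set p := 'D_(e1 R) v _; set q := 'D_(e2 R) v _.
pose k := `|a'| + `|b'| + 2 + `|p| + `|q|.
have k0 : 0 < k by rewrite /k -!addrA ltr_wpDl// ltr_wpDl// ltr_wpDr// addr_ge0.
have e10 : 0 < Num.min 1 (e / k) by rewrite lt_min ltr01 divr_gt0.
have e11 : Num.min 1 (e / k) <= 1 by rewrite ge_min lexx.
have e1k : Num.min 1 (e / k) <= e / k by rewrite ge_min lexx orbT.
set c := Num.min _ _ in e10 e11 e1k.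
have [d1 d10 D1] := C1_expansion C1v Dz e10; rewrite /= -/p -/q in D1.
have [d2 d20 D2] := is_derive_smallo da e10; have [d3 d30 D3] := is_derive_smallo db e10.
have m0 : 0 < `|a'| + `|b'| + 1 by rewrite ltr_wpDl// addr_ge0.
exists (Num.min (d1 / (`|a'| + `|b'| + 1)) (Num.min d2 d3)).
  by rewrite !lt_min d20 d30 divr_gt0.
move=> h; rewrite !lt_min => /and3P[h1 h2 h3].
have A := D2 h h2; have B := D3 h h3; have n0 := normr_ge0 h.
have hd1 : `|h| * (`|a'| + `|b'| + 1) < d1 by rewrite -ltr_pdivlMr.
have na := normr_ge0 a'; have nb := normr_ge0 b'.
have ch : c * `|h| <= `|h| by rewrite ler_piMl.
have A1 : `|a (t + h) - a t| <= `|h| * (`|a'| + 1).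
  have := ler_normD (a (t + h) - a t - a' * h) (a' * h); rewrite subrK normrM; lra.
have B1 : `|b (t + h) - b t| <= `|h| * (`|b'| + 1).
  have := ler_normD (b (t + h) - b t - b' * h) (b' * h); rewrite subrK normrM; lra.
have hb : `|h| * `|b'| >= 0 by rewrite mulr_ge0.
have ha : `|h| * `|a'| >= 0 by rewrite mulr_ge0.
have C := D1 (a (t + h), b (t + h)) _ _; rewrite /= in C.
have {}C := C ltac:(by rewrite /=; lra) ltac:(by rewrite /=; lra).
set X := v _ - v _ in C *; set da' := a (t + h) - a t in A A1 C *; set db' := b (t + h) - b t in B B1 C *.
have -> : X - (a' * p + b' * q) * h = (X - (p * da' + q * db')) +
    (p * (da' - a' * h) + q * (db' - b' * h)) by ring.
have P1 : `|p * (da' - a' * h)| <= `|p| * (c * `|h|) by rewrite normrM ler_wpM2l.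
have Q1 : `|q * (db' - b' * h)| <= `|q| * (c * `|h|) by rewrite normrM ler_wpM2l.
have C2 : c * (`|da'| + `|db'|) <= c * (`|h| * (`|a'| + `|b'| + 2)).
  by rewrite ler_wpM2l ?(ltW e10)//; lra.
have fin : c * `|h| * k <= e * `|h|.
  have : c * k <= e by rewrite -ler_pdivlMr.
  by move=> /(ler_wpM2r n0); rewrite mulrAC.
have := ler_normD (X - (p * da' + q * db')) (p * (da' - a' * h) + q * (db' - b' * h)).
have := ler_normD (p * (da' - a' * h)) (q * (db' - b' * h)).
move: fin; rewrite /k; lra.
Qed.

End plane_calculus.

(** * Logarithmic polar coordinates *)

Section polar_harmonic.
Variable R : realType.
Implicit Types (z w : R * R) (a b d e t x y r : R).

(** The chain rule along curves in the disc: what the change of coordinates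
    requires of the gradient. *)
Definition curve_gradient (h h1 h2 : R * R -> R) :=
  forall (a b : R -> R) t a' b', disc (a t, b t) ->
  is_derive t (1 : R) a a' -> is_derive t (1 : R) b b' ->
  is_derive t (1 : R) (fun s => h (a s, b s)) (a' * h1 (a t, b t) + b' * h2 (a t, b t)).

Lemma C1_curve_gradient h : C1_on (@disc R) h ->
  curve_gradient h (fun z => 'D_(e1 R) h z) (fun z => 'D_(e2 R) h z).
Proof. by move=> C1h a b t a' b'; exact: is_derive_curve. Qed.

Lemma disc_polar x y : 0 < y -> disc (polar (expR (- y)) x).
Proof.
move=> y0; apply/disc_sqr; rewrite /= !exprMn -mulrDr cos2Dsin2 mulr1.
by rewrite exprn_ilt1 ?expR_ge0// expR_lt1 oppr_lt0.
Qed.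

Let c x y : R := expR (- y) * cos x.
Let s x y : R := expR (- y) * sin x.

Let dcx x y : is_derive x (1 : R) (c^~ y) (- s x y).
Proof.
apply: is_derive_eqv (dM (dC (expR (- y)) x) (is_derive_cos x)) _.
by rewrite /s; ring.
Qed.

Let dsx x y : is_derive x (1 : R) (s^~ y) (c x y).
Proof.
apply: is_derive_eqv (dM (dC (expR (- y)) x) (is_derive_sin x)) _.
by rewrite /c; ring.
Qed.

Let dey y : is_derive y (1 : R) (fun y => expR (- y)) (- expR (- y)).
Proof.
by apply: is_derive_eqv (dcomp (g := fun y => - y) (is_derive_expR (- y)) (dN (dI y))) _; ring.
Qed.

Let dcy x y : is_derive y (1 : R) (c x) (- c x y).
Proof.
apply: is_derive_eqv (dM (dey y) (dC (cos x) y)) _.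
by rewrite /c; ring.
Qed.

Let dsy x y : is_derive y (1 : R) (s x) (- s x y).
Proof.
apply: is_derive_eqv (dM (dey y) (dC (sin x) y)) _.
by rewrite /s; ring.
Qed.

Let P x y := polar (expR (- y)) x.

Definition polar_fun (h : R * R -> R) x y : R := h (P x y).

Let hx h h1 h2 x y : curve_gradient h h1 h2 -> 0 < y ->
  is_derive x (1 : R) (fun x => h (P x y)) (- s x y * h1 (P x y) + c x y * h2 (P x y)).
Proof. by move=> Ch y0; apply: (Ch (c^~ y) (s^~ y)) => //; exact: disc_polar. Qed.

Let hy h h1 h2 x y : curve_gradient h h1 h2 -> 0 < y ->
  is_derive y (1 : R) (fun y => h (P x y)) (- c x y * h1 (P x y) + - s x y * h2 (P x y)).
Proof. by move=> Ch y0; apply: (Ch (c x) (s x)) => //; exact: disc_polar. Qed.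

(** The image of the half-plane above the height [y0] lies in a compact subset
    of the disc. *)
Lemma bounded_polar (h : R * R -> R) y0 : (forall z, disc z -> {for z, continuous h}) ->
  0 < y0 -> exists2 K : R, 0 <= K & forall x y, y0 <= y -> `|h (P x y)| <= K.
Proof.
move=> ch y00; pose D := [set z : R * R | z.1 ^+ 2 + z.2 ^+ 2 <= expR (- y0) ^+ 2].
have e1 : expR (- y0) < 1 by rewrite expR_lt1 oppr_lt0.
have cD : compact D.
  apply: (@subclosed_compact (R * R)%type D (`[-1, 1]%classic `*` `[-1, 1]%classic)).
  - apply: (@preimage_closed _ _ (fun z : R * R => z.1 ^+ 2 + z.2 ^+ 2) [set u | u <= expR (- y0) ^+ 2]); last exact: closed_le.
    by move=> z _; exact: continuous_sqr_norm.
  - by apply: compact_setX; exact: segment_compact.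
  - have sq1 : expR (- y0) ^+ 2 <= 1 by rewrite exprn_ile1 ?expR_ge0// ltW.
    have H (a b : R) : a ^+ 2 + b ^+ 2 <= expR (- y0) ^+ 2 -> -1 <= a <= 1.
      move=> ab; rewrite -ler_norml -(@ler_pXn2r _ 2) ?nnegrE// expr1n real_normK ?num_real//.
      by have := sqr_ge0 b; lra.
    by move=> z Dz; split; rewrite /= in_itv/=; [exact: H Dz|apply: (H z.2 z.1); rewrite addrC].
move/compact_near_coveringP : cD => cD.
have /cD [] : forall z, D z -> \forall w \near z & K \near +oo, `|h w| <= K.
  move=> z Dz; have dz : disc z.
    by apply/disc_sqr/(le_lt_trans Dz); rewrite exprn_ilt1 ?expR_ge0.
  have [d d0 dP] := continuous_box (ch z dz) ltr01.
  exists ([set w : R * R | `|w.1 - z.1| < d /\ `|w.2 - z.2| < d], [set K : R | `|h z| + 1 <= K]); first split => /=.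
  - exists (ball z.1 d, ball z.2 d); first by split; exact: nbhsx_ballx.
    by move=> w [/= w1 w2]; split; rewrite distrC.
  - exact: nbhs_pinfty_ge.
  - move=> [w K] [/= [w1 w2] hK]; rewrite (le_trans _ hK)//.
    have := ler_normD (h w - h z) (h z); rewrite subrK; have := dP w w1 w2; lra.
move=> K [_ KP]; pose K1 := Num.max 0 (K + 1).
exists K1; first by rewrite le_max lexx.
have KK1 : K < K1 by rewrite lt_max; apply/orP; right; rewrite ltrDl.
move=> x y y0y; apply: (KP K1 KK1); rewrite /D /= !exprMn -mulrDr cos2Dsin2 mulr1.
by rewrite lerXn2r ?nnegrE ?expR_ge0// ler_expR lerN2.
Qed.

Let c_le x y : 0 < y -> `|c x y| <= 1.
Proof.
move=> y0; rewrite normrM ger0_norm ?expR_ge0// mulr_ile1 ?expR_ge0//.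
  by rewrite expR_le1 oppr_le0 ltW.
by rewrite ler_norml cos_geN1 cos_le1.
Qed.

Let s_le x y : 0 < y -> `|s x y| <= 1.
Proof.
move=> y0; rewrite normrM ger0_norm ?expR_ge0// mulr_ile1 ?expR_ge0//.
  by rewrite expR_le1 oppr_le0 ltW.
by rewrite ler_norml sin_geN1 sin_le1.
Qed.

Let term_le (a b u w K L : R) : `|a| <= L -> `|b| <= L -> `|u| <= K -> `|w| <= K ->
  `|a * u + b * w| <= 2 * L * K.
Proof.
move=> aL bL uK wK; rewrite (le_trans (ler_normD _ _))// !normrM -mulrA mulr_natl mulr2n.
by rewrite lerD// ler_pM.
Qed.

(** The change of coordinates is conformal, hence preserves the Laplace
    equation; derivatives in [y] carry a factor [e^(-y)], whence the decay at
    infinity. *)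
Lemma bharmonic_polar (v v1 v2 v11 v12 v21 v22 : R * R -> R) :
  curve_gradient v v1 v2 -> curve_gradient v1 v11 v12 -> curve_gradient v2 v21 v22 ->
  (forall z, disc z -> [/\ {for z, continuous v}, {for z, continuous v1} & {for z, continuous v2}]) ->
  (forall z, disc z -> {for z, continuous v11} /\ {for z, continuous v12}) ->
  (forall z, disc z -> {for z, continuous v21} /\ {for z, continuous v22}) ->
  (forall z, disc z -> v11 z + v22 z = 0) ->
  exists Ut Uy Utt : R -> R -> R, bharmonic (polar_fun v) Ut Uy Utt.
Proof.
move=> C1v C1v1 C1v2 cc0 cc1 cc2 Lv.
exists (fun x y => - s x y * v1 (P x y) + c x y * v2 (P x y)),
  (fun x y => - c x y * v1 (P x y) + - s x y * v2 (P x y)),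
  (fun x y => (- c x y * v1 (P x y) + - s x y * (- s x y * v11 (P x y) + c x y * v12 (P x y)))
    + (- s x y * v2 (P x y) + c x y * (- s x y * v21 (P x y) + c x y * v22 (P x y)))).
have cv z : disc z -> {for z, continuous v} by move=> /cc0[].
have cv1 z : disc z -> {for z, continuous v1} by move=> /cc0[].
have cv2 z : disc z -> {for z, continuous v2} by move=> /cc0[].
have cv11 z : disc z -> {for z, continuous v11} by move=> /cc1[].
have cv12 z : disc z -> {for z, continuous v12} by move=> /cc1[].
have cv21 z : disc z -> {for z, continuous v21} by move=> /cc2[].
have cv22 z : disc z -> {for z, continuous v22} by move=> /cc2[].
split.
- by move=> x y y0; exact: hx.
- by move=> x y y0; exact: hy.
- move=> x y y0.
  apply: is_derive_eqv (dD (dM (dN (dsx x y)) (hx x C1v1 y0)) (dM (dcx x y) (hx x C1v2 y0))) _.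
  by ring.
- move=> x y y0.
  apply: is_derive_eqv (dD (dM (dN (dcy x y)) (hy x C1v1 y0)) (dM (dN (dsy x y)) (hy x C1v2 y0))) _.
  have L : v22 (P x y) = - v11 (P x y).
    by apply/eqP; rewrite -addr_eq0 addrC; apply/eqP/Lv/disc_polar.
  by rewrite L; ring.
- move=> y0 y00.
  have [K K0 KP] := bounded_polar cv y00.
  have [K1 K10 KP1] := bounded_polar cv1 y00; have [K2 K20 KP2] := bounded_polar cv2 y00.
  have [K11 K110 KP11] := bounded_polar cv11 y00; have [K12 K120 KP12] := bounded_polar cv12 y00.
  have [K21 K210 KP21] := bounded_polar cv21 y00; have [K22 K220 KP22] := bounded_polar cv22 y00.
  pose L := K + K1 + K2 + K11 + K12 + K21 + K22.
  have L0 : 0 <= L by rewrite !addr_ge0.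
  exists (6 * L) => x y yy; have yp := lt_le_trans y00 yy.
  have k0 := le_trans (KP x y yy) (_ : K <= L).
  have k1 := le_trans (KP1 x y yy) (_ : K1 <= L); have k2 := le_trans (KP2 x y yy) (_ : K2 <= L).
  have k11 := le_trans (KP11 x y yy) (_ : K11 <= L); have k12 := le_trans (KP12 x y yy) (_ : K12 <= L).
  have k21 := le_trans (KP21 x y yy) (_ : K21 <= L); have k22 := le_trans (KP22 x y yy) (_ : K22 <= L).
  have {}k0 := k0 ltac:(rewrite /L; lra); have {}k1 := k1 ltac:(rewrite /L; lra).
  have {}k2 := k2 ltac:(rewrite /L; lra); have {}k11 := k11 ltac:(rewrite /L; lra).
  have {}k12 := k12 ltac:(rewrite /L; lra); have {}k21 := k21 ltac:(rewrite /L; lra).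
  have {}k22 := k22 ltac:(rewrite /L; lra).
  have cl := c_le x yp; have sl := s_le x yp.
  have cl' : `|- c x y| <= 1 by rewrite normrN.
  have sl' : `|- s x y| <= 1 by rewrite normrN.
  have one_mul a b : `|a| <= 1 -> `|b| <= 2 * L -> `|a * b| <= 2 * L.
    by move=> a1 bL; rewrite normrM -[leRHS]mul1r ler_pM.
  have one_mul' a b : `|a| <= 1 -> `|b| <= L -> `|a * b| <= L.
    by move=> a1 bL; rewrite normrM -[leRHS]mul1r ler_pM.
  have T1 := term_le sl' cl k11 k12; have T2 := term_le sl' cl k21 k22.
  rewrite mulr1 in T1 T2.
  split.
  + by rewrite (le_trans k0)//; lra.
  + by rewrite (le_trans (term_le sl' cl k1 k2))//; lra.
  + by rewrite (le_trans (term_le cl' sl' k1 k2))//; lra.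
  + rewrite (le_trans (ler_normD _ _))// (le_trans (lerD (ler_normD _ _) (ler_normD _ _)))//.
    have := one_mul _ _ sl' T1; have := one_mul _ _ cl T2.
    have := one_mul' _ _ cl' k1; have := one_mul' _ _ sl' k2; lra.
- move=> e e0.
  have [K1 K10 KP1] := bounded_polar cv1 ltr01; have [K2 K20 KP2] := bounded_polar cv2 ltr01.
  have K0 : 0 < 2 * (K1 + K2) + 1 by rewrite ltr_wpDl// mulr_ge0// addr_ge0.
  pose Y := Num.max 1 (- ln (e / (2 * (K1 + K2) + 1))).
  exists Y; first by rewrite lt_max ltr01.
  move=> x y Yy; have y1 : 1 <= y by rewrite (le_trans _ Yy)// le_max lexx.
  have ey : expR (- y) <= e / (2 * (K1 + K2) + 1).
    rewrite -[leRHS]lnK ?posrE ?divr_gt0// ler_expR lerNl (le_trans _ Yy)//.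
    by rewrite le_max lexx orbT.
  have cl : `|- c x y| <= expR (- y).
    by rewrite normrN normrM ger0_norm ?expR_ge0// ler_piMr ?expR_ge0// ler_norml cos_geN1 cos_le1.
  have sl : `|- s x y| <= expR (- y).
    by rewrite normrN normrM ger0_norm ?expR_ge0// ler_piMr ?expR_ge0// ler_norml sin_geN1 sin_le1.
  have h1 : `|v1 (P x y)| <= K1 + K2 by rewrite (le_trans (KP1 x y y1))// lerDl.
  have h2 : `|v2 (P x y)| <= K1 + K2 by rewrite (le_trans (KP2 x y y1))// lerDr.
  rewrite (le_trans (term_le cl sl h1 h2))//.
  rewrite -mulrA mulrCA (@le_trans _ _ (expR (- y) * (2 * (K1 + K2) + 1)))//.
    by rewrite ler_wpM2l ?expR_ge0// lerDl.
  by rewrite -ler_pdivlMr.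
Qed.

End polar_harmonic.

(** * Stolz regions in polar coordinates *)

Section periodic_polar.
Variable R : realType.
Implicit Types (r x y a b t phi theta : R).

Lemma polar_period r x (k : int) : polar r (x + k%:~R * (2 * pi)) = polar r x.
Proof.
have pE : 2 * pi = pi *+ 2 :> R by rewrite mulr2n; ring.
have H (n : nat) (z : R) : cos (z + n%:R * (2 * pi)) = cos z /\ sin (z + n%:R * (2 * pi)) = sin z.
  by rewrite mulr_natl pE; split; apply: periodicn; [exact: cosD2pi|exact: sinD2pi].
case: k => n; first by have [h1 h2] := H n x; rewrite /polar -pmulrn h1 h2.
have [h1 h2] := H n.+1 (x + (Negz n)%:~R * (2 * pi)).
have E : x + (Negz n)%:~R * (2 * pi) + n.+1%:R * (2 * pi) = x.
  by rewrite NegzE mulrNz -pmulrn; ring.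
by rewrite E in h1 h2; rewrite /polar h1 h2.
Qed.

Lemma polar_reduce x : exists k : int, 0 <= x - k%:~R * (2 * pi) < 2 * pi.
Proof.
have pi20 : 0 < 2 * pi :> R by rewrite mulr_gt0// pi_gt0.
exists (Num.floor (x / (2 * pi))); set k := Num.floor _.
have k1 : k%:~R <= x / (2 * pi) by exact: floor_le.
have k2 : x / (2 * pi) < (k + 1)%:~R by exact: floorD1_gt.
rewrite subr_ge0 -ler_pdivlMr// k1/=.
rewrite ltr_pdivrMr// intrD mulrDl mul1r in k2.
by rewrite ltrBlDl.
Qed.

Lemma cos_sin_lip x y : `|cos x - cos y| <= `|x - y| /\ `|sin x - sin y| <= `|x - y|.
Proof.
split; rewrite -[X in `|X| <= _]subr0 -[X in _ - X](mul0r (x - y)) -[leRHS]mul1r.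
  apply: (@segment_lipschitz R cos (fun t => - sin t)) => t _.
  by rewrite subr0 normrN ler_norml sin_geN1 sin_le1.
apply: (@segment_lipschitz R sin cos) => t _.
by rewrite subr0 ler_norml cos_geN1 cos_le1.
Qed.

Lemma polar_near x x' y : 0 < y -> `|(polar (expR (- y)) x').1 - (polar 1 x).1| <= y + `|x' - x| /\
  `|(polar (expR (- y)) x').2 - (polar 1 x).2| <= y + `|x' - x|.
Proof.
move=> y0; rewrite /= !mul1r; have [h1 h2] := cos_sin_lip x' x.
have e0 := expR_ge0 (- y); have e1 : expR (- y) <= 1 by rewrite expR_le1 oppr_le0 ltW.
have ey : 1 - expR (- y) <= y by have := expR_ge1Dx (- y); lra.
have H a b : `|a| <= 1 -> `|a - b| <= `|x' - x| -> `|expR (- y) * a - b| <= y + `|x' - x|.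
  move=> a1 ab; have -> : expR (- y) * a - b = - ((1 - expR (- y)) * a) + (a - b) by ring.
  rewrite (le_trans (ler_normD _ _))// lerD// normrN normrM (le_trans _ ey)//.
  by rewrite ger0_norm ?subr_ge0// ler_piMr// subr_ge0.
by split; apply: H => //; rewrite ler_norml ?cos_geN1 ?cos_le1 ?sin_geN1 ?sin_le1.
Qed.

Lemma normc_le a b : cmod (a +i* b)%C <= `|a| + `|b|.
Proof.
rewrite /cmod /=; have ab0 : 0 <= `|a| + `|b| by rewrite addr_ge0.
rewrite -[leRHS]ger0_norm// -sqrtr_sqr ler_wsqrtr// sqrrD !real_normK ?num_real//.
by rewrite addrAC lerDl mulrn_wge0// mulr_ge0.
Qed.

Lemma Re_le_normc (c : R[i]) : `|complex.Re c| <= cmod c.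
Proof. by case: c => a b; rewrite /cmod /= -sqrtr_sqr ler_wsqrtr// lerDl sqr_ge0. Qed.

Lemma Im_le_normc (c : R[i]) : `|complex.Im c| <= cmod c.
Proof. by case: c => a b; rewrite /cmod /= -sqrtr_sqr ler_wsqrtr// lerDr sqr_ge0. Qed.

(** As [cos (pi / 2 - theta) = sin theta], it is enough to bound the modulus,
    and it is at most [a + |b|]. *)
Lemma carg_sector theta a b : 0 < theta < pi / 2 -> 0 < a ->
  sin theta * `|b| <= (1 - sin theta) * a -> `|carg (a +i* b)%C| <= pi / 2 - theta.
Proof.
move=> /andP[t0 t1] a0 h; rewrite /carg; set q := _ / _.
have n0 : 0 < cmod (a +i* b)%C.
  by rewrite (lt_le_trans _ (Re_le_normc _))//= normr_gt0 gt_eqF.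
have sq : sin theta <= q.
  have s0 : 0 <= sin theta by rewrite ltW// sin_gt0_pihalf// t0.
  rewrite /q/= ler_pdivlMr// (le_trans (ler_wpM2l s0 (normc_le a b)))//.
  by rewrite (gtr0_norm a0); lra.
have q1 : -1 <= q <= 1.
  rewrite /q -ler_norml normrM normfV (gtr0_norm n0) ler_pdivrMr// mul1r.
  exact: Re_le_normc.
have A : acos q <= pi / 2 - theta.
  rewrite leNgt; apply/negP => hq; have pi0 := pi_gt0 R.
  have : cos (acos q) < cos (pi / 2 - theta).
    rewrite ltr_cos// in_itv/= ?acos_ge0 ?acos_lepi//.
    by apply/andP; split; lra.
  rewrite acosK ?in_itv//= -cosN opprB cosBpihalf ltNge sq//.
case: ifP => _; rewrite ?normrN ger0_norm// acos_ge0//.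
Qed.

(** Set [d := x - phi]. The real part of [1 - e^(-y) e^(i d)] is at least [1 -
    e^(-y)], hence at least [y e^(-y)], and its imaginary part is at most [|d|
    e^(-y)]; so narrow cones of the half-plane are sent into Stolz regions. *)
Lemma cone_stolz theta phi x y : 0 < theta < pi / 2 -> 0 < y ->
  `|x - phi| < (1 - sin theta) * y -> stolz theta phi (polar (expR (- y)) x).
Proof.
move=> t01 y0 xy; split; first exact: disc_polar.
have /andP[t0 t1] := t01.
have e0 := expR_gt0 (- y).
pose d := x - phi; rewrite /mkset.
have -> : 1 - expi (- phi) * toC (polar (expR (- y)) x) =
    ((1 - expR (- y) * cos d) +i* (- (expR (- y) * sin d)))%C.
  rewrite /expi /toC /polar /= cosN sinN /d cosB sinB.
  by apply/eqP; rewrite eq_complex /=; apply/andP; split; apply/eqP; ring.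
have e1 : expR (- y) < 1 by rewrite expR_lt1 oppr_lt0.
have ce : expR (- y) * cos d <= expR (- y) by rewrite ler_piMr ?(ltW e0)// cos_le1.
have ye : expR (- y) * y <= 1 - expR (- y).
  have h : expR (- y) * expR y = 1 by rewrite -expRD addNr expR0.
  have := ler_wpM2l (ltW e0) (expR_ge1Dx y); rewrite h mulrDr mulr1; lra.
apply: carg_sector => //; first lra.
have s0 : 0 <= sin theta by rewrite ltW// sin_gt0_pihalf.
have s1 := sin_le1 theta.
rewrite normrN normrM (gtr0_norm e0).
have sd : `|sin d| <= (1 - sin theta) * y.
  have [_] := cos_sin_lip d 0; rewrite sin0 !subr0 => h; apply: le_trans h _.
  exact: ltW.
rewrite (@le_trans _ _ (1 * (expR (- y) * ((1 - sin theta) * y))))//.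
  by rewrite ler_pM ?mulr_ge0 ?(ltW e0)// ler_wpM2l ?(ltW e0).
rewrite mul1r mulrCA ler_wpM2l ?subr_ge0// (le_trans ye)//; lra.
Qed.

Lemma sin_lt1 theta : 0 < theta < pi / 2 -> sin theta < 1.
Proof.
move=> /andP[t0 t1]; have pi0 := pi_gt0 R.
rewrite -(sin_pihalf R) ltr_sin// in_itv/=; apply/andP; split; lra.
Qed.

End periodic_polar.

(** * Growth and integral conditions in polar coordinates *)

Section disc_data.
Variable R : realType.
Implicit Types (u : R * R -> R[i]) (f g v : R * R -> R) (a d e m r x y theta : R).

(** For [y < 1], the distance [1 - e^(-y)] to the circle lies between [y / 2]
    and [y], so that the growth becomes one in [y]. The exponent is made odd,
    for the estimates in the half-plane, and at least [m]. *)
Lemma growth_polar u m : charmonic_on (@disc R) u -> 0 <= m ->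
  circle_sup u =O_ ((1 : R)^'-) (fun r : R => (1 - r) `^ (- m)) ->
  exists (j : nat) (A : R), 0 <= A /\
    forall x y, 0 < y -> cmod (u (polar (expR (- y)) x)) <= A * blow j.*2.+1 1 y.
Proof.
move=> [[[C1r _ _] _] [[C1i _ _] _]] m0 /eqO_exP[k k0 [d /= d0 dP]].
pose j := Num.truncn m; exists j.
pose E := j.*2.+1; pose y1 := Num.min 1 d.
have y10 : 0 < y1 by rewrite lt_min ltr01.
have cr z : disc z -> {for z, continuous (fun z => complex.Re (u z))} by exact: C1_continuous.
have ci z : disc z -> {for z, continuous (fun z => complex.Im (u z))} by exact: C1_continuous.
have bd y0 : 0 < y0 -> exists2 K : R, 0 <= K & forall x y, y0 <= y ->
    cmod (u (polar (expR (- y)) x)) <= K.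
  move=> y00; have [K1 K10 h1] := bounded_polar cr y00; have [K2 K20 h2] := bounded_polar ci y00.
  exists (K1 + K2); first exact: addr_ge0.
  move=> x y yy; have := h1 x y yy; have := h2 x y yy.
  case: (u _) => p q /= hq hp.
  by rewrite (le_trans (normc_le _ _))// lerD.
have [K K0 KP] := bd y1 y10.
exists (k * 2 ^+ E + K); split; first by rewrite addr_ge0// mulr_ge0// ltW.
move=> x y y0; rewrite mulrDl; have b1 := blow_ge1 E 1 y.
have [yy|yy] := leP y1 y.
  rewrite (le_trans (KP x y yy))// (@le_trans _ _ (K * blow E 1 y))//.
    by rewrite ler_peMr.
  by rewrite lerDr mulr_ge0// ?mulr_ge0 ?blow_ge0// ltW.
rewrite (@le_trans _ _ (k * 2 ^+ E * blow E 1 y))//; last by rewrite lerDl mulr_ge0// blow_ge0.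
move: yy; rewrite lt_min => /andP[yl1 yd].
have e1 : expR (- y) < 1 by rewrite expR_lt1 oppr_lt0.
have e0 := expR_gt0 (- y).
have ey : 1 - expR (- y) <= y by have := expR_ge1Dx (- y); lra.
have ey2 : y / 2 <= 1 - expR (- y).
  have h : expR (- y) * expR y = 1 by rewrite -expRD addNr expR0.
  have := ler_wpM2l (ltW e0) (expR_ge1Dx y); rewrite h => h1.
  by nra.
have /dP h : `|1 - expR (- y)| < d by rewrite gtr0_norm ?subr_gt0// (le_lt_trans ey).
have {}h := h e1.
have sup_le : cmod (u (polar (expR (- y)) x)) <= circle_sup u (expR (- y)).
  have [q qP] := polar_reduce x.
  have [K' _ K'P] := bd y y0.
  apply: ub_le_sup.
    by exists K' => _ [phi _ <-]; exact: K'P.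
  exists (x - q%:~R * (2 * pi)); first by rewrite /= in_itv.
  by rewrite -[in RHS](subrK (q%:~R * (2 * pi)) x) polar_period.
rewrite (le_trans sup_le)// (le_trans (ler_norm _))// (le_trans h)//.
rewrite -mulrA ler_wpM2l ?(ltW k0)// powRN normfV ger0_norm ?powR_ge0//.
rewrite blow1_small; last by rewrite y0 ltW.
rewrite -[2 ^+ E]invrK -invfM -exprVn -exprMn.
have p0 : 0 < 2^-1 * y by rewrite mulr_gt0.
rewrite lef_pV2 ?posrE ?exprn_gt0//; last by rewrite powR_gt0// subr_gt0.
have w01 : 0 < 1 - expR (- y) <= 1 by rewrite subr_gt0 e1/= gerBl ltW.
apply: (@le_trans _ _ ((1 - expR (- y)) ^+ E)).
  rewrite lerXn2r ?nnegrE ?(ltW p0)//; first by rewrite ltW//; case/andP: w01.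
  by rewrite mulrC.
rewrite -powR_mulrn; last by rewrite ltW//; case/andP: w01.
apply: ger_powR => //; rewrite (le_trans (ltW (truncnS_gt m)))// ler_nat -/j.
by rewrite /E ltnS -addnn leq_addr.
Qed.

Lemma measurable_polar g y : 0 < y -> measurable_fun (@disc R) g ->
  measurable_fun setT (fun x => g (polar (expR (- y)) x)).
Proof.
move=> y0 mg.
have mp : measurable_fun setT (fun x : R => polar (expR (- y)) x).
  apply: measurable_fun_pair => /=.
    apply: measurable_funM => //; apply: continuous_measurable_fun; exact: continuous_cos.
  apply: measurable_funM => //; apply: continuous_measurable_fun; exact: continuous_sin.
apply: (measurable_comp (F := @disc R)) mg mp => //.
- have -> : @disc R = setT `&` (fun z : R * R => z.1 ^+ 2 + z.2 ^+ 2) @^-1` `]-oo, 1[.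
    by apply/seteqP; split => z; rewrite /= in_itv/=; [split => //; exact/disc_sqr|case=> _ ?; exact/disc_sqr].
  have ms : measurable_fun setT (fun z : R * R => z.1 ^+ 2 + z.2 ^+ 2).
    apply: measurable_funD; apply: measurable_funX; [exact: measurable_fst|exact: measurable_snd].
  by apply: ms => //; exact: measurable_itv.
- by move=> _ [x _ <-]; exact: disc_polar.
Qed.

(** An interval of length 2 is covered by two consecutive periods. *)
Lemma circle_integral_bound g : (forall z, disc z -> 0 <= g z) -> measurable_fun (@disc R) g ->
  (ereal_sup [set circle_integral g r | r in `]0%R, 1%R[ ] < +oo)%E ->
  exists K : R, forall a y, 0 < y ->
    (\int[@lebesgue_measure R]_(x in `[(a - 1)%R, (a + 1)%R]) (g (polar (expR (- y)) x))%:E <= K%:E)%E.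
Proof.
move=> g0 mg; set M := ereal_sup _ => Moo.
have ge0 x y : 0 < y -> (0 <= (g (polar (expR (- y)) x))%:E)%E.
  by move=> y0; rewrite lee_fin; apply/g0/disc_polar.
have cM y : 0 < y -> (circle_integral g (expR (- y)) <= M)%E.
  move=> y0; apply: ereal_sup_ubound; exists (expR (- y)) => //=.
  by rewrite in_itv/= expR_gt0 expR_lt1 oppr_lt0.
have M0 : (0 <= M)%E.
  apply: le_trans (cM 1 ltr01); apply: integral_ge0 => x _; exact: ge0.
have Mfin : M = (fine M)%:E by rewrite fineK// ge0_fin_numE.
exists (fine M + fine M) => a y y0.
pose G x := (g (polar (expR (- y)) x))%:E.
have mG : measurable_fun setT G by apply/measurable_EFinP; exact: measurable_polar.
have pi2 : 2 <= 2 * pi :> R by have := pi_ge2 R; lra.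
have period b (k : int) : b = k%:~R * (2 * pi) ->
    (\int[@lebesgue_measure R]_(x in `[b, (b + 2 * pi)%R]) G x <= M)%E.
  move=> bk; apply: le_trans (cM y y0); rewrite /circle_integral.
  rewrite -(integral_shift b (D := `[b, (b + 2 * pi)%R]%classic)).
  - rewrite (_ : [set t | _] = `[0, (2 * pi)%R]%classic); last first.
      by apply/seteqP; split => t /=; rewrite !in_itv/= lerDr (addrC b) lerD2r.
    rewrite le_eqVlt; apply/orP; left; apply/eqP.
    by apply: eq_integral => t _; rewrite /G bk polar_period.
  - exact: measurable_itv.
  - exact: measurable_funTS.
  - by move=> t _; exact: ge0.
have [k /andP[k1 k2]] := polar_reduce (a - 1).
set b := k%:~R * (2 * pi) in k1 k2.
pose A := `[b, (b + 2 * pi)%R]%classic : set R.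
pose B := `[(b + 2 * pi)%R, (b + 2 * pi + 2 * pi)%R]%classic : set R.
have mA : measurable A by exact: measurable_itv.
have mB : measurable B by exact: measurable_itv.
have mBA : measurable (B `\` A) by exact: measurableD.
have sub : `[a - 1, a + 1]%classic `<=` A `|` (B `\` A).
  move=> x /=; rewrite in_itv/= => /andP[x1 x2].
  have [Ax|nA] := pselect (A x); [by left|right; split => //].
  rewrite /B /= in_itv/=; apply/andP; split; last lra.
  rewrite leNgt; apply/negP => xb; apply: nA; rewrite /A /= in_itv/=; apply/andP; split; lra.
rewrite EFinD -Mfin.
apply: (@le_trans _ _ (\int[@lebesgue_measure R]_(x in A `|` (B `\` A)) G x)%E).
  apply: ge0_subset_integral => //.
  - exact: measurableU.
  - exact: measurable_funTS.
  - by move=> x _; exact: ge0.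
rewrite ge0_integral_setU//.
- rewrite leeD//; first exact: period.
  apply: (@le_trans _ _ (\int[@lebesgue_measure R]_(x in B) G x)%E).
    apply: ge0_subset_integral => //; first exact: measurable_funTS.
    by move=> x _; exact: ge0.
  apply: (period (b + 2 * pi) (k + 1)).
  by rewrite /b (intrD R k 1) -[(1%:~R : R)]/(1 : R); ring.
- exact: measurable_funTS.
- by move=> x _; exact: ge0.
- by apply/disj_setPS => x [Ax [_ nA]].
Qed.

Lemma cone_limit f theta e x : 0 < theta < pi / 2 ->
  (forall phi, 0 <= phi < 2 * pi ->
     f z @[z --> within (stolz theta phi) (nbhs (polar 1 phi))] --> 0) -> 0 < e ->
  exists2 n : R, 0 < n & forall x' y, `|x' - x| < (1 - sin theta) * y -> 0 < y < n ->
    f (polar (expR (- y)) x') <= e.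
Proof.
move=> t01 flim e0; have [k kP] := polar_reduce x.
set b := k%:~R * (2 * pi) in kP.
have /cvgrPdist_le/(_ _ e0) := flim _ kP.
rewrite near_withinE => /nbhs_ballP[d /= d0 dP].
have s1 := sin_lt1 t01; have c0 : 0 < 2 - sin theta by lra.
exists (d / (2 - sin theta)); first exact: divr_gt0.
move=> x' y xx /andP[y0 yd].
have -> : polar (expR (- y)) x' = polar (expR (- y)) (x' - b).
  by rewrite -[in LHS](subrK b x') polar_period.
have xb : `|x' - b - (x - b)| < (1 - sin theta) * y.
  by have -> : x' - b - (x - b) = x' - x by ring.
have [h1 h2] := polar_near (x - b) (x' - b) y0.
have yd' : y + `|x' - b - (x - b)| < d.
  rewrite ltr_pdivlMr// in yd; lra.
have := dP (polar (expR (- y)) (x' - b)) _ (cone_stolz t01 y0 xb).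
rewrite sub0r normrN => h; rewrite (le_trans (ler_norm _))// h//.
by split; rewrite /ball/= distrC; [exact: le_lt_trans h1 yd'|exact: le_lt_trans h2 yd'].
Qed.

Lemma polar_onto z : disc z -> z != 0 -> exists x y, 0 < y /\ z = polar (expR (- y)) x.
Proof.
move=> Dz z0; have tz : toC z != 0.
  by apply: contra z0; rewrite eq_complex /= => /andP[/eqP z1 /eqP z2]; apply/eqP; case: z Dz z1 z2 => a b _ /= -> ->.
have [zE _] := cargP tz.
have n0 : 0 < cmod (toC z).
  rewrite lt_neqAle sqrtr_ge0 andbT eq_sym; apply: contra tz => /eqP h.
  by rewrite zE h mul0r.
exists (carg (toC z)), (- ln (cmod (toC z))); split.
  by rewrite oppr_gt0 ln_lt0// n0.
rewrite opprK lnK ?posrE//; move: zE; case: z {Dz z0 tz} n0 => a b n0.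
set n := cmod _ in n0 *; set t := carg _; rewrite /toC /expi /= => /eqP.
rewrite eq_complex /= !mul0r subr0 addr0 => /andP[/eqP h1 /eqP h2].
by rewrite /polar -h1 -h2.
Qed.

(** [half_plane_uniqueness] for [v] in polar coordinates, with [f] bounded by
    [e] in cones by [cone_limit]. *)
Lemma harmonic_uniqueness v f g theta (j : nat) A : harmonic_on (@disc R) v ->
  (forall z, disc z -> 0 <= f z) -> (forall z, disc z -> 0 <= g z) -> 0 < theta < pi / 2 ->
  measurable_fun (@disc R) g -> (forall z, disc z -> `|v z| <= f z * g z) ->
  (forall phi, 0 <= phi < 2 * pi ->
     f z @[z --> within (stolz theta phi) (nbhs (polar 1 phi))] --> 0) ->
  (ereal_sup [set circle_integral g r | r in `]0%R, 1%R[ ] < +oo)%E ->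
  0 <= A -> (forall x y, 0 < y -> `|v (polar (expR (- y)) x)| <= A * blow j.*2.+1 1 y) ->
  forall z, disc z -> v z = 0.
Proof.
move=> hv f0 g0 t01 mg vfg flim gsup A0 vA.
have [[C1v C1v1 C1v2] Lv] := hv.
have [Ut [Uy [Utt hU]]] : exists Ut Uy Utt, bharmonic (polar_fun v) Ut Uy Utt.
  apply: (@bharmonic_polar R v (fun z => 'D_(e1 R) v z) (fun z => 'D_(e2 R) v z)
    (fun z => 'D_(e1 R) (fun w => 'D_(e1 R) v w) z) (fun z => 'D_(e2 R) (fun w => 'D_(e1 R) v w) z)
    (fun z => 'D_(e1 R) (fun w => 'D_(e2 R) v w) z) (fun z => 'D_(e2 R) (fun w => 'D_(e2 R) v w) z)).
  - exact: (C1_curve_gradient C1v).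
  - exact: (C1_curve_gradient C1v1).
  - exact: (C1_curve_gradient C1v2).
  - move=> z Dz; have h := C1_partials C1v Dz.
    exact: (And3 (C1_continuous C1v Dz) h.1 h.2).
  - by move=> z Dz; exact: (C1_partials C1v1 Dz).
  - by move=> z Dz; exact: (C1_partials C1v2 Dz).
  - exact: Lv.
have [K KP] := circle_integral_bound g0 mg gsup.
have s1 : 0 < 1 - sin theta by rewrite subr_gt0 sin_lt1.
have v0 x y : 0 < y -> v (polar (expR (- y)) x) = 0.
  apply: (@half_plane_uniqueness R (polar_fun v) Ut Uy Utt j A hU A0 vA
    (fun x y => g (polar (expR (- y)) x)) (1 - sin theta) K s1) => //.
  - by move=> x' y' y0; apply/g0/disc_polar.
  - by move=> y' y0; exact: measurable_polar.
  - move=> e x' e0; have [n n0 nP] := cone_limit x' t01 flim e0.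
    exists n => // x'' y'' xx yn; have /andP[y0 _] := yn.
    have Dp := disc_polar x'' y0.
    by rewrite (le_trans (vfg _ Dp))// ler_wpM2r ?g0// nP.
have vz z : disc z -> z != 0 -> v z = 0.
  by move=> Dz z0; have [x [y [y0 ->]]] := polar_onto Dz z0; exact: v0.
move=> z Dz; have [z0|] := eqVneq z 0; last exact: vz.
(* The origin is not reached by polar coordinates. *)
apply/eqP; rewrite -normr_le0; apply/ler_addgt0Pr => e e0; rewrite add0r.
have [d1 d10 D1] := disc_box Dz; have [d2 d20 D2] := continuous_box (C1_continuous C1v Dz) e0.
pose d := Num.min d1 d2 / 2.
have m0 : 0 < Num.min d1 d2 by rewrite lt_min d10.
have m1 : Num.min d1 d2 <= d1 by rewrite ge_min lexx.
have m2 : Num.min d1 d2 <= d2 by rewrite ge_min lexx orbT.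
have d0 : 0 < d by rewrite divr_gt0.
pose w : R * R := (d, 0).
have w1 : `|w.1 - z.1| = d by rewrite z0 /= subr0 gtr0_norm.
have w2 : `|w.2 - z.2| = 0 by rewrite z0 /= subr0 normr0.
have Dw : disc w by apply: D1; rewrite ?w1 ?w2// /d; lra.
have wn : w != 0 by apply/eqP => -[] h; move: d0; rewrite h ltxx.
have := D2 w; rewrite w1 w2 (vz w Dw wn) sub0r normrN; apply => //.
by rewrite /d; lra.
Qed.

End disc_data.

(** * The uniqueness theorem *)

Theorem theorem1p4 (R : realType) (u : R * R -> R[i])
  (u_harmonic : charmonic_on (@disc R) u)
  (H1 : exists (f g : R * R -> R) (theta : R),
      (forall z, disc z -> 0 <= f z) /\
      (forall z, disc z -> 0 <= g z) /\
      0 < theta < pi / 2 /\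
      lower_semicontinuous (fun z : subspace (@disc R) => (f z)%:E) /\
      measurable_fun (@disc R) g /\
      (forall z, disc z -> cmod (u z) <= f z * g z) /\
      (forall phi, 0 <= phi < 2 * pi ->
        f z @[z --> within (stolz theta phi) (nbhs (polar 1 phi))] --> 0) /\
      (ereal_sup [set circle_integral g r | r in `]0%R, 1%R[ ] < +oo)%E)
  (H2 : exists m : R, 0 <= m /\
      circle_sup u =O_ ((1 : R)^'-) (fun r : R => (1 - r) `^ (- m))) :
  forall z, disc z -> u z = 0.
Proof.
have [f [g [theta [f0 [g0 [t01 [_ [mg [ufg [flim gsup]]]]]]]]]] := H1.
have [m [m0 um]] := H2; have [hr hi] := u_harmonic.
have [j [A [A0 uA]]] := growth_polar u_harmonic m0 um.
have re0 : forall z, disc z -> complex.Re (u z) = 0.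
  apply: (harmonic_uniqueness (f := f) (g := g) (j := j) hr f0 g0 t01 mg _ flim gsup A0).
    by move=> z Dz; exact: le_trans (Re_le_normc _) (ufg z Dz).
  by move=> x y y0; exact: le_trans (Re_le_normc _) (uA x y y0).
have im0 : forall z, disc z -> complex.Im (u z) = 0.
  apply: (harmonic_uniqueness (f := f) (g := g) (j := j) hi f0 g0 t01 mg _ flim gsup A0).
    by move=> z Dz; exact: le_trans (Im_le_normc _) (ufg z Dz).
  by move=> x y y0; exact: le_trans (Im_le_normc _) (uA x y y0).
by move=> z Dz; move: (re0 z Dz) (im0 z Dz); case: (u z) => a b /= -> ->.
Qed.
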